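(* Suppose $F/\mathbb{Q}_p$ is ramified (i.e. $e\ge2$), and let $\chi=\det^s\cdot\chi_r$ be a character of $B(\mathcal{O}/\mathfrak{m}^2)$. The Jordan-Hölder constituents of $I_2(\chi)$ (with multiplicity) are parametrized by the set of types, which is a (possibly proper) subset of the set of pairs $(I,\gamma)$ with $I\subseteq\mathbb{Z}/f\mathbb{Z}$ and $\gamma\in\widetilde{\mathbb{N}}$; the constituent parametrized by the type $(I,\gamma)$ is $L(I,\gamma)$. Moreover, for types $(I,\gamma)$ and $(I',\gamma')$ one has $V_{(I',\gamma')}\subseteq V_{(I,\gamma)}$ if and only if $(I',\gamma')\le_\chi(I,\gamma)$, and the multiset of Jordan-Hölder constituents of $V_{(I,\gamma)}$ is $\{L(I',\gamma'):(I',\gamma')\le_\chi(I,\gamma)\}$. Moreover, except in the case where $I=\mathbb{Z}/f\mathbb{Z}$ and $r-2\gamma=q-1$ in $\widetilde{\mathbb{N}}$, the submodule $V_{(I,\gamma)}$ has irreducible cosocle $L(I,\gamma)$.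
   Context: Let $p$ be an odd prime, $F/\mathbb{Q}_p$ a finite extension with valuation ring $\mathcal{O}$, maximal ideal $\mathfrak{m}$, uniformizer $\varpi$, ramification index $e$, and residue field $k$ of cardinality $q=p^f$. All representations are over an extension field $E$ of $k$. $B\le\mathrm{GL}_2$ is the upper triangular subgroup. Every $\lambda\in\mathcal{O}/\mathfrak{m}^2$ is written uniquely as $\lambda=[\lambda_0]+[\lambda_1]\varpi$ with $\lambda_i\in k$, $[\cdot]$ being the Teichmüller lift. Monoid. $\widetilde{\mathbb{N}}$ is the quotient monoid of $(\mathbb{N}\cup\{0\},+)$ by: $a\sim b$ iff $a=b=0$, or $a,b>0$ and $a\equiv b\bmod q-1$ (so $x^\alpha$ makes sense for $x\in k$, with $0^0=1$). Each $\alpha\in\widetilde{\mathbb{N}}$ contains a unique integer $\sum_{i=0}^{f-1}\alpha_ip^i$ with digits $0\le\alpha_i\le p-1$; indices are in $\mathbb{Z}/f\mathbb{Z}$. $\widetilde{\mathbb{N}}\setminus\{0\}$ is identified with $\mathbb{Z}/(q-1)\mathbb{Z}$. Write $\alpha\preceq\beta$ iff $\alpha_i\le\beta_i$ for all $i$; then $\beta\ominus\alpha$ has digits $\beta_i-\alpha_i$. For $a\ne0$, $a-b$ is the unique $c\in\widetilde{\mathbb{N}}\setminus\{0\}$ with $b+c=a$. Carry sets. For $\alpha,\beta\in\widetilde{\mathbb{N}}$, $I(\alpha,\beta)\subseteq\mathbb{Z}/f\mathbb{Z}$ is the unique subset such that for all $i$: $\alpha_i+\beta_i\le p-1$ if $i-1,i\notin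 I(\alpha,\beta)$; $\alpha_i+\beta_i\le p-2$ if $i-1\in I(\alpha,\beta)$, $i\notin I(\alpha,\beta)$; $\alpha_i+\beta_i\ge p$ if $i-1\notin I(\alpha,\beta)$, $i\in I(\alpha,\beta)$; $\alpha_i+\beta_i\ge p-1$ if $i-1,i\in I(\alpha,\beta)$; and $I(\alpha,\beta)=\varnothing$ if $\alpha_i+\beta_i=p-1$ for all $i$. Representation and basis. Every character $\chi$ of $B(\mathcal{O}/\mathfrak{m}^2)$ factors through $B(k)$ and is uniquely $\chi=\det^s\cdot\chi_r$ with $s,r\in\mathbb{Z}/(q-1)\mathbb{Z}$, where $\det$ is followed by reduction to $k^\times$ and $\chi_r\begin{pmatrix}a&b\\0&d\end{pmatrix}=(d\bmod\mathfrak{m})^r$; view $r\in\widetilde{\mathbb{N}}\setminus\{0\}$. $I_2(\chi)=\mathrm{Ind}_{B(\mathcal{O}/\mathfrak{m}^2)}^{\mathrm{GL}_2(\mathcal{O}/\mathfrak{m}^2)}\chi$ is the space of functions $\varphi$ with $\varphi(bg)=\chi(b)\varphi(g)$, under right translation; it is identified with $\det^s\otimes I_2(\chi_r)$ via $\det(g)^s\varphi(g)\leftrightarrow\varphi(g)$. In $I_2(\chi_r)$, $g\otimes v$ is the function supported on $B(\mathcal{O}/\mathfrak{m}^2)g^{-1}$ with value $\chi_r(b)v$ at $bg^{-1}$. For $(j_0,j_1)\in\widetilde{\mathbb{N}}^2$ put $f_{(j_0,j_1)}=\sum_{\lambda\in\mathcal{O}/\mathfrak{m}^2}\begin{pmatrix}\lambda&1\\1&0\end{pmatrix}\otimes\lambda_0^{j_0}\lambda_1^{j_1}$,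 and $f_{(\infty,j_1)}=wf_{(0,j_1)}$ with $w=\begin{pmatrix}0&1\\1&0\end{pmatrix}$ acting on $I_2(\chi_r)$. With $\Theta=(\widetilde{\mathbb{N}}\cup\{\infty\})\times\widetilde{\mathbb{N}}$, the set $\mathcal{B}=\{f_{(j_0,j_1)}:(j_0,j_1)\in\Theta\}$ is a basis of $I_2(\chi_r)$, hence of $I_2(\chi)$. Types. Let $\le_r$ be the smallest preorder on $\Theta$ such that, for $m\in\{0,\dots,f-1\}$ and $j_1\in\widetilde{\mathbb{N}}$: (1) $(j_0\ominus p^m,j_1)\le_r(j_0,j_1)$ if $j_0\in\widetilde{\mathbb{N}}$, $p^m\preceq j_0$; (2) $(j_0,j_1\ominus p^m)\le_r(j_0,j_1)$ if $j_0\in\widetilde{\mathbb{N}}$, $p^m\preceq j_1$; (3) $(j_0+p^m,j_1\ominus p^m)\le_r(j_0,j_1)$ if $j_0\in\widetilde{\mathbb{N}}$, $p^m\preceq j_1$; (4) $(r-2j_1-j_0,j_1)\le_r(j_0,j_1)$ if $j_0\notin\{0,\infty\}$; (5) $(r-2j_1,j_1\ominus p^m)\le_r(\infty,j_1)$ if $p^m\preceq j_1$; (6) $((r-2j_1)\ominus p^m,j_1)\le_r(\infty,j_1)$ if $p^m\preceq r-2j_1$; (7) $(0,j_1)\le_r(\infty,j_1)$ and $(\infty,j_1)\le_r(0,j_1)$. Two elements are equivalent if each is $\le_r$ the other. A type is an equivalence class; $\le_r$ induces a partial order on types, denoted $\le_\chi$. The class of $(j_0,j_1)$ is encoded by the pair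 $(I(j_0',r-2j_1-j_0'),j_1)$ for any representative $(j_0',j_1)$ with $j_0'\in\widetilde{\mathbb{N}}$; this encoding is well defined and injective, and types are written as such pairs $(I,\gamma)$. $V_{(I,\gamma)}$ is the span of the $f_{(j_0,j_1)}\in\mathcal{B}$ with type of $(j_0,j_1)$ $\le_\chi(I,\gamma)$; these are $\mathrm{GL}_2(\mathcal{O}/\mathfrak{m}^2)$-submodules when $e\ge2$. Put $L(I,\gamma)=V_{(I,\gamma)}/\sum_{(I',\gamma')<_\chi(I,\gamma)}V_{(I',\gamma')}$. *)

(* Defs.v *)
From HB Require Import structures.
From mathcomp Require Import all_boot all_order all_algebra.
From mathcomp Require Import all_fingroup fieldext mxrepresentation.

Set Implicit Arguments.
Unset Strict Implicit.
Unset Printing Implicit Defensive.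

Import Order.TTheory GRing.Theory Num.Theory.

Local Open Scope ring_scope.

(* K, with absolute value abs, is Q_p: the completion of the rationals for    *)
(* the p-adic absolute value.                                                 *)
Record is_padic_field (p : nat) (K : fieldType) (abs : K -> rat) : Prop := {
  padic_ge0 : forall x, 0 <= abs x;
  padic_eq0 : forall x, (abs x == 0) = (x == 0);
  padic_mul : forall x y, abs (x * y) = abs x * abs y;
  padic_add : forall x y, abs (x + y) <= Num.max (abs x) (abs y);
  padic_nat : forall n : nat, (0 < n)%N -> abs n%:R = p%:R ^- logn p n;
  padic_dense : forall (x : K) (eps : rat), 0 < eps ->
    exists c : rat, abs (x - ratr c) < eps;
  padic_complete : forall u : nat -> K,
    (forall eps : rat, 0 < eps -> exists N : nat,
       forall m n : nat, (N <= m)%N -> (N <= n)%N -> abs (u m - u n) < eps) ->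
    exists l : K, forall eps : rat, 0 < eps -> exists N : nat,
       forall n : nat, (N <= n)%N -> abs (u n - l) < eps
}.

(* v is the normalised discrete valuation of the finite extension F of Q_p;   *)
(* the value v 0 is irrelevant (mathematically, it is +oo).  As |p| = p^-1,   *)
(* the last field says that the restriction of v to Q_p is e times the p-adic *)
(* valuation, i.e., that e is the ramification index.                         *)
Record is_valuation (p : nat) (Qp : fieldType) (abs : Qp -> rat)
    (F : fieldExtType Qp) (v : F -> int) (e : nat) : Prop := {
  val_mul : forall x y, x != 0 -> y != 0 -> v (x * y) = v x + v y;
  val_add : forall x y, x != 0 -> y != 0 -> x + y != 0 ->
    Num.min (v x) (v y) <= v (x + y);
  val_onto : exists2 x, x != 0 & v x = 1;
  val_ramified : forall (x : Qp) (n : int),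
    abs x = p%:R ^ n -> v x%:A = - (e%:Z * n)
}.

Section ValuationRing.

Variables (F : fieldType) (v : F -> int).

(* Membership in the n-th power of the maximal ideal; for n = 0 this is the   *)
(* valuation ring itself.                                                     *)
Definition in_pow_ideal (n : nat) (x : F) := (x == 0) || (n%:Z <= v x).

Definition in_valring := in_pow_ideal 0.

(* pi identifies A with O/m^n; the values of pi outside O are irrelevant.     *)
Record is_quotient (n : nat) (A : nzRingType) (pi : F -> A) : Prop := {
  quot_one : pi 1 = 1;
  quot_add : forall x y, in_valring x -> in_valring y ->
    pi (x + y) = pi x + pi y;
  quot_mul : forall x y, in_valring x -> in_valring y ->
    pi (x * y) = pi x * pi y;
  quot_onto : forall a, exists2 x, in_valring x & pi x = a;
  quot_ker : forall x, in_valring x -> (pi x == 0) = in_pow_ideal n x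
}.

(* The Teichmueller lift is the unique multiplicative section of O -> k.      *)
Record is_teichmuller (k : nzRingType) (pik : F -> k) (teich : k -> F) :
    Prop := {
  teich_int : forall x, in_valring (teich x);
  teichK : forall x, pik (teich x) = x;
  teichM : forall x y, teich (x * y) = teich x * teich y
}.

End ValuationRing.

Section ExponentMonoid.

Local Open Scope nat_scope.

Variables p f : nat.
Local Notation q := (p ^ f).

(* The quotient monoid of exponents: each class is represented by its unique  *)
(* element in {0, ..., q - 1}.  The additive structure that MathComp puts on  *)
(* 'I_n.+1 is addition modulo q and must not be used here.                    *)
Definition expo := 'I_q.-1.+1.

Definition to_expo (n : nat) : expo :=
  inord (if n == 0 then 0 else (n.-1 %% q.-1).+1).

Lemma to_expo_val n : 1 < q ->
  to_expo n = (if n == 0 then 0 else (n.-1 %% q.-1).+1) :> nat.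
Proof.
move=> q1; rewrite inordK //; case: ifP => // _.
by rewrite ltnS ltn_mod -subn1 subn_gt0.
Qed.

Lemma to_expo_eq a b : 1 < q ->
  (to_expo a == to_expo b) =
  (a == 0) && (b == 0) || [&& 0 < a, 0 < b & a == b %[mod q.-1]].
Proof.
move=> q1; rewrite -val_eqE /= !to_expo_val //.
case: a b => [|a] [|b] //=; rewrite eqSS -(eqn_modDr 1) !addn1.
by [].
Qed.

Lemma to_expoK (a : expo) : 1 < q -> to_expo a = a.
Proof.
move=> q1; apply/val_inj; rewrite /= to_expo_val //.
case: a => [[|a] la] //=; rewrite modn_small //.
Qed.

Definition expo_add (a b : expo) : expo := to_expo (a + b).

(* a - b, for a <> 0. *)
Definition expo_sub (a b : expo) : expo :=
  odflt ord0 [pick c : expo | (c != ord0) && (expo_add b c == a)].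

Definition digit (a : expo) (i : 'I_f) : nat := (a %/ p ^ i) %% p.

Definition digit_le (a b : expo) : bool :=
  [forall i : 'I_f, digit a i <= digit b i].

(* b (-) a, for a, b such that digit_le a b. *)
Definition digit_sub (b a : expo) : expo :=
  to_expo (\sum_(i < f) (digit b i - digit a i) * p ^ i).

Definition carry_spec (a b : expo) (I : {set 'I_f}) : bool :=
  [forall i : 'I_f,
     let s := digit a i + digit b i in
     match ord_pred i \in I, i \in I with
     | false, false => s <= p - 1
     | true, false => s <= p - 2
     | false, true => p <= s
     | true, true => p - 1 <= s
     end]
  && ([forall i : 'I_f, digit a i + digit b i == p - 1] ==> (I == set0)).

(* I(a, b), the unique set satisfying carry_spec. *)
Definition carry (a b : expo) : {set 'I_f} :=
  odflt set0 [pick I | carry_spec a b I].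

(* None stands for the symbol oo. *)
Definition theta := (option expo * expo)%type.

Variable r : expo.

(* r - 2 j *)
Definition expo_r2 (j : expo) : expo := expo_sub r (expo_add j j).

(* theta_step x y: the relation x <=_r y is one of the defining ones, with    *)
(* the larger element y as second argument.                                   *)
Definition theta_step (x y : theta) : bool :=
  let pw (m : 'I_f) := to_expo (p ^ m) in
  let j1 := y.2 in
  match y.1 with
  | Some j0 =>
    [|| [exists m : 'I_f, digit_le (pw m) j0
                       && (x == (Some (digit_sub j0 (pw m)), j1))],
        [exists m : 'I_f, digit_le (pw m) j1
                       && (x == (Some j0, digit_sub j1 (pw m)))],
        [exists m : 'I_f, digit_le (pw m) j1
                       && (x == (Some (expo_add j0 (pw m)),
                                 digit_sub j1 (pw m)))],
        (j0 != ord0) && (x == (Some (expo_sub (expo_r2 j1) j0), j1)) |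
        (j0 == ord0) && (x == (None, j1))]
  | None =>
    [|| [exists m : 'I_f, digit_le (pw m) j1
                       && (x == (Some (expo_r2 j1), digit_sub j1 (pw m)))],
        [exists m : 'I_f, digit_le (pw m) (expo_r2 j1)
                       && (x == (Some (digit_sub (expo_r2 j1) (pw m)), j1))] |
        x == (Some ord0, j1)]
  end.

(* The reflexive transitive closure, i.e., the preorder generated. *)
Definition theta_le (x y : theta) : bool := connect theta_step x y.

(* The pair encoding the equivalence class of x; the class of (oo, j1) is     *)
(* that of (0, j1).                                                           *)
Definition theta_class (x : theta) : {set 'I_f} * expo :=
  let j0 := odflt ord0 x.1 in
  (carry j0 (expo_sub (expo_r2 x.2) j0), x.2).

(* A type, i.e., a class of theta for the equivalence relation defined by     *)
(* theta_le, is given by the pair (I, gamma) that encodes it.                 *)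
Record ktype := KType {
  ktype_pair : {set 'I_f} * expo;
  ktype_pairP : ktype_pair \in [set theta_class x | x : theta]
}.

HB.instance Definition _ := [isSub for ktype_pair].
HB.instance Definition _ := [Finite of ktype by <:].

Lemma theta_class_ktype (x : theta) :
  theta_class x \in [set theta_class y | y : theta].
Proof. exact: imset_f. Qed.

Definition theta_ktype (x : theta) : ktype :=
  KType (theta_class_ktype x).

Definition ktype_le (t u : ktype) : bool :=
  [exists x : theta, exists y : theta,
     [&& theta_ktype x == t, theta_ktype y == u & theta_le x y]].

Definition ktype_lt (t u : ktype) : bool := (t != u) && ktype_le t u.

End ExponentMonoid.

(* A function phi on the finite group G is the row vector of its values.  In  *)
(* MathComp, representations act on row vectors on the right.  The left       *)
(* action by right translation, (x phi)(g) = phi (g x), therefore corresponds *)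
(* to the right action phi |-> x^-1 phi, which is the library's regular       *)
(* representation (fun_row_regular); both have the same submodules.           *)
Section Functions.

Variables (E : fieldType) (gT : finGroupType) (G : {group gT}).

Definition fun_row (phi : gT -> E) : 'rV[E]_#|G| := \row_i phi (enum_val i).

Lemma fun_row_regular (phi : gT -> E) x : x \in G ->
  fun_row phi *m regular_repr E G x = fun_row (fun g => phi (g * x^-1)%g).
Proof.
move=> Gx; apply/rowP=> j; rewrite !mxE.
have Gj : (enum_val j * x^-1 \in G)%g by rewrite groupM ?groupV ?enum_valP.
rewrite (bigD1 (gring_index G (enum_val j * x^-1)%g)) //= !mxE.
rewrite gring_indexK // mulgKV gring_valK !eqxx mulr1.
rewrite big1 ?addr0 // => i ne_i; rewrite !mxE eqxx /=.
case: eqP => [Ej|]; last by rewrite mulr0.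
case/eqP: ne_i.
by rewrite Ej gring_indexK ?groupM ?enum_valP // mulgK gring_valK.
Qed.

(* phi |-> (g |-> phi (b g)) *)
Definition left_trans (b : gT) : 'M[E]_#|G| :=
  \matrix_(i, j) (enum_val i == b * enum_val j)%g%:R.

Lemma fun_row_left_trans (phi : gT -> E) b : b \in G ->
  fun_row phi *m left_trans b = fun_row (fun g => phi (b * g)%g).
Proof.
move=> Gb; apply/rowP=> j; rewrite !mxE.
have Gj : (b * enum_val j \in G)%g by rewrite groupM ?enum_valP.
rewrite (bigD1 (gring_index G (b * enum_val j)%g)) //= !mxE.
rewrite gring_indexK // eqxx mulr1.
rewrite big1 ?addr0 // => i ne_i; rewrite !mxE.
case: eqP => [Ei|]; last by rewrite mulr0.
by case/eqP: ne_i; rewrite -Ei gring_valK.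
Qed.

(* The space of functions phi such that phi (b g) = chi b * phi g for b in B. *)
Definition induced (B : {set gT}) (chi : gT -> E) : 'M[E]_#|G| :=
  (\bigcap_(b in B) eigenspace (left_trans b) (chi b))%MS.

Lemma inducedP (B : {set gT}) (chi phi : gT -> E) : B \subset G ->
  reflect {in B & G, forall b g, phi (b * g)%g = chi b * phi g}
          (fun_row phi <= induced B chi)%MS.
Proof.
move=> /subsetP sBG; apply: (iffP sub_bigcapmxP) => [ind b g Bb Gg | ind b Bb].
  have /eigenspaceP := ind b Bb; rewrite fun_row_left_trans ?sBG //.
  by move/rowP/(_ (gring_index G g)); rewrite !mxE gring_indexK.
apply/eigenspaceP; rewrite fun_row_left_trans ?sBG //.
by apply/rowP=> j; rewrite !mxE ind // enum_valP.
Qed.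

End Functions.

Section Constituents.

Variables (E : fieldType) (gT : finGroupType) (G : {group gT}).
Variables (n : nat) (rG : mx_representation E G n).

(* The multiset of Jordan-Hoelder constituents of W is {L t : t in S}: the    *)
(* factors of a composition series of W (any one, by mx_JordanHolder) are in  *)
(* bijection with S, that of index i being isomorphic to L (h i).             *)
Definition JH_constituents (W : 'M[E]_n) (T : finType) (S : {set T})
    (d : T -> nat) (L : forall t : T, mx_representation E G (d t)) : Prop :=
  exists (U : seq 'M[E]_n) (compU : mx_composition_series rG U),
    (last 0 U :=: W)%MS /\
    exists h : 'I_(size U) -> T,
      [/\ injective h, [set h i | i : 'I_(size U)] = S
        & forall i : 'I_(size U), mx_rsim (series_repr i compU) (L (h i))].

(* R is the radical of W: the intersection of W with all its maximal proper   *)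
(* submodules.                                                                *)
Definition is_radical (W R : 'M[E]_n) : Prop :=
  forall u : 'rV[E]_n, (u <= R)%MS <->
    (u <= W)%MS /\
    (forall M : 'M[E]_n, mxmodule rG M -> max_submod rG M W -> (u <= M)%MS).

(* The cosocle W / rad W is irreducible, and isomorphic to L. *)
Definition irreducible_cosocle (W : 'M[E]_n) (modW : mxmodule rG W)
    (d : nat) (L : mx_representation E G d) : Prop :=
  exists (R : 'M[E]_n) (modR : mxmodule rG R),
    [/\ is_radical W R, mx_irreducible (section_repr modR modW)
      & mx_rsim (section_repr modR modW) L].

End Constituents.

Section PrincipalSeries.

Variables (p f : nat) (A : finComUnitRingType) (k : finFieldType).
Variables (E : fieldType) (iota : k -> E).
(* The reduction O/m^2 -> k, and the images in O/m^2 of the Teichmueller lift *)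
(* and of the uniformiser.                                                    *)
Variables (red : A -> k) (teich : k -> A) (varpi : A).

Local Notation gT := {'GL_2[A]}.
Local Notation G := 'GL_2[A]%G.
Local Notation rG := (regular_repr E G).

Definition borel : {set gT} := [set b : gT | GLval b 1 0 == 0].

(* (l_0, l_1) such that l = [l_0] + [l_1] varpi *)
Definition teich_coord (l : A) : k * k :=
  odflt (0, 0) [pick c : k * k | teich c.1 + teich c.2 * varpi == l].

Definition lam_mx (l : A) : 'M[A]_2 :=
  \matrix_(i, j) (if i == 0 then if j == 0 then l else 1
                  else if j == 0 then 1 else 0).

Lemma lam_mx_unit l : lam_mx l \is a GRing.unit.
Proof.
pose M : 'M[A]_2 := \matrix_(i, j) (if i == 0 then if j == 0 then 0 else 1
                                    else if j == 0 then 1 else - l).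
suff /mulmx1_unit[] : lam_mx l *m M = 1%:M by [].
apply/matrixP=> i j; rewrite !mxE !big_ord_recl big_ord0 !mxE /=.
case: i j => [[|[|//]] ?] [[|[|//]] ?] /=;
  by rewrite !(mulr0, mulr1, mul1r, mul0r, addr0, add0r) ?subrr.
Qed.

(* The matrix (l 1; 1 0); for l = 0 this is w. *)
Definition lam_GL (l : A) : gT := Sub (lam_mx l) (lam_mx_unit l).

Variables s r : expo p f.

Definition chi_r (b : gT) : E := iota (red (GLval b 1 1)) ^+ r.

Definition det_s (g : gT) : E := iota (red (\det (GLval g))) ^+ s.

Definition chi (b : gT) : E := det_s b * chi_r b.

Definition I2 : 'M[E]_#|G| := induced G borel chi.

(* The function g (x) c of I_2(chi_r), evaluated at h. *)
Definition otimes (g : gT) (c : E) (h : gT) : E :=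
  if (h * g)%g \in borel then chi_r (h * g)%g * c else 0.

Definition f_fin (j0 j1 : expo p f) (h : gT) : E :=
  \sum_(l : A) otimes (lam_GL l)
    (iota (teich_coord l).1 ^+ j0 * iota (teich_coord l).2 ^+ j1) h.

Definition f_theta (x : theta p f) (h : gT) : E :=
  match x.1 with
  | Some j0 => f_fin j0 x.2 h
  | None => f_fin ord0 x.2 (h * lam_GL 0)%g
  end.

(* The basis vector of I_2(chi) = det^s (x) I_2(chi_r). *)
Definition f_chi (x : theta p f) : 'rV[E]_#|G| :=
  fun_row G (fun h => det_s h * f_theta x h).

Definition Vmod (t : ktype r) : 'M[E]_#|G| :=
  (\sum_(x : theta p f | ktype_le (theta_ktype r x) t) <<f_chi x>>)%MS.

Definition Vlt (t : ktype r) : 'M[E]_#|G| :=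
  (\sum_(u : ktype r | ktype_lt u t) Vmod u)%MS.

Lemma Vlt_module (modV : forall t, mxmodule rG (Vmod t)) t :
  mxmodule rG (Vlt t).
Proof. by apply: sumsmx_module => u _; apply: modV. Qed.

(* V_t / V_{< t} *)
Definition Lrep (modV : forall t, mxmodule rG (Vmod t)) (t : ktype r) :=
  section_repr (Vlt_module modV t) (modV t).

End PrincipalSeries.

(* Main.v *)
Require Import Defs.
From HB Require Import structures.
From mathcomp Require Import all_boot all_order all_algebra.
From mathcomp Require Import all_fingroup fieldext mxrepresentation.
From mathcomp Require Import finfield mxabelem cyclic pgroup.
From mathcomp Require Import zify ring.
Import Order.TTheory GRing.Theory Num.Theory.
Local Open Scope ring_scope.

Set Implicit Arguments.
Unset Strict Implicit.
Unset Printing Implicit Defensive.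

(** Since e >= 2, the prime p vanishes in A = O/m^2. The map a |-> a^q is then
    additive, which makes the Teichmueller lift a ring morphism and A the ring
    k[w] with w^2 = 0 (quotient_dual_numbers).

    A function in I_2(chi) depends, apart from the factor det^s, on the bottom row
    (X + X' w, Y + Y' w) of the matrix. The Borel subgroup multiplies X and Y by a
    scalar d, and D = X Y' - X' Y by d^2. So the monomials X^a Y^b D^j with
    a + b + 2 j = r modulo q - 1 give elements of I_2(chi), and up to signs the
    vectors f_(j0,j1) are such monomials: b = j0 and j = j1, or a = 0 at oo
    (f_chiE). They form a basis, because every function on k is a unique
    polynomial of degree below q (basis_row_free, I2_span).

    GL_2(A) is generated by the Weyl element, a torus, which scales the monomials,
    and the families Y |-> Y + c X, D |-> D + c X^2 and D |-> D + c X Y. When a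
    monomial is expanded along one of these families, the coefficient of c^i is a
    binomial coefficient, which by Lucas is nonzero modulo p exactly when i is
    digitwise below the exponent. Splitting such an i into units of digits gives
    the generating relations of the preorder, rewritten for monomials
    (theta_stepP). So down-sets span submodules (ideal_module). Conversely,
    summing a polynomial orbit map over c in k with weights c^(q-1-b) isolates its
    coefficient of c^b (coef_opE), so a submodule containing a basis vector
    contains all those below it (module_le).

    The equivalence classes are found by invariants. For each i, consider the
    degree in X and Y of the monomial raised to the p^(f-1-i)-th power, with
    exponents reduced modulo q - 1 (twdeg). Going down in the preorder lowers the
    exponent of D, or keeps it and does not raise any of these degrees. They are
    known modulo q - 1 from j, and the carry set says which of them exceed q - 1
    (theta_classE), so the pair (I, j) is an invariant. Within a class the digit
    sums a_i + b_i are constant, and digitwise minima of the exponents of Y connect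
    any two members (class_meet, theta_class_eq).

    A submodule of V_t that is not inside the sum of the smaller V_u has an element
    in which members of the class t occur. A coefficient operator applied to it
    gives the member with the digitwise smallest exponent of Y, modulo that sum,
    and this member generates V_t (V_irr). Hence L(t) is irreducible, and removing
    maximal types one at a time gives the composition series (span_of_JH).

    For the cosocle, let M be a maximal submodule of V_t. The congruence kernel is
    a normal p-subgroup, so it acts trivially on V_t / M. The operators that lower
    the exponent of D lie in its augmentation ideal, so M contains all basis
    vectors with a smaller exponent of D than t (dexp_drop). What remains concerns
    monomials with the same exponent of D. Outside the exceptional case, t has a
    member with exponents 0 < a < q - 1 and b > 0, or empty carry set; torus
    projections and coefficient operators then show that M contains every V_u with
    u < t (Vs_sub_max). In the exceptional case these monomials look like the
    representation of functions on the projective line over k, whose trivial and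
    Steinberg constituents split. *)

(** * Digits in base p *)

Section Digits.
Local Open Scope nat_scope.
Variable p : nat.
Hypothesis p_pr : prime p.

Let p_gt0 : 0 < p. Proof. exact: prime_gt0. Qed.
Let p_gt1 : 1 < p. Proof. exact: prime_gt1. Qed.

Definition dig (n i : nat) := n %/ p ^ i %% p.

Lemma dig0 n : dig n 0 = n %% p.
Proof. by rewrite /dig divn1. Qed.

Lemma digS n i : dig n i.+1 = dig (n %/ p) i.
Proof. by rewrite /dig expnS divnMA. Qed.

Lemma dig_ltp n i : dig n i < p.
Proof. exact: ltn_pmod. Qed.

Lemma sum_digits f (c : nat -> nat) :
  \sum_(i < f.+1) c i * p ^ i = c 0 + (\sum_(i < f) c i.+1 * p ^ i) * p.
Proof.
rewrite big_ord_recl /= muln1 big_distrl /=; congr (_ + _).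
by apply: eq_bigr => i _; rewrite expnS mulnA mulnAC.
Qed.

Lemma dig_sum f (c : nat -> nat) l : (forall i, i < f -> c i < p) -> l < f ->
  dig (\sum_(i < f) c i * p ^ i) l = c l.
Proof.
elim: f c l => // f IH c l cp lf; rewrite sum_digits.
case: l lf => [|l] lf; first by rewrite dig0 addnC modnMDl modn_small ?cp.
rewrite digS addnC divnMDl // divn_small ?cp // addn0.
by rewrite (IH (fun i => c i.+1)) // => i lif; apply: cp.
Qed.

Lemma sum_digits_lt f (c : nat -> nat) : (forall i, i < f -> c i < p) ->
  \sum_(i < f) c i * p ^ i < p ^ f.
Proof.
elim: f c => [|f IH] c cp; first by rewrite big_ord0.
rewrite sum_digits expnS.
have H := IH (fun i => c i.+1) (fun i h => cp i.+1 h); have H0 := cp 0 isT.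
rewrite -addSn; apply: leq_trans (_ : p + (p ^ f).-1 * p <= _).
  by rewrite leq_add // leq_mul2r -ltnS prednK ?expn_gt0 ?p_gt0 // H orbT.
by rewrite -mulSn prednK ?expn_gt0 ?p_gt0 // mulnC.
Qed.

Lemma digitsE f n : n < p ^ f -> \sum_(i < f) dig n i * p ^ i = n.
Proof.
elim: f n => [|f IH] n ltn; first by rewrite big_ord0; move: ltn; rewrite expn0; lia.
rewrite sum_digits dig0 (eq_bigr (fun i : 'I_f => dig (n %/ p) i * p ^ i)) => [|i _]; last by rewrite digS.
rewrite IH; first by rewrite addnC -divn_eq.
by rewrite ltn_divLR // mulnC -expnS.
Qed.

Definition dle f (m n : nat) := [forall i : 'I_f, dig m i <= dig n i].

Lemma dle_leq f m n : m < p ^ f -> n < p ^ f -> dle f m n -> m <= n.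
Proof.
move=> /digitsE {2}<- /digitsE {2}<- /forallP mn.
by apply: leq_sum => i _; rewrite leq_mul2r mn orbT.
Qed.

Lemma digB f m n l : m < p ^ f -> n < p ^ f -> dle f m n -> l < f ->
  dig (n - m) l = dig n l - dig m l.
Proof.
move=> mf nf /forallP mn lf.
have -> : n - m = \sum_(i < f) (dig n i - dig m i) * p ^ i.
  rewrite -{1}(digitsE mf) -{1}(digitsE nf) -sumnB => [|i _]; last by rewrite leq_mul2r mn orbT.
  by apply: eq_bigr => i _; rewrite mulnBl.
rewrite (dig_sum (c := fun i => dig n i - dig m i)) // => i _.
by rewrite (leq_ltn_trans (leq_subr _ _)) // dig_ltp.
Qed.

Lemma sum_digB f m n : m < p ^ f -> n < p ^ f -> dle f m n ->
  \sum_(i < f) (dig n i - dig m i) * p ^ i = n - m.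
Proof.
move=> mf nf mn; rewrite -[RHS](@digitsE f) ?(leq_ltn_trans (leq_subr _ _)) //.
by apply: eq_bigr => i _; rewrite (digB mf nf mn).
Qed.

Lemma dig_inj f m n : m < p ^ f -> n < p ^ f ->
  (forall i, i < f -> dig m i = dig n i) -> m = n.
Proof.
move=> /digitsE {2}<- /digitsE {2}<- mn.
by apply: eq_bigr => i _; rewrite mn.
Qed.

Lemma digX m l : dig (p ^ m) l = (l == m).
Proof.
elim: m l => [|m IH] [|l]; rewrite ?dig0 ?digS.
- by rewrite expn0 modn_small.
- by rewrite expn0 divn_small // /dig div0n mod0n.
- by rewrite expnS mulnC modnMl.
- by rewrite expnS mulKn // IH.
Qed.

Lemma dig_0 l : dig 0 l = 0.
Proof. by rewrite /dig div0n mod0n. Qed.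

Lemma dle0 f n : dle f 0 n.
Proof. by apply/forallP=> i; rewrite dig_0. Qed.

Lemma dleX f (m : 'I_f) n : dle f (p ^ m) n = (0 < dig n m).
Proof.
apply/forallP/idP => [/(_ m)|nm i]; rewrite digX ?eqxx //.
by case: eqP => // ->.
Qed.

Lemma dle_trans f : transitive (dle f).
Proof.
move=> n m k /forallP mn /forallP nk; apply/forallP => i.
exact: leq_trans (mn i) (nk i).
Qed.

Lemma dleB f m n : m < p ^ f -> n < p ^ f -> dle f m n -> dle f (n - m) n.
Proof.
by move=> mf nf mn; apply/forallP => i; rewrite (digB mf nf mn) ?leq_subr.
Qed.

Lemma dig_max f l : l < f -> dig (p ^ f).-1 l = p.-1.
Proof.
move=> lf; rewrite predn_exp big_distrr /=.
rewrite (dig_sum (c := fun=> p.-1)) // => i _; lia.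
Qed.

End Digits.

(** * Lucas' theorem *)

Section Lucas.
Local Open Scope nat_scope.
Variable p : nat.
Hypothesis p_pr : prime p.
Let p_gt0 : 0 < p. Proof. exact: prime_gt0. Qed.

Lemma coef_1DXn (R : comNzRingType) n k :
  (((1 + 'X) ^+ n : {poly R})`_k = 'C(n, k)%:R)%R.
Proof.
rewrite exprDn coef_sum; have [kn|nk] := leqP k n.
  rewrite (bigD1 (Ordinal (kn : k < n.+1))) //= expr1n mul1r coefMn coefXn eqxx.
  rewrite big1 ?addr0 // => i ik; rewrite expr1n mul1r coefMn coefXn eq_sym.
  by rewrite -val_eqE /= in ik; rewrite (negbTE ik) mul0rn.
rewrite bin_small // big1 // => i _; rewrite expr1n mul1r coefMn coefXn.
by rewrite gtn_eqF ?mul0rn // (leq_trans (ltn_ord i)).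
Qed.

(** Compare the coefficients of X^k in (1 + X)^(n + p) = (1 + X)^n (1 + X^p). *)
Lemma bin_charp_add (R : comNzRingType) n k : p \in [pchar R]%R ->
  ('C(n + p, k)%:R = 'C(n, k)%:R + (if (k < p)%N then 0 else 'C(n, k - p)%:R) :> R)%R.
Proof.
move=> pR; rewrite -!coef_1DXn addnC exprD exprDn_pchar; last first.
  by rewrite pnatE // pchar_poly.
rewrite expr1n mulrDl mul1r coefD; congr (_ + _)%R.
by rewrite coefXnM coef_1DXn.
Qed.

Lemma Lucas_step (R : comNzRingType) m n u v : p \in [pchar R]%R ->
  u < p -> v < p ->
  ('C(m * p + u, n * p + v)%:R = 'C(m, n)%:R * 'C(u, v)%:R :> R)%R.
Proof.
move=> pR up vp; elim: m n => [|m IH] [|n].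
- by rewrite !mul0n !add0n bin0 mul1r.
- rewrite mul0n add0n bin0n mul0r bin_small //.
  by rewrite mulSn -addnA (leq_trans up) ?leq_addr.
- rewrite mulSnr addnAC bin_charp_add // mul0n add0n vp addr0.
  by rewrite -[v in LHS]add0n -(mul0n p) IH !bin0.
rewrite mulSnr addnAC bin_charp_add // ifF; last by apply/negbTE; rewrite -leqNgt mulSnr; lia.
by rewrite IH mulSnr addnAC addnK IH binS natrD mulrDl.
Qed.

Lemma Lucas (R : idomainType) f m n : p \in [pchar R]%R ->
  m < p ^ f -> n < p ^ f -> (('C(n, m)%:R == 0 :> R)%R = ~~ dle p f m n).
Proof.
move=> pR; elim: f m n => [|f IH] m n.
  rewrite expn0 => /ltnSE; rewrite leqn0 => /eqP-> _.
  by rewrite bin0 oner_eq0 dle0.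
rewrite !expnS => mf nf.
rewrite {1}(divn_eq m p) {1}(divn_eq n p) Lucas_step ?ltn_pmod // mulf_eq0.
rewrite IH ?ltn_divLR ?[_ * p]mulnC // -(dvdn_pcharf pR).
have -> : dle p f.+1 m n = (m %% p <= n %% p) && dle p f (m %/ p) (n %/ p).
  apply/forallP/andP => [mn|[mn0 /forallP mn] i].
    split; first by have := mn ord0; rewrite !dig0.
    by apply/forallP => i; have := mn (lift ord0 i); rewrite !digS.
  case: (unliftP ord0 i) => [j|] ->; last by rewrite !dig0.
  by rewrite !digS; apply: mn.
rewrite negb_and orbC; congr (_ || _).
have np : n %% p < p by rewrite ltn_pmod.
have [le|lt] := leqP (m %% p) (n %% p); last by rewrite bin_small // dvdn0.
apply/negbTE; apply/negP => dv.
have := dvdn_trans dv (dvdn_mulr ((m %% p)`! * (n %% p - m %% p)`!) (dvdnn _)).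
rewrite bin_fact //; elim: (n %% p) np => [|k IHk] kp; first by rewrite dvdn1 gtn_eqF ?prime_gt1.
rewrite factS Euclid_dvdM // => /orP[/dvdn_leq-/(_ isT)|/(IHk (ltnW kp))//].
by rewrite leqNgt kp.
Qed.
End Lucas.

(** * Rotations of the digits *)

Section Rot.
Local Open Scope nat_scope.
Variables (p f : nat).
Hypothesis p_pr : prime p.
Let p_gt0 : 0 < p. Proof. exact: prime_gt0. Qed.
Let p_gt1 : 1 < p. Proof. exact: prime_gt1. Qed.
Local Notation q := (p ^ f).

(** At an index j where W is maximal, p W_j <= W_(j-1) <= W_j. This is the
    tool that turns digitwise conditions around the cycle into bounds. *)
Lemma cyclic_le0 (W : 'I_f -> int) :
  (forall i, p%:Z * W i <= W (ord_pred i))%R -> forall i, (W i <= 0)%R.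
Proof.
move=> HW i; case: (arg_maxP (P := predT) W (i0 := i)) => // j _ maxj.
apply: le_trans (maxj i isT) _.
have := HW j; have := maxj (ord_pred j) isT; have : (2 <= p%:Z)%R by rewrite lez_nat.
set x := W j; set y := W (ord_pred j); move=> *; nia.
Qed.

(** The integer below p^f whose digits are those of a, rotated so that the i-th
    one comes on top; it represents p^(f-1-i) a modulo q - 1. *)
Definition digit_rot (a i : nat) := a %% p ^ i.+1 * p ^ (f - i.+1) + a %/ p ^ i.+1.

(** Multiplication by p pushes the top digit of a rotation to the weight q,
    whereas the next rotation has this digit at the weight 1. *)
Lemma digit_rot_rec (i : 'I_f) a : a < q ->
  p * digit_rot a i = q.-1 * dig p a i + digit_rot a (ord_pred i).
Proof.
case: i => [[|i] lif] aq; rewrite /digit_rot /=.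
  rewrite add0n (modn_small (_ : f.-1 < f)) ?prednK // (modn_small aq) (divn_small aq).
  rewrite subnn muln1 addn0 dig0 expn1.
  have -> : q = p ^ (f - 1) * p by rewrite -expnSr; congr (p ^ _); lia.
  have : 0 < p ^ (f - 1) * p by rewrite muln_gt0 expn_gt0 p_gt0.
  set x := p ^ (f - 1); move=> xp0.
  rewrite {4}(divn_eq a p) addnCA -mulSnr prednK //.
  by clear; nia.
have -> : (i.+1 + f).-1 %% f = i by rewrite addSn /= modnDr modn_small // ltnW.
set P := p ^ i.+1.
have lo : a %% p ^ i.+2 = dig p a i.+1 * P + a %% P.
  rewrite /dig modn_divl -/P -expnS {1}(divn_eq (a %% p ^ i.+2) P).
  by rewrite modn_dvdm // /P dvdn_exp2l.
have hi : a %/ P = a %/ p ^ i.+2 * p + dig p a i.+1.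
  by rewrite /dig -/P expnSr -/P divnMA -divn_eq.
have fi : f - i.+1 = (f - i.+2).+1 by lia.
have -> : q.-1 = (p ^ (f - i.+2).+1 * P).-1 by rewrite /P -expnD -fi subnK // ltnW.
rewrite lo hi fi !(expnS p (f - i.+2)).
have : 0 < p ^ (f - i.+2) by rewrite expn_gt0 p_gt0.
have : 0 < P by rewrite expn_gt0 p_gt0.
set x := p ^ (f - i.+2); set y := a %/ _; set z := a %% P; set d := dig _ _ _.
move=> P0 x0; have -> : (p * x * P).-1 = p * x * P - 1 by rewrite subn1.
rewrite mulnBl mul1n; have dle : d <= p * x * P * d.
  by rewrite leq_pmull // !muln_gt0 p_gt0 x0 P0.
have -> : p * ((d * P + z) * x + y) = p * x * P * d + z * (p * x) + y * p by clear; nia.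
lia.
Qed.

Lemma digit_rot_mod (i : 'I_f) a : a < q -> digit_rot a i = p ^ (f - i.+1) * a %[mod q.-1].
Proof.
have qE x : x * q = x %[mod q.-1].
  have {1}-> : x * q = x * q.-1 + x by rewrite -mulnSr prednK // expn_gt0 p_gt0.
  by rewrite modnMDl.
move=> aq; rewrite {2}(divn_eq a (p ^ i.+1)) mulnDr mulnCA -expnD subnK ?ltn_ord //.
by rewrite -modnDm qE modnDm /digit_rot addnC [X in _ = _ + X %[mod _]]mulnC.
Qed.

Lemma digit_rot_last a : 0 < f -> a < q -> digit_rot a f.-1 = a.
Proof.
move=> f0 aq; rewrite /digit_rot prednK // subnn muln1 modn_small // divn_small //.
by rewrite addn0.
Qed.

Lemma digit_rot_lt (i : 'I_f) a : a < q -> digit_rot a i < q.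
Proof.
move=> aq; have h : a %/ p ^ i.+1 < p ^ (f - i.+1).
  by rewrite ltn_divLR ?expn_gt0 ?p_gt0 // -expnD subnK.
have l : a %% p ^ i.+1 < p ^ i.+1 by rewrite ltn_pmod ?expn_gt0 ?p_gt0.
have -> : q = p ^ (f - i.+1) * p ^ i.+1 by rewrite -expnD subnK.
rewrite /digit_rot.
apply: leq_trans (_ : (a %% p ^ i.+1).+1 * p ^ (f - i.+1) <= _).
  by rewrite mulSn [X in _ <= X]addnC -addnS leq_add2l.
by rewrite [X in _ <= X]mulnC leq_mul2r l orbT.
Qed.

Lemma digit_rot_gt0 (i : 'I_f) a : (0 < digit_rot a i) = (0 < a).
Proof.
rewrite !lt0n; congr (~~ _); apply/eqP/eqP => [|->]; last first.
  by rewrite /digit_rot mod0n div0n.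
move/eqP; rewrite addn_eq0 muln_eq0 expn_eq0 => /andP[/orP[/eqP lo|]]; last by lia.
by move=> /eqP hi; rewrite (divn_eq a (p ^ i.+1)) lo hi.
Qed.

Lemma digit_rot0 i : digit_rot 0 i = 0.
Proof. by rewrite /digit_rot mod0n div0n. Qed.

(** The difference of two solutions satisfies p W_i = W_(i-1), so cyclic_le0
    applies to it and to its opposite. Identities between rotations are thereby
    reduced to identities between digits. *)
Lemma rec_unique (x y : 'I_f -> nat) (c : 'I_f -> nat) :
  (forall i, p * x i = c i + x (ord_pred i)) ->
  (forall i, p * y i = c i + y (ord_pred i)) -> x =1 y.
Proof.
move=> xc yc i.
have hx := @cyclic_le0 (fun i => (x i)%:Z - (y i)%:Z)%R _ i.
have hy := @cyclic_le0 (fun i => (y i)%:Z - (x i)%:Z)%R _ i.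
have {}hx : (x i <= y i)%N.
  by rewrite -lez_nat -subr_le0; apply: hx => j; have := xc j; have := yc j; lia.
have {}hy : (y i <= x i)%N.
  by rewrite -lez_nat -subr_le0; apply: hy => j; have := xc j; have := yc j; lia.
by apply/eqP; rewrite eqn_leq hx hy.
Qed.

Lemma digit_rotB m n (i : 'I_f) : m < q -> n < q -> dle p f m n ->
  digit_rot (n - m) i + digit_rot m i = digit_rot n i.
Proof.
move=> mq nq mn; have nmq : n - m < q by rewrite (leq_ltn_trans (leq_subr _ _)).
apply: (@rec_unique (fun i => digit_rot (n - m) i + digit_rot m i) (digit_rot n)
  (fun i => q.-1 * dig p n i)) => j; last exact: digit_rot_rec.
rewrite mulnDr !digit_rot_rec // (digB p_pr mq nq) //.
by have /forallP/(_ j) := mn; nia.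
Qed.
End Rot.

(** * The monoid of exponents *)

Section Exponents.
Local Open Scope nat_scope.
Variables (p f : nat).
Hypotheses (p_pr : prime p) (f_gt0 : 0 < f).
Let p_gt1 : 1 < p. Proof. exact: prime_gt1. Qed.
Local Notation q := (p ^ f).
Local Notation expo := (expo p f).
Local Notation to_expo := (to_expo p f).

Lemma q_gt1 : 1 < q.
Proof. by rewrite -(expn0 p) ltn_exp2l. Qed.
Let q1 := q_gt1.

Lemma expo_lt (a : expo) : a < q.
Proof. by apply: leq_trans (ltn_ord a) _; rewrite prednK // ltnW. Qed.

Lemma to_expo_small n : n < q -> to_expo n = n :> nat.
Proof.
move=> nq; rewrite to_expo_val //; case: n nq => //= n nq.
by rewrite modn_small // -ltnS prednK // ltnW.
Qed.

Lemma to_expo_mod n : to_expo n = n %[mod q.-1].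
Proof.
by rewrite to_expo_val //; case: n => //= n; rewrite -!(addn1 n) -addn1 modnDml.
Qed.

Lemma to_expo_gt0 n : (0 < to_expo n) = (0 < n).
Proof. by rewrite to_expo_val //; case: n. Qed.

Lemma to_expo_le n : to_expo n <= n.
Proof. by rewrite to_expo_val //; case: n => //= n; rewrite ltnS leq_mod. Qed.

Lemma to_expo_congr m n : (0 < m) = (0 < n) -> m = n %[mod q.-1] ->
  to_expo m = to_expo n.
Proof.
move=> mn0 mn; apply/eqP; rewrite to_expo_eq // mn eqxx andbT !eqn0Ngt mn0.
by case: (0 < n).
Qed.

Lemma expo_inj_mod (a b : expo) : (0 < a) = (0 < b) -> a = b %[mod q.-1] -> a = b.
Proof.
by move=> ab0 ab; rewrite -(to_expoK a q1) -(to_expoK b q1); apply: to_expo_congr.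
Qed.

Lemma to_expo_idl m n : to_expo (to_expo m + n) = to_expo (m + n).
Proof.
apply: to_expo_congr; first by rewrite !addn_gt0 to_expo_gt0.
by rewrite -modnDml to_expo_mod modnDml.
Qed.

Lemma to_expo_id m : to_expo (to_expo m) = to_expo m.
Proof. exact: to_expoK. Qed.

(** The integers 0 and q - 1 are congruent and both below q; the hypothesis on
    positivity tells them apart. *)
Lemma leq_expo_mod m n : m < q -> m = n %[mod q.-1] -> (0 < m -> 0 < n) -> m <= n.
Proof.
move=> mq mn; case: n mn => [|n] mn h; first by rewrite leqNgt; apply/negP => /h.
rewrite -(to_expo_small mq); case: m mq mn h => [|m] mq mn h.
  by rewrite to_expo_val.
by rewrite (to_expo_congr _ mn) // to_expo_le.
Qed.

Lemma expo_subP (a b : expo) : a != ord0 ->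
  0 < expo_sub a b /\ b + expo_sub a b = a %[mod q.-1].
Proof.
move=> a0; rewrite /expo_sub; case: pickP => [c /= /andP[c0 /eqP <-]|no].
  by rewrite lt0n /expo_add to_expo_mod; split.
pose c := to_expo (q.-1 * q + a - b).
have agt0 : 0 < a by rewrite lt0n.
have bq : b <= q.-1 * q by apply: leq_trans (leq_pmulr _ _); [rewrite -ltnS ltn_ord | exact: ltnW].
have c0 : 0 < c by rewrite to_expo_gt0; lia.
have := no c; rewrite -val_eqE /= -lt0n c0 /= => /eqP[].
apply: expo_inj_mod; first by rewrite to_expo_gt0 addn_gt0 c0 agt0 orbT.
rewrite to_expo_mod -modnDmr to_expo_mod modnDmr subnKC; last first.
  exact: leq_trans bq (leq_addr _ _).
by rewrite (mulnC q.-1) modnMDl.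
Qed.

Lemma expo_sub_eq (a b c : expo) : a != ord0 -> 0 < c -> b + c = a %[mod q.-1] ->
  expo_sub a b = c.
Proof.
move=> a0 c0 bc; have [s0 bs] := expo_subP b a0.
apply: expo_inj_mod; first by rewrite s0 c0.
by apply/eqP; rewrite -(eqn_modDl b) bs bc.
Qed.

Lemma expX_lt (m : 'I_f) : p ^ m < q.
Proof. by rewrite ltn_exp2l. Qed.

Lemma digit_leE (a b : expo) : digit_le a b = dle p f a b.
Proof. by []. Qed.

Lemma digit_le_pw (m : 'I_f) (a : expo) : digit_le (to_expo (p ^ m)) a = (0 < dig p a m).
Proof. by rewrite digit_leE to_expo_small ?expX_lt // dleX. Qed.

Lemma digit_sub_pw (m : 'I_f) (a : expo) : digit_le (to_expo (p ^ m)) a ->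
  digit_sub a (to_expo (p ^ m)) = to_expo (a - p ^ m).
Proof.
rewrite digit_leE /digit_sub /digit to_expo_small ?expX_lt // => ma.
congr to_expo; rewrite -(sum_digB p_pr _ _ ma) ?expX_lt ?expo_lt //.
Qed.

End Exponents.

(** * The preorder in terms of monomials *)

Section ThetaSteps.
Local Open Scope nat_scope.
Variables (p f : nat).
Hypotheses (p_pr : prime p) (f_gt0 : 0 < f).
Let p_gt0 : 0 < p. Proof. exact: prime_gt0. Qed.
Local Notation q := (p ^ f).
Local Notation expo := (expo p f).
Local Notation theta := (theta p f).
Local Notation to_expo := (to_expo p f).
Let q1 : 1 < q := q_gt1 p_pr f_gt0.
Let elt (a : expo) : a < q := expo_lt p_pr f_gt0 a.

Variable r : expo.
Hypothesis r_neq0 : r != ord0.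

Local Notation le := (theta_le r).

(** An index (j0, j1) stands for a monomial X^a Y^b D^j with j = j1. For finite
    j0 one has b = j0 and a = r - 2 j1 - j0, and at oo one has a = 0 and
    b = r - 2 j1. The exponents a, b, j are xexp, yexp and dexp. *)
Definition xexp (x : theta) : nat :=
  if x.1 is Some j0 then expo_sub (expo_r2 r x.2) j0 else 0.
Definition yexp (x : theta) : nat := if x.1 is Some j0 then j0 else expo_r2 r x.2.
Definition dexp (x : theta) : nat := x.2.

(** The degree is taken with X, Y of weight 1 and D of weight 2, which is how
    the Borel subgroup scales them. The condition 0 < a + b reflects that r - 2 j
    is taken in the nonzero part of the monoid. *)
Definition homog a b j := (0 < a + b) && (a + b + 2 * j == r %[mod q.-1]).

Definition mono_theta a b j : theta :=
  (if a == 0 then None else Some (to_expo b), to_expo j).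

Lemma expo_r2P j : 0 < expo_r2 r j /\ expo_r2 r j + 2 * j = r %[mod q.-1].
Proof.
have [s0 h] := expo_subP p_pr f_gt0 (expo_add j j) r_neq0; split=> //.
by rewrite -h -[RHS]modnDml to_expo_mod // modnDml addnC mul2n addnn.
Qed.

Lemma expo_r2_neq0 j : expo_r2 r j != ord0.
Proof. by have [] := expo_r2P j; rewrite lt0n. Qed.

Lemma homog_theta x : homog (xexp x) (yexp x) (dexp x).
Proof.
case: x => [[j0|] j]; rewrite /homog /xexp /yexp /dexp /=; last first.
  by have [s0 h] := expo_r2P j; rewrite !add0n s0 h eqxx.
have [s0 h] := expo_subP p_pr f_gt0 j0 (expo_r2_neq0 j).
have [_ h2] := expo_r2P j.
by rewrite addn_gt0 s0 /= -h2 eqn_modDr addnC h eqxx.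
Qed.

Lemma xexp_lt x : xexp x < q. Proof. by case: x => [[j0|] j]; rewrite /xexp /=; [apply: elt | apply: ltnW]. Qed.
Lemma yexp_lt x : yexp x < q. Proof. by case: x => [[j0|] j]; apply: elt. Qed.
Lemma dexp_lt x : dexp x < q. Proof. exact: elt. Qed.

Lemma to_expo_homog a b j :
  to_expo a + to_expo b + 2 * to_expo j = a + b + 2 * j %[mod q.-1].
Proof.
rewrite -[LHS]modnDm -[RHS]modnDm; congr ((_ + _) %% _).
  by rewrite -modnDm !to_expo_mod // modnDm.
by rewrite -modnMmr to_expo_mod // modnMmr.
Qed.

Lemma homog_sub a b j : homog a b j -> 0 < a -> expo_sub (expo_r2 r (to_expo j)) (to_expo b) = to_expo a.
Proof.
case/andP=> _ /eqP h a0; apply: expo_sub_eq; rewrite ?expo_r2_neq0 ?to_expo_gt0 //.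
have [_ h2] := expo_r2P (to_expo j).
by apply/eqP; rewrite -(eqn_modDr (2 * to_expo j)) h2 (addnC (to_expo b)) to_expo_homog h.
Qed.

Lemma homog_r2 b j : homog 0 b j -> expo_r2 r (to_expo j) = to_expo b.
Proof.
case/andP=> b0 /eqP; rewrite add0n => h; have [s0 h2] := expo_r2P (to_expo j).
apply: (expo_inj_mod p_pr f_gt0); first by rewrite s0 to_expo_gt0.
apply/eqP; rewrite -(eqn_modDr (2 * to_expo j)) h2 -h.
by have := to_expo_homog 0 b j; rewrite to_expo_small ?(ltnW q1) // !add0n => ->.
Qed.

Lemma mono_thetaK a b j : homog a b j ->
  [/\ xexp (mono_theta a b j) = to_expo a, yexp (mono_theta a b j) = to_expo b
    & dexp (mono_theta a b j) = to_expo j].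
Proof.
move=> h; rewrite /xexp /yexp /dexp /mono_theta /=; case: (posnP a) => [a0|a0] /=.
  by subst a; rewrite (homog_r2 h) to_expo_small // ltnW.
by rewrite (homog_sub h).
Qed.

Lemma mono_theta_exp x : mono_theta (xexp x) (yexp x) (dexp x) = x.
Proof.
case: x => [[j0|] j]; rewrite /mono_theta /xexp /yexp /dexp /= to_expoK //.
have [s0 h] := expo_subP p_pr f_gt0 j0 (expo_r2_neq0 j).
by rewrite gtn_eqF ?to_expoK.
Qed.

Lemma theta_exp_inj x y : xexp x = xexp y -> yexp x = yexp y -> dexp x = dexp y -> x = y.
Proof. by move=> hx hy hd; rewrite -(mono_theta_exp x) hx hy hd mono_theta_exp. Qed.

Lemma mono_theta_congr a b j a' b' j' :
  to_expo a = to_expo a' -> to_expo b = to_expo b' -> to_expo j = to_expo j' ->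
  mono_theta a b j = mono_theta a' b' j'.
Proof.
move=> ha hb hj; rewrite /mono_theta hb hj; congr (if _ then _ else _, _).
by rewrite !eqn0Ngt -(to_expo_gt0 p_pr f_gt0) ha to_expo_gt0.
Qed.

Lemma mono_theta_red a b j : mono_theta (to_expo a) (to_expo b) (to_expo j) = mono_theta a b j.
Proof. by apply: mono_theta_congr; rewrite to_expo_id. Qed.

Let pwlt (m : 'I_f) : p ^ m < q := expX_lt p_pr m.

(** On exponents the seven kinds of generating relations become four moves: a
    unit of a digit passes from Y to X, X and Y are exchanged, or D^(p^m) is traded
    for X^(2 p^m) or for (X Y)^(p^m). *)
Lemma theta_stepP (x y : theta) : theta_step r x y ->
  [\/ exists2 m : 'I_f, 0 < dig p (yexp y) m &
        x = mono_theta (xexp y + p ^ m) (yexp y - p ^ m) (dexp y),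
      x = mono_theta (yexp y) (xexp y) (dexp y) |
      exists2 m : 'I_f, 0 < dig p (dexp y) m &
        x = mono_theta (xexp y + 2 * p ^ m) (yexp y) (dexp y - p ^ m) \/
        x = mono_theta (xexp y + p ^ m) (yexp y + p ^ m) (dexp y - p ^ m)].
Proof.
have pm0 m : 0 < p ^ m by rewrite expn_gt0 p_gt0.
case: y => [[b|] j]; rewrite /theta_step /xexp /yexp /dexp /mono_theta /=.
  have [s0 h] := expo_subP p_pr f_gt0 b (expo_r2_neq0 j).
  case/or4P => [/existsP[m /andP[mb /eqP->]] | /existsP[m /andP[mj /eqP->]] | /existsP[m /andP[mj /eqP->]] |].
  - apply: Or31; exists m; first by rewrite -(digit_le_pw p_pr).
    by rewrite digit_sub_pw // gtn_eqF ?addn_gt0 ?s0 // to_expoK.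
  - apply: Or33; exists m; first by rewrite -(digit_le_pw p_pr).
    by left; rewrite digit_sub_pw // gtn_eqF ?addn_gt0 ?s0 // to_expoK.
  - apply: Or33; exists m; first by rewrite -(digit_le_pw p_pr).
    right; rewrite digit_sub_pw // gtn_eqF ?addn_gt0 ?s0 //.
    by rewrite /expo_add (to_expo_small p_pr f_gt0 (pwlt m)).
  - rewrite -!val_eqE /=; case/orP=> /andP[b0 /eqP->]; apply: Or32.
      by rewrite (negbTE b0) !to_expoK.
    by rewrite b0 to_expoK.
case/or3P => [/existsP[m /andP[mj /eqP->]] | /existsP[m /andP[mj /eqP->]] | /eqP->].
- apply: Or33; exists m; first by rewrite -(digit_le_pw p_pr).
  by left; rewrite digit_sub_pw // gtn_eqF ?add0n ?muln_gt0 ?pm0 // to_expoK.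
- apply: Or31; exists m; first by rewrite -(digit_le_pw p_pr).
  by rewrite digit_sub_pw // add0n gtn_eqF // to_expoK.
apply: Or32; have [s0 _] := expo_r2P j.
by rewrite gtn_eqF // to_expoK //; congr (Some _, _); apply: val_inj; rewrite /= to_expo_val.
Qed.

Lemma step_y (y : theta) (m : 'I_f) : 0 < dig p (yexp y) m ->
  le (mono_theta (xexp y + p ^ m) (yexp y - p ^ m) (dexp y)) y.
Proof.
have pm0 : 0 < p ^ m by rewrite expn_gt0 p_gt0.
move=> mb; apply: connect1; case: y mb => [[b|] j]; rewrite /theta_step /xexp /yexp /dexp /mono_theta /= => mb.
  apply/or4P/Or41/existsP; exists m; rewrite digit_le_pw // mb /=.
  by rewrite digit_sub_pw ?digit_le_pw // gtn_eqF ?addn_gt0 ?pm0 ?orbT // to_expoK.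
apply/or3P/Or32/existsP; exists m; rewrite digit_le_pw // mb /=.
by rewrite digit_sub_pw ?digit_le_pw // gtn_eqF // to_expoK.
Qed.

Lemma step_swap (y : theta) : le (mono_theta (yexp y) (xexp y) (dexp y)) y.
Proof.
apply: connect1; case: y => [[b|] j]; rewrite /theta_step /xexp /yexp /dexp /mono_theta /=.
  have [s0 h] := expo_subP p_pr f_gt0 b (expo_r2_neq0 j).
  apply/or4P/Or44; rewrite -val_eqE /=; case: (posnP b) => [b0|b0].
    by rewrite /= to_expoK.
  by rewrite /= !to_expoK // eqxx.
have [s0 _] := expo_r2P j.
apply/or3P/Or33; rewrite gtn_eqF // to_expoK //; apply/eqP; congr (Some _, _).
by apply: val_inj; rewrite /= to_expo_val.
Qed.

Lemma step_xx (y : theta) (m : 'I_f) : 0 < dig p (dexp y) m ->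
  le (mono_theta (xexp y + 2 * p ^ m) (yexp y) (dexp y - p ^ m)) y.
Proof.
have pm0 : 0 < p ^ m by rewrite expn_gt0 p_gt0.
move=> mb; apply: connect1; case: y mb => [[b|] j]; rewrite /theta_step /xexp /yexp /dexp /mono_theta /= => mb.
  apply/or4P/Or42/existsP; exists m; rewrite digit_le_pw // mb /=.
  by rewrite digit_sub_pw ?digit_le_pw // gtn_eqF ?addn_gt0 ?muln_gt0 ?pm0 ?orbT // to_expoK.
apply/or3P/Or31/existsP; exists m; rewrite digit_le_pw // mb /=.
by rewrite digit_sub_pw ?digit_le_pw // gtn_eqF ?muln_gt0 ?pm0 // to_expoK.
Qed.

Lemma theta_le_trans : transitive le. Proof. exact: connect_trans. Qed.

Lemma step_xy_pos (y : theta) (m : 'I_f) : 0 < dig p (dexp y) m -> 0 < xexp y ->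
  le (mono_theta (xexp y + p ^ m) (yexp y + p ^ m) (dexp y - p ^ m)) y.
Proof.
have pm0 : 0 < p ^ m by rewrite expn_gt0 p_gt0.
move=> mb; case: y mb => [[b|] j]; rewrite /theta_step /xexp /yexp /dexp /mono_theta //= => mb x0.
apply: connect1.
apply/or4P/Or43/existsP; exists m; rewrite digit_le_pw // mb /=.
rewrite digit_sub_pw ?digit_le_pw // gtn_eqF ?addn_gt0 ?pm0 ?orbT //.
by rewrite /expo_add (to_expo_small p_pr f_gt0 (pwlt m)).
Qed.

End ThetaSteps.

(** * Shifts by several digits *)

Section ThetaShifts.
Local Open Scope nat_scope.
Variables (p f : nat).
Hypotheses (p_pr : prime p) (f_gt0 : 0 < f).
Let p_gt0 : 0 < p. Proof. exact: prime_gt0. Qed.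
Local Notation q := (p ^ f).
Local Notation expo := (expo p f).
Local Notation theta := (theta p f).
Local Notation to_expo := (to_expo p f).

Variable r : expo.
Hypothesis r_neq0 : r != ord0.

Local Notation le := (theta_le r).

Local Notation xexp := (xexp r).
Local Notation yexp := (yexp r).
Local Notation mono_theta := (@mono_theta p f).
Local Notation homog := (@homog p f r).
Local Notation theta_exp_inj := (theta_exp_inj p_pr f_gt0 r_neq0).
Local Notation mono_theta_exp := (mono_theta_exp p_pr f_gt0 r_neq0).
Let xlt := xexp_lt p_pr f_gt0 r.
Let ylt := yexp_lt p_pr f_gt0 r.
Let dlt := @dexp_lt p f p_pr f_gt0.
Let small := to_expo_small p_pr f_gt0.

Lemma theta_le_refl x : le x x. Proof. exact: connect0. Qed.

Lemma homog_mono y a b j : 0 < a + b -> a + b + 2 * j = xexp y + yexp y + 2 * dexp y ->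
  homog a b j.
Proof.
move=> ab0 e; rewrite /homog ab0 e /=.
by have /andP[] := homog_theta p_pr f_gt0 r_neq0 y.
Qed.

Lemma exp_gt0 x : 0 < xexp x + yexp x.
Proof. by have /andP[] := homog_theta p_pr f_gt0 r_neq0 x. Qed.

(** The effect of the Weyl element on monomials. *)
Definition swap x : theta := mono_theta (yexp x) (xexp x) (dexp x).

Lemma swapE x : [/\ xexp (swap x) = yexp x, yexp (swap x) = xexp x & dexp (swap x) = dexp x].
Proof.
have h : homog (yexp x) (xexp x) (dexp x).
  by apply: (@homog_mono x); rewrite ?(addnC (yexp x)) ?exp_gt0.
by have [-> -> ->] := mono_thetaK p_pr f_gt0 r_neq0 h; rewrite !small.
Qed.

Lemma swapK : involutive swap.
Proof.
move=> x; have [hx hy hd] := swapE x; have [hx' hy' hd'] := swapE (swap x).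
by apply: theta_exp_inj; rewrite ?hx' ?hy' ?hd'.
Qed.

Lemma swap_le x : le (swap x) x. Proof. exact: step_swap. Qed.

Lemma swap_ge x : le x (swap x).
Proof. by rewrite -{1}(swapK x) swap_le. Qed.

Lemma exists_dig i : i < q -> 0 < i -> exists m : 'I_f, 0 < dig p i m.
Proof.
move=> iq i0; apply/existsP; apply: contraTT i0; rewrite negb_exists => /forallP h.
rewrite -eqn0Ngt; apply/eqP; apply: (dig_inj p_pr iq); first by rewrite expn_gt0 p_gt0.
move=> l lf; rewrite dig_0; have := h (Ordinal lf).
by rewrite -eqn0Ngt => /eqP.
Qed.

(** The induction step for the shifts below: one unit is split off from a digit
    of i. *)
Lemma dle_subX i (m : 'I_f) b : i < q -> b < q -> dle p f i b -> 0 < dig p i m ->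
  [/\ dle p f (i - p ^ m) b, 0 < dig p (b - (i - p ^ m)) m & p ^ m <= i].
Proof.
move=> iq bq ib im; have mi : dle p f (p ^ m) i by rewrite dleX.
have mq : p ^ m < q := expX_lt p_pr m.
have h : dle p f (i - p ^ m) b by apply: dle_trans ib; apply: dleB.
split=> //; last exact: dle_leq mi.
rewrite (digB p_pr _ bq h) ?(leq_ltn_trans (leq_subr _ _)) // (digB p_pr mq iq mi) // digX // eqxx.
by have /forallP/(_ m) := ib; lia.
Qed.

(** A shift by i is a composition of steps, each moving a unit of some digit;
    no step needs to borrow because i is digitwise below the exponent. *)
Lemma le_shift_y x i : i < q -> dle p f i (yexp x) ->
  le (mono_theta (xexp x + i) (yexp x - i) (dexp x)) x.
Proof.
elim/ltn_ind: i => i IH iq ib; case: (posnP i) => [->|i0].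
  by rewrite addn0 subn0 mono_theta_exp theta_le_refl.
have [m im] := exists_dig iq i0.
have [i'b bm mi] := dle_subX iq (ylt x) ib im.
have pm0 : 0 < p ^ m by rewrite expn_gt0 p_gt0.
have i'i : i - p ^ m < i by lia.
apply: theta_le_trans (IH _ i'i (ltn_trans i'i iq) i'b).
set i' := i - p ^ m in i'b bm i'i *; have ib' := dle_leq p_pr (ltn_trans i'i iq) (ylt x) i'b.
have h : homog (xexp x + i') (yexp x - i') (dexp x).
  by apply: (@homog_mono x); have := exp_gt0 x; lia.
have [hx hy hd] := mono_thetaK p_pr f_gt0 r_neq0 h.
have {}bm : 0 < dig p (yexp (mono_theta (xexp x + i') (yexp x - i') (dexp x))) m.
  by rewrite hy small // (leq_ltn_trans (leq_subr _ _)).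
apply: theta_le_trans (step_y p_pr f_gt0 bm); rewrite hx hy hd.
rewrite (mono_theta_congr p_pr f_gt0 (_ : _ = to_expo (xexp x + i)) (_ : _ = to_expo (yexp x - i)) (_ : _ = to_expo (dexp x))) ?theta_le_refl //.
- by rewrite to_expo_idl //; congr to_expo; rewrite /i'; lia.
- by rewrite small ?(leq_ltn_trans (leq_subr _ _)) //; congr to_expo; rewrite /i'; lia.
- by rewrite to_expo_id.
Qed.

(** Trading D for X Y is a generating relation only when X occurs. When it does
    not, Y occurs, and exchanging X and Y before and after the step reduces to that
    case. *)
Lemma step_xy (y : theta) (m : 'I_f) : 0 < dig p (dexp y) m ->
  le (mono_theta (xexp y + p ^ m) (yexp y + p ^ m) (dexp y - p ^ m)) y.
Proof.
move=> mj; case: (posnP (xexp y)) => [x0|]; last exact: step_xy_pos.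
have [hx hy hd] := swapE y; apply: theta_le_trans (swap_le y).
have x0' : 0 < xexp (swap y) by rewrite hx; have := exp_gt0 y; rewrite x0.
have := step_xy_pos p_pr f_gt0 _ x0'; rewrite hd => /(_ m mj); apply: theta_le_trans.
have pm0 : 0 < p ^ m by rewrite expn_gt0 p_gt0.
have mj' : p ^ m <= dexp y by apply: (dle_leq p_pr (expX_lt p_pr m) (dlt _)); rewrite dleX.
have h : homog (xexp (swap y) + p ^ m) (yexp (swap y) + p ^ m) (dexp y - p ^ m).
  by apply: (@homog_mono y); rewrite hx hy; lia.
have [hx2 hy2 hd2] := mono_thetaK p_pr f_gt0 r_neq0 h.
have := swap_le (mono_theta (xexp (swap y) + p ^ m) (yexp (swap y) + p ^ m) (dexp y - p ^ m)).
by rewrite /swap hx2 hy2 hd2 mono_theta_red // -/(swap y) hx hy.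
Qed.

(** Both trades of powers of D are treated at once: (k, l) = (2, 0) is the one
    for X^2, and (k, l) = (1, 1) the one for X Y. *)
Lemma le_shift_d k l x i : k + l = 2 ->
  (forall (y : theta) (m : 'I_f), 0 < dig p (dexp y) m ->
     le (mono_theta (xexp y + k * p ^ m) (yexp y + l * p ^ m) (dexp y - p ^ m)) y) ->
  i < q -> dle p f i (dexp x) ->
  le (mono_theta (xexp x + k * i) (yexp x + l * i) (dexp x - i)) x.
Proof.
move=> kl step; elim/ltn_ind: i => i IH iq ib; case: (posnP i) => [->|i0].
  by rewrite !muln0 !addn0 subn0 mono_theta_exp theta_le_refl.
have [m im] := exists_dig iq i0.
have [i'b bm mi] := dle_subX iq (dlt x) ib im.
have pm0 : 0 < p ^ m by rewrite expn_gt0 p_gt0.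
have i'i : i - p ^ m < i by lia.
apply: theta_le_trans (IH _ i'i (ltn_trans i'i iq) i'b).
have -> : i = (i - p ^ m) + p ^ m by rewrite subnK.
rewrite addnK; set i' := i - p ^ m in i'b bm i'i *.
have ib' := dle_leq p_pr (ltn_trans i'i iq) (dlt x) i'b.
have h : homog (xexp x + k * i') (yexp x + l * i') (dexp x - i').
  by apply: (@homog_mono x); have := exp_gt0 x; nia.
have [hx hy hd] := mono_thetaK p_pr f_gt0 r_neq0 h.
have {}bm : 0 < dig p (dexp (mono_theta (xexp x + k * i') (yexp x + l * i') (dexp x - i'))) m.
  by rewrite hd small // (leq_ltn_trans (leq_subr _ _)).
apply: theta_le_trans (step _ _ bm); rewrite hx hy hd.
rewrite (mono_theta_congr p_pr f_gt0 (_ : _ = to_expo (xexp x + k * (i' + p ^ m)))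
  (_ : _ = to_expo (yexp x + l * (i' + p ^ m))) (_ : _ = to_expo (dexp x - (i' + p ^ m)))) ?theta_le_refl //.
- by rewrite to_expo_idl // -addnA -mulnDr.
- by rewrite to_expo_idl // -addnA -mulnDr.
- by rewrite small ?(leq_ltn_trans (leq_subr _ _)) // subnDA.
Qed.

Lemma le_shift_xx x i : i < q -> dle p f i (dexp x) ->
  le (mono_theta (xexp x + 2 * i) (yexp x) (dexp x - i)) x.
Proof.
move=> iq ix; rewrite -[X in mono_theta _ X](addn0 (yexp x)).
by apply: (le_shift_d (l := 0)) => // y m ym; rewrite addn0; apply: step_xx.
Qed.

Lemma le_shift_xy x i : i < q -> dle p f i (dexp x) ->
  le (mono_theta (xexp x + i) (yexp x + i) (dexp x - i)) x.
Proof.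
move=> iq ix; have := @le_shift_d 1 1 x i erefl _ iq ix; rewrite !mul1n; apply.
by move=> y m ym; rewrite !mul1n; apply: step_xy.
Qed.

End ThetaShifts.

(** * Carry sets and equivalence classes *)

Section ThetaClasses.
Local Open Scope nat_scope.
Variables (p f : nat).
Hypotheses (p_pr : prime p) (f_gt0 : 0 < f).
Let p_gt0 : 0 < p. Proof. exact: prime_gt0. Qed.
Let p_gt1 : 1 < p. Proof. exact: prime_gt1. Qed.
Local Notation q := (p ^ f).
Local Notation expo := (expo p f).
Local Notation theta := (theta p f).
Local Notation to_expo := (to_expo p f).
Let q1 : 1 < q := q_gt1 p_pr f_gt0.
Let elt (a : expo) : a < q := expo_lt p_pr f_gt0 a.

Variable r : expo.
Hypothesis r_neq0 : r != ord0.

Local Notation le := (theta_le r).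

Local Notation xexp := (xexp r).
Local Notation yexp := (yexp r).
Local Notation mono_theta := (@mono_theta p f).
Local Notation homog := (@homog p f r).
Local Notation mono_theta_exp := (mono_theta_exp p_pr f_gt0 r_neq0).
Let xlt := xexp_lt p_pr f_gt0 r.
Let ylt := yexp_lt p_pr f_gt0 r.
Let dlt := @dexp_lt p f p_pr f_gt0.
Let small := to_expo_small p_pr f_gt0.

Local Notation swap := (swap r).
Local Notation swapE := (swapE p_pr f_gt0 r_neq0).
Local Notation exp_gt0 := (exp_gt0 p_pr f_gt0 r_neq0).
Local Notation homog_mono := (homog_mono p_pr f_gt0 r_neq0).
Let mono_thetaK := @mono_thetaK p f p_pr f_gt0 r r_neq0.

(** The degree in X and Y of the monomial after the p^(f-1-i)-th power
    Frobenius, with exponents reduced modulo q - 1. The carry set of the type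
    records for which i it exceeds q - 1. *)
Definition twdeg (x : theta) (i : nat) := digit_rot p f (xexp x) i + digit_rot p f (yexp x) i.

Lemma digit_rot_le_pred (i : 'I_f) a : a < q -> digit_rot p f a i <= q.-1.
Proof. by move=> aq; rewrite -ltnS prednK ?digit_rot_lt // ltnW. Qed.

(** The left side represents the right side modulo q - 1 and is the smallest
    such representative of the same positivity. *)
Lemma digit_rot_add (i : 'I_f) a b : a < q -> b < q ->
  digit_rot p f (to_expo (a + b)) i <= digit_rot p f a i + digit_rot p f b i.
Proof.
move=> aq bq; have cq := elt (to_expo (a + b)).
apply: (leq_expo_mod p_pr f_gt0); first exact: digit_rot_lt.
  rewrite digit_rot_mod // -[RHS]modnDm !digit_rot_mod // modnDm -mulnDr.
  by rewrite -modnMmr to_expo_mod // modnMmr.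
by rewrite digit_rot_gt0 // to_expo_gt0 // (addn_gt0 a) (addn_gt0 (digit_rot _ _ _ _)) !digit_rot_gt0.
Qed.

Lemma twdeg_swap x i : twdeg (swap x) i = twdeg x i.
Proof. by have [hx hy _] := swapE x; rewrite /twdeg hx hy addnC. Qed.

(** Moving a digit from Y to X keeps the twisted degrees, except that reducing
    the new exponent of X modulo q - 1 may lower them; the trades lower the exponent
    of D. *)
Lemma theta_step_mono x y : theta_step r x y ->
  dexp x < dexp y \/ dexp x = dexp y /\ forall i : 'I_f, twdeg x i <= twdeg y i.
Proof.
have pm0 (m : 'I_f) : 0 < p ^ m by rewrite expn_gt0 p_gt0.
have jlt (m : 'I_f) : 0 < dig p (dexp y) m -> p ^ m <= dexp y.
  by move=> ym; apply: (dle_leq p_pr (expX_lt p_pr m) (dlt _)); rewrite dleX.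
case/(theta_stepP p_pr f_gt0 r_neq0) => [[m ym ->]|->|[m ym xE]].
- have ymd : dle p f (p ^ m) (yexp y) by rewrite dleX.
  have yml := dle_leq p_pr (expX_lt p_pr m) (ylt y) ymd.
  have h : homog (xexp y + p ^ m) (yexp y - p ^ m) (dexp y).
    by apply: (homog_mono (y := y)); have := exp_gt0 y; lia.
  have [hx hy hd] := mono_thetaK h; right; rewrite hd to_expoK //; split=> // i.
  rewrite /twdeg hx hy (small (leq_ltn_trans (leq_subr _ _) (ylt y))).
  rewrite -(digit_rotB p_pr i (expX_lt p_pr m) (ylt y) ymd).
  by rewrite addnCA addnC leq_add2l digit_rot_add ?(expX_lt p_pr).
- by right; have [_ _ hd] := swapE y; split=> [|i]; rewrite -/(swap y) ?hd ?twdeg_swap.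
left; have := jlt _ ym; have := pm0 m => m0 mj.
have lt : to_expo (dexp y - p ^ m) < dexp y by apply: leq_ltn_trans (to_expo_le p_pr f_gt0 _) _; lia.
case: xE => ->.
  have h : homog (xexp y + 2 * p ^ m) (yexp y) (dexp y - p ^ m).
    by apply: (homog_mono (y := y)); have := exp_gt0 y; lia.
  by have [_ _ ->] := mono_thetaK h.
have h : homog (xexp y + p ^ m) (yexp y + p ^ m) (dexp y - p ^ m).
  by apply: (homog_mono (y := y)); have := exp_gt0 y; lia.
by have [_ _ ->] := mono_thetaK h.
Qed.

Lemma theta_le_mono x y : le x y ->
  dexp x < dexp y \/ dexp x = dexp y /\ forall i : 'I_f, twdeg x i <= twdeg y i.
Proof.
case/connectP => s; elim: s x => [|z s IH] x /=; first by move=> _ ->; right.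
case/andP=> /theta_step_mono xz zs ey; have {IH zs ey} zy := IH _ zs ey.
case: xz zy => [xz|[xz dxz]] [zy|[zy dzy]].
- by left; apply: ltn_trans zy.
- by left; rewrite -zy.
- by left; rewrite xz.
- by right; split=> [|i]; rewrite ?xz // (leq_trans (dxz i)).
Qed.

Lemma cyclic_ind (P : pred 'I_f) i : P i -> (forall l, P l -> P (ord_pred l)) -> forall l, P l.
Proof.
move=> Pi step.
have down n (ln : n < f) m (lm : m < f) : P (Ordinal ln) -> m <= n -> P (Ordinal lm).
  elim: n ln => [|n IH] ln Pn; first by rewrite leqn0 => /eqP m0; have -> // : Ordinal lm = Ordinal ln by apply: val_inj.
  rewrite leq_eqVlt => /orP[/eqP mn|mn]; first by have -> // : Ordinal lm = Ordinal ln by apply: val_inj.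
  apply: (IH (ltnW ln)) => //; have := step _ Pn; congr (P _).
  by apply: val_inj; rewrite /= modnDr modn_small // ltnW.
have fp : f.-1 < f by rewrite prednK.
have P0 : P (Ordinal f_gt0) by apply: (down _ (ltn_ord i)) => //; move: Pi; congr (P _); apply: val_inj.
have Pm : P (Ordinal fp).
  have := step _ P0; congr (P _); apply: val_inj; rewrite /= add0n modn_small //.
case=> l lf; apply: down Pm _; by rewrite -ltnS prednK.
Qed.

Lemma sum_digit_rot_rec (a b : nat) (i : 'I_f) : a < q -> b < q ->
  p * (digit_rot p f a i + digit_rot p f b i) =
  q.-1 * (dig p a i + dig p b i) + (digit_rot p f a (ord_pred i) + digit_rot p f b (ord_pred i)).
Proof. by move=> aq bq; rewrite mulnDr !digit_rot_rec // mulnDr addnACA. Qed.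

(** Put d_i for the sum of rotations, so p d_i = (q - 1)(a_i + b_i) + d_(i-1).
    By cyclic_le0 the carry conditions give d_i <= q - 1 for i outside I and
    d_i >= q - 1 for i in I. The ambiguous value d_i = q - 1 with i in I would
    propagate around the cycle and make every digit sum p - 1, the case in which I
    is empty by definition. *)
Lemma carry_unique (a b : expo) (I : {set 'I_f}) : 0 < a + b -> carry_spec a b I ->
  I = [set i : 'I_f | q <= digit_rot p f a i + digit_rot p f b i].
Proof.
move=> ab0 /andP[/forallP spec /implyP spec0].
pose d (i : 'I_f) := digit_rot p f a i + digit_rot p f b i.
have d0 i : 0 < d i by rewrite addn_gt0 !digit_rot_gt0 // -addn_gt0.
have drec i : p * d i = q.-1 * (digit a i + digit b i) + d (ord_pred i) := sum_digit_rot_rec i (elt a) (elt b).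
have q0 : q = q.-1.+1 by rewrite prednK // ltnW.
have bnd i : (p * (i \in I) <= digit a i + digit b i + (ord_pred i \in I) <= p.-1 + p * (i \in I))%N.
  have := spec i; rewrite /= /digit; have := ltn_pmod (a %/ p ^ i) p_gt0; have := ltn_pmod (b %/ p ^ i) p_gt0.
  by case: (ord_pred i \in I); case: (i \in I) => /=; lia.
have up i : (d i <= q.-1 + q.-1 * (i \in I))%N.
  suff : ((d i)%:Z - (q.-1 + q.-1 * (i \in I))%:Z <= 0)%R by lia.
  move: i; apply: (cyclic_le0 p_pr) => i; move: (drec i) (bnd i) => e /andP[_].
  rewrite -(leq_pmul2l (m := q.-1)); last by rewrite -ltnS -q0.
  move: e; move: (d i) (d (ord_pred i)) (q.-1) (digit a i + digit b i) => x y Q s.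
  rewrite -(prednK p_gt0) /=; move: (p.-1) => p'.
  by case: (ord_pred i \in I); case: (i \in I); lia.
have lo i : (q.-1 * (i \in I) <= d i)%N.
  suff : ((q.-1 * (i \in I))%:Z - (d i)%:Z <= 0)%R by lia.
  move: i; apply: (cyclic_le0 p_pr) => i; move: (drec i) (bnd i) => e /andP[+ _].
  rewrite -(leq_pmul2l (m := q.-1)); last by rewrite -ltnS -q0.
  move: e; move: (d i) (d (ord_pred i)) (q.-1) (digit a i + digit b i) => x y Q s.
  rewrite -(prednK p_gt0) /=; move: (p.-1) => p'.
  by case: (ord_pred i \in I); case: (i \in I); lia.
apply/setP => i; rewrite inE -/(d i) q0 ltnNge; move: (lo i) (up i).
case iI: (i \in I) => /=; rewrite ?muln1 ?muln0 ?addn0 => lo_i up_i; last by rewrite up_i.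
apply/esym/negP => up_i'; have {up_i lo_i up_i'} di : d i = q.-1 by apply/eqP; rewrite eqn_leq lo_i up_i'.
have tight l : d l = q.-1 * (l \in I) -> d (ord_pred l) = q.-1 * (ord_pred l \in I) /\
    digit a l + digit b l + (ord_pred l \in I) = p * (l \in I).
  move=> dl; move: (drec l) (spec l) (lo (ord_pred l)) => /=; rewrite -!/(d _) dl.
  have : 0 < q.-1 by rewrite -ltnS -q0.
  move: (d (ord_pred l)) (q.-1) => y Q.
  by case: (ord_pred l \in I); case: (l \in I) => Q0 e s h; split; nia.
have tightA l : d l = q.-1 * (l \in I).
  apply/eqP; move: l; apply: (@cyclic_ind (fun l => d l == q.-1 * (l \in I)) i).
    by rewrite iI muln1 di.
  by move=> l /eqP/tight[/eqP].
have IT l : l \in I by have := d0 l; rewrite tightA; case: (l \in I); rewrite // muln0.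
have s l : digit a l + digit b l == p - 1.
  by have [_] := tight l (tightA l); rewrite !IT; lia.
by have := spec0 (introT forallP s) => /eqP I0; rewrite I0 inE in iI.
Qed.

(** Conversely the set of the i with d_i >= q satisfies the carry conditions:
    the recursion for d turns the bounds on d_(i-1) and d_i into bounds on the digit
    sum a_i + b_i. *)
Lemma carryE (a b : expo) : 0 < a + b ->
  carry a b = [set i : 'I_f | q <= digit_rot p f a i + digit_rot p f b i].
Proof.
move=> ab0; rewrite /carry; case: pickP => [I /(carry_unique ab0)//|no].
pose d (i : 'I_f) := digit_rot p f a i + digit_rot p f b i.
have d0 i : 0 < d i by rewrite addn_gt0 !digit_rot_gt0 // -addn_gt0.
have drec i : p * d i = q.-1 * (digit a i + digit b i) + d (ord_pred i) := sum_digit_rot_rec i (elt a) (elt b).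
have q0 : q = q.-1.+1 by rewrite prednK // ltnW.
have Q0 : 0 < q.-1 by rewrite -ltnS -q0.
have dmax i : d i <= 2 * q.-1.
  by rewrite mul2n -addnn leq_add // digit_rot_le_pred.
have /negP[] := no [set i | q <= d i]; apply/andP; split.
  apply/forallP => i; rewrite /= !inE.
  have := drec i; have := d0 i; have := d0 (ord_pred i); have := dmax (ord_pred i).
  rewrite -/(d i) -/(d (ord_pred i)).
  move: (digit a i + digit b i) (d i) (d (ord_pred i)) => s x y y2 y0 x0 e.
  have pQ z : z <= q.-1 -> p * z <= q.-1 * p by move=> zQ; rewrite mulnC leq_mul2r zQ orbT.
  have pq z : q <= z -> q.-1 * p + p <= p * z by move=> zq; rewrite -mulSnr -q0 mulnC leq_mul2l zq orbT.
  case: (leqP q y) => [yq|yq]; case: (leqP q x) => [xq|xq].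
  - suff : p - 2 < s by lia.
    have : q.-1 * 2 <= q.-1 * p by rewrite leq_mul2l p_gt1 orbT.
    by rewrite -(ltn_pmul2l Q0) mulnBr; have := pq _ xq; lia.
  - suff : s.+1 < p by lia.
    by rewrite -(ltn_pmul2l Q0) mulnS; have := pQ x; lia.
  - suff : p - 1 < s by lia.
    have : q.-1 * 1 <= q.-1 * p by rewrite leq_mul2l p_gt0 orbT.
    by rewrite -(ltn_pmul2l Q0) mulnBr; have := pq _ xq; lia.
  - suff : s < p by lia.
    by rewrite -(ltn_pmul2l Q0); have := pQ x; lia.
apply/implyP => /forallP s1; apply/eqP/setP => i; rewrite !inE; apply/negbTE; rewrite -ltnNge q0 ltnS.
suff : ((d i)%:Z - q.-1%:Z <= 0)%R by lia.
move: i; apply: (cyclic_le0 p_pr) => i; have := drec i; rewrite (eqP (s1 i)).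
by move: (d i) (d (ord_pred i)) (q.-1) => x y Q; nia.
Qed.

Lemma theta_classE x :
  theta_class r x = ([set i : 'I_f | q <= twdeg x i], x.2).
Proof.
have e0 := exp_gt0 x; rewrite /theta_class; congr (_, _).
move: e0; rewrite /twdeg /xexp /yexp; case: x => [[j0|] j] /= e0.
  by rewrite carryE; [apply/setP => i; rewrite !inE addnC | rewrite addnC].
have [s0 h] := expo_subP p_pr f_gt0 ord0 (expo_r2_neq0 p_pr f_gt0 r_neq0 j).
have -> : expo_sub (expo_r2 r j) ord0 = expo_r2 r j.
  by apply: (expo_inj_mod p_pr f_gt0); [rewrite s0 e0 | rewrite -h].
by rewrite carryE //; apply/setP => i; rewrite !inE digit_rot0.
Qed.

Lemma twdeg_mod x y (i : 'I_f) : dexp x = dexp y -> twdeg x i = twdeg y i %[mod q.-1].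
Proof.
move=> xy; rewrite /twdeg -modnDm -[RHS]modnDm !digit_rot_mod // !modnDm -!mulnDr.
rewrite -modnMmr -[RHS]modnMmr; congr ((_ * _) %% _).
have /andP[_ /eqP hx] := homog_theta p_pr f_gt0 r_neq0 x.
have /andP[_ /eqP hy] := homog_theta p_pr f_gt0 r_neq0 y.
by apply/eqP; rewrite -(eqn_modDr (2 * dexp x)) hx xy hy.
Qed.

Lemma eq_mod_pos m n Q : 0 < m -> 0 < n -> m <= Q -> n <= Q -> m = n %[mod Q] -> m = n.
Proof.
case: m n => [//|m] [//|n] _ _ mQ nQ /eqP; rewrite -[m.+1]addn1 -[n.+1]addn1 eqn_modDr.
by rewrite !modn_small // => /eqP->.
Qed.

(** A twisted degree lies between 1 and 2 (q - 1), its residue modulo q - 1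
    depends on r and j alone, and the carry set says in which half it lies. *)
Lemma class_twdeg x y : theta_class r x = theta_class r y ->
  dexp x = dexp y /\ forall i : 'I_f, twdeg x i = twdeg y i.
Proof.
rewrite !theta_classE => -[eI ej]; have ej' : dexp x = dexp y by rewrite /dexp ej.
split=> // i; have := twdeg_mod i ej'.
have q0 : q = q.-1.+1 by rewrite prednK // ltnW.
have Q0 : 0 < q.-1 by rewrite -ltnS -q0.
have dmax z : twdeg z i <= 2 * q.-1.
  by rewrite mul2n -addnn leq_add // digit_rot_le_pred.
have d0 z : 0 < twdeg z i by rewrite addn_gt0 !digit_rot_gt0 // -addn_gt0 exp_gt0.
have : (q <= twdeg x i) = (q <= twdeg y i) by have /setP/(_ i) := eI; rewrite !inE.
have := dmax x; have := dmax y; have := d0 x; have := d0 y.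
move: (twdeg x i) (twdeg y i) => m n; rewrite q0 /=; move: (q.-1) Q0 => Q Q0 n0 m0 n2 m2 mn /eqP.
have [mQ|mQ] := leqP m Q; have [nQ|nQ] := leqP n Q; try (by move: mn; lia).
- by move/eqP; apply: eq_mod_pos.
- rewrite -(subnK (ltnW mQ)) -(subnK (ltnW nQ)) !modnDr => /eqP h.
  by congr (_ + _); apply: eq_mod_pos h; rewrite ?subn_gt0 ?leq_subLR ?addnn -?mul2n.
Qed.

Lemma class_twdegP x y : dexp x = dexp y -> (forall i : 'I_f, twdeg x i = twdeg y i) ->
  theta_class r x = theta_class r y.
Proof.
move=> xy dxy; rewrite !theta_classE; congr (_, _); last exact: val_inj.
by apply/setP => i; rewrite !inE dxy.
Qed.

Lemma class_sum x y : theta_class r x = theta_class r y -> xexp x + yexp x = xexp y + yexp y.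
Proof.
have fp : f.-1 < f by rewrite prednK.
by move=> /class_twdeg[_ /(_ (Ordinal fp))]; rewrite /twdeg /= !digit_rot_last.
Qed.

(** The recursion of the rotations recovers the digit sums from the twisted
    degrees. *)
Lemma class_dig x y (i : 'I_f) : theta_class r x = theta_class r y ->
  dig p (xexp x) i + dig p (yexp x) i = dig p (xexp y) i + dig p (yexp y) i.
Proof.
have Q0 : 0 < q.-1 by rewrite -ltnS prednK // ltnW.
have drec z : p * twdeg z i = q.-1 * (dig p (xexp z) i + dig p (yexp z) i) + twdeg z (ord_pred i).
  exact: sum_digit_rot_rec.
move=> /class_twdeg[_ dxy]; apply/eqP; rewrite -(eqn_pmul2l Q0) -(eqn_add2r (twdeg x (ord_pred i))).
by rewrite -drec dxy (dxy (ord_pred i)) drec.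
Qed.

Lemma class_swap x : theta_class r (swap x) = theta_class r x.
Proof.
by have [_ _ hd] := swapE x; apply: class_twdegP => // i; rewrite twdeg_swap.
Qed.

Lemma class_le_y x y : theta_class r x = theta_class r y -> dle p f (yexp y) (yexp x) ->
  le y x.
Proof.
move=> xy d; have [ej _] := class_twdeg xy.
have yx : dle p f (yexp x - yexp y) (yexp x) by apply: dleB.
have lt : yexp x - yexp y < q by rewrite (leq_ltn_trans (leq_subr _ _)).
have leq := dle_leq p_pr (ylt y) (ylt x) d.
have := le_shift_y p_pr f_gt0 r_neq0 lt yx.
have e1 : xexp x + (yexp x - yexp y) = xexp y by have := class_sum xy; lia.
have e2 : yexp x - (yexp x - yexp y) = yexp y by lia.
by rewrite e1 e2 ej mono_theta_exp.
Qed.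

Lemma class_le_x x y : theta_class r x = theta_class r y -> dle p f (xexp y) (xexp x) ->
  le y x.
Proof.
move=> xy d; apply: theta_le_trans (swap_le p_pr f_gt0 r_neq0 x).
apply: theta_le_trans (swap_ge p_pr f_gt0 r_neq0 y) _.
apply: class_le_y; first by rewrite !class_swap.
by have [_ -> _] := swapE x; have [_ -> _] := swapE y.
Qed.

(** The digit sums of the exponents of X and Y determine the twisted degrees,
    and they are kept when minima are taken in Y and maxima in X. *)
Lemma class_meet x y : theta_class r x = theta_class r y ->
  exists z, [/\ theta_class r z = theta_class r x, dle p f (yexp z) (yexp x),
    dle p f (yexp z) (yexp y) & dle p f (xexp x) (xexp z)].
Proof.
move=> xy.
pose cb i := minn (dig p (yexp x) i) (dig p (yexp y) i).
pose ca i := maxn (dig p (xexp x) i) (dig p (xexp y) i).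
have cab i : i < f -> ca i + cb i = dig p (xexp x) i + dig p (yexp x) i.
  by move=> lf; have := class_dig (Ordinal lf) xy; rewrite /= /ca /cb; lia.
have cbp i : i < f -> cb i < p by move=> _; rewrite gtn_min dig_ltp.
have cap i : i < f -> ca i < p by move=> _; rewrite gtn_max !dig_ltp.
have [a aq da] : exists2 a, a < q & forall i, i < f -> dig p a i = ca i.
  by exists (\sum_(i < f) ca i * p ^ i) => [|i lf]; [apply: sum_digits_lt | apply: dig_sum].
have [b bq db] : exists2 b, b < q & forall i, i < f -> dig p b i = cb i.
  by exists (\sum_(i < f) cb i * p ^ i) => [|i lf]; [apply: sum_digits_lt | apply: dig_sum].
have ab : a + b = xexp x + yexp x.
  rewrite -(digitsE p_pr (xlt x)) -(digitsE p_pr (ylt x)) -(digitsE p_pr aq) -(digitsE p_pr bq).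
  rewrite -!big_split /=; apply: eq_bigr => i _.
  by rewrite -!mulnDl da ?db ?cab.
have h : homog a b (dexp x) by apply: (homog_mono (y := x)); rewrite ab ?exp_gt0.
have [hx hy hd] := mono_thetaK h; rewrite (small aq) in hx; rewrite (small bq) in hy.
rewrite (small (dlt x)) in hd.
exists (mono_theta a b (dexp x)); rewrite ?hx ?hy; split.
- apply: class_twdegP => [//|i]; rewrite /twdeg hx hy.
  apply: (@rec_unique p f p_pr (fun i => digit_rot p f a i + digit_rot p f b i)
    (fun i => digit_rot p f (xexp x) i + digit_rot p f (yexp x) i)
    (fun i => q.-1 * (dig p (xexp x) i + dig p (yexp x) i))) => l.
    rewrite -(cab _ (ltn_ord l)) -(da _ (ltn_ord l)) -(db _ (ltn_ord l)).
    exact: sum_digit_rot_rec.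
  exact: sum_digit_rot_rec.
- by apply/forallP => i; rewrite (db _ (ltn_ord i)) geq_minl.
- by apply/forallP => i; rewrite (db _ (ltn_ord i)) geq_minr.
- by apply/forallP => i; rewrite (da _ (ltn_ord i)) leq_maxl.
Qed.

(** With z the meet, x is below z by comparison of the exponents of X, and z is
    below y by comparison of the exponents of Y. *)
Lemma class_le x y : theta_class r x = theta_class r y -> le x y.
Proof.
move=> xy; have [z [zx _ zy xz]] := class_meet xy.
apply: theta_le_trans (class_le_x zx xz) _.
by apply: class_le_y zy; rewrite zx.
Qed.

(** Going down never raises the exponent of D, nor the twisted degrees while the
    exponent of D is constant, so equivalent elements share all of them. The
    converse is class_le. *)
Lemma theta_class_eq x y : (theta_class r x == theta_class r y) = le x y && le y x.
Proof.
apply/eqP/andP => [xy|[/theta_le_mono xy /theta_le_mono yx]]; first by split; apply: class_le.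
case: xy yx => [xy|[xy dxy]] [yx|[yx dyx]]; try by exfalso; lia.
by apply: class_twdegP => // i; apply/eqP; rewrite eqn_leq dxy dyx.
Qed.

(** A member with the least exponent of Y equals its meet with any other member. *)
Lemma class_lowest x : exists2 z, theta_class r z = theta_class r x &
  forall y, theta_class r y = theta_class r x -> dle p f (yexp z) (yexp y).
Proof.
case: (arg_minnP (P := fun z => theta_class r z == theta_class r x) (fun z => yexp z) (eqxx _)) => z /eqP zx min.
exists z; [exact: zx | move=> y yx]; have [w [wz wyz wy _]] := class_meet (etrans zx (esym yx)).
have e : yexp w = yexp z.
  apply/eqP; rewrite eqn_leq (dle_leq p_pr (ylt w) (ylt z) wyz) /=.
  by apply: min; rewrite wz zx.
by rewrite -e.
Qed.

(** Below x, with the same exponent of D, the twisted degrees are at most those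
    of x, so they stay below q. *)
Lemma class_set0_min x y : (theta_class r x).1 = set0 -> le y x ->
  dexp y = dexp x -> theta_class r y = theta_class r x.
Proof.
move=> I0 /theta_le_mono[|[ej dyx] _]; first by move=> lt e; rewrite e ltnn in lt.
rewrite !theta_classE in I0 *; congr (_, _); last exact: val_inj.
rewrite /= in I0; rewrite I0; apply/setP => i; rewrite !inE; apply/negbTE.
have /setP/(_ i) := I0; rewrite !inE => /negbT; apply: contra => /leq_trans; exact.
Qed.

Lemma class_set0 x : xexp x = 0 \/ yexp x = 0 -> (theta_class r x).1 = set0.
Proof.
move=> xy0; rewrite theta_classE /=; apply/setP => i; rewrite !inE; apply/negbTE.
by rewrite -ltnNge /twdeg; case: xy0 => ->; rewrite digit_rot0 ?addn0 digit_rot_lt.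
Qed.

(** A nonempty carry set forces both exponents to be positive. Up to exchanging
    X and Y, one has the required member unless both exponents are q - 1, and then
    the type is the exceptional one. *)
Lemma class_generic x : (theta_class r x).1 <> set0 ->
  ~ ((theta_class r x).1 = setT /\ expo_r2 r (theta_class r x).2 = to_expo (q - 1)) ->
  exists2 y, theta_class r y = theta_class r x & 0 < xexp y < q.-1 /\ 0 < yexp y.
Proof.
move=> I0 notT.
have q0 : q = q.-1.+1 by rewrite prednK // ltnW.
have x0 : 0 < xexp x by case: (posnP (xexp x)) => // h; case: I0; apply: class_set0; left.
have y0 : 0 < yexp x by case: (posnP (yexp x)) => // h; case: I0; apply: class_set0; right.
have := xlt x; have := ylt x; rewrite {1 2}q0 !ltnS => yQ xQ.
case: (ltngtP (xexp x) q.-1) xQ => // [xQ|xE] _; first by exists x; rewrite ?x0.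
case: (ltngtP (yexp x) q.-1) yQ => // [yQ|yE] _.
  by exists (swap x); [exact: class_swap | have [-> -> _] := swapE x; rewrite x0 y0 yQ].
case: notT; split.
  have e l : l < f -> dig p q.-1 l = p.-1 := @dig_max p p_pr f l.
  rewrite theta_classE; apply/setP => i; rewrite !inE /twdeg xE yE.
  have -> : digit_rot p f q.-1 i = q.-1.
    apply: (rec_unique p_pr (x := fun i : 'I_f => digit_rot p f q.-1 i) (y := fun=> q.-1) (c := fun i => q.-1 * p.-1)) => l.
      by rewrite digit_rot_rec ?e // q0.
    by rewrite -mulnSr prednK // mulnC.
  by have -> : (q <= q.-1 + q.-1) = true by lia.
have Q0 : 0 < q.-1 by rewrite -ltnS -q0.
apply: (expo_inj_mod p_pr f_gt0).
  by rewrite to_expo_gt0 // subn1 Q0; have [-> _] := expo_r2P p_pr f_gt0 r_neq0 (theta_class r x).2.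
have [_ h] := expo_r2P p_pr f_gt0 r_neq0 (theta_class r x).2.
have /andP[_ /eqP h2] := homog_theta p_pr f_gt0 r_neq0 x.
rewrite to_expo_mod // subn1; apply/eqP; rewrite -(eqn_modDr (2 * dexp x)).
by rewrite h -h2 xE yE -addnA modnDl.
Qed.

End ThetaClasses.

(** * Submodules spanned by down-sets of a free family *)

Section SpannedSubmodules.
Variables (E : fieldType) (gT : finGroupType) (G : {group gT}) (n : nat).
Variable (rG : mx_representation E G n).
Variables (T K : finType) (F : T -> 'rV[E]_n) (cl : T -> K) (kle : rel K).

Definition span_of (P : pred T) : 'M[E]_n := (\sum_(x | P x) <<F x>>)%MS.

Lemma span_ofP (P : pred T) (u : 'rV[E]_n) :
  reflect (exists c : T -> E, u = \sum_(x | P x) c x *: F x) (u <= span_of P)%MS.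
Proof.
apply: (iffP sub_sumsmxP) => [[v ->]|[c ->]].
  have vF x : exists c : E, v x *m <<F x>>%MS == c *: F x.
    have : (v x *m <<F x>>%MS <= F x)%MS by rewrite (submx_trans (submxMl _ _)) ?genmxE.
    by case/sub_rVP => c ->; exists c.
  by exists (fun x => xchoose (vF x)); apply: eq_bigr => x _; apply/eqP/(xchooseP (vF x)).
have Fv x : exists v : 'M[E]_(1, n), c x *: F x == v *m <<F x>>%MS.
  have : (c x *: F x <= <<F x>>)%MS by rewrite genmxE scalemx_sub.
  by case/submxP => v ->; exists v.
by exists (fun x => xchoose (Fv x)); apply: eq_bigr => x _; apply/eqP/(xchooseP (Fv x)).
Qed.

Lemma span_of_subP (P : pred T) (m : nat) (W : 'M[E]_(m, n)) :
  reflect (forall x, P x -> (F x <= W)%MS) (span_of P <= W)%MS.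
Proof.
by apply: (iffP sumsmx_subP) => h x /h; rewrite genmxE.
Qed.

Lemma mem_span_of (P : pred T) x : P x -> (F x <= span_of P)%MS.
Proof. by move=> Px; move: x Px; apply/span_of_subP. Qed.

Lemma span_ofS (P Q : pred T) : subpred P Q -> (span_of P <= span_of Q)%MS.
Proof. by move=> PQ; apply/span_of_subP => x /PQ; apply: mem_span_of. Qed.

Hypothesis F_free : forall c : T -> E, \sum_x c x *: F x = 0 -> forall x, c x = 0.

(** Coefficients on a free family are unique. *)
Lemma span_of_cap (P Q : pred T) :
  (span_of P :&: span_of Q <= span_of (predI P Q))%MS.
Proof.
apply/rV_subP => u; rewrite sub_capmx => /andP[/span_ofP[c uc] /span_ofP[d ud]].
pose e (a : T -> E) (R : pred T) x := if R x then a x else 0.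
have eE (a : T -> E) (R : pred T) : \sum_(x | R x) a x *: F x = \sum_x e a R x *: F x.
  by rewrite big_mkcond; apply: eq_bigr => x _; rewrite /e; case: ifP; rewrite ?scale0r.
have cd x : e c P x = e d Q x.
  apply/eqP; rewrite -subr_eq0; apply/eqP.
  apply: (F_free (c := fun x => e c P x - e d Q x)).
  under eq_bigr => y _ do rewrite scalerBl.
  by rewrite sumrB -(eE c P) -(eE d Q) -uc -ud subrr.
apply/span_ofP; exists c; rewrite uc (eE c P) (eE c (predI P Q)); apply: eq_bigr => x _.
have := cd x; rewrite /e /=; case: (P x) => //=; case: (Q x) => //= ->.
by [].
Qed.

Lemma F_neq0 x : F x != 0.
Proof.
apply/negP => /eqP Fx0; have : \sum_y (y == x)%:R *: F y = 0 :> 'rV[E]_n.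
  rewrite (bigD1 x) //= Fx0 scaler0 add0r big1 // => y /negbTE->.
  by rewrite scale0r.
by move/F_free/(_ x)/eqP; rewrite eqxx oner_eq0.
Qed.

Lemma mem_span_ofE (P : pred T) x : (F x <= span_of P)%MS = P x.
Proof.
apply/idP/idP => [Fx|]; last exact: mem_span_of.
have : (F x <= span_of (predI P (pred1 x)))%MS.
  by apply: submx_trans (span_of_cap _ _); rewrite sub_capmx Fx mem_span_of /=.
apply: contraTT => nPx; rewrite /span_of big_pred0 ?submx0 ?F_neq0 // => y /=.
by case: eqP => [->|]; rewrite ?andbF // (negbTE nPx).
Qed.

Variable le : rel T.
Hypothesis cl_onto : forall t, exists x, cl x = t.
Hypothesis kleE : forall x y, kle (cl x) (cl y) = le x y.
Hypothesis le_refl : reflexive le.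
Hypothesis le_trans : transitive le.
Hypothesis cl_eq : forall x y, (cl x == cl y) = le x y && le y x.

Lemma kle_refl : reflexive kle.
Proof. by move=> t; have [x <-] := cl_onto t; rewrite kleE. Qed.

Lemma kle_trans : transitive kle.
Proof.
move=> u t w; have [x <-] := cl_onto t; have [y <-] := cl_onto u.
have [z <-] := cl_onto w; rewrite !kleE; exact: le_trans.
Qed.

Lemma kle_anti : antisymmetric kle.
Proof.
move=> u t; have [x <-] := cl_onto t; have [y <-] := cl_onto u.
by rewrite !kleE -cl_eq => /eqP.
Qed.

Definition klt u t := (u != t) && kle u t.
Definition below t : 'M[E]_n := span_of (fun x => kle (cl x) t).
Definition strictly_below t : 'M[E]_n := (\sum_(u | klt u t) below u)%MS.

Lemma below_leE t u : (below u <= below t)%MS = kle u t.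
Proof.
apply/span_of_subP/idP => [h|ut x xu]; last exact/mem_span_of/(kle_trans xu).
have [x xu] := cl_onto u; have := h x; rewrite mem_span_ofE xu.
by apply; rewrite kle_refl.
Qed.

Lemma strictly_belowE t : (strictly_below t :=: span_of (fun x => klt (cl x) t))%MS.
Proof.
apply/eqmxP/andP; split.
  apply/sumsmx_subP => u /andP[ut ult]; apply: span_ofS => x xu.
  rewrite /klt (kle_trans xu ult) andbT; apply: contraNneq ut => xt.
  by apply/eqP; apply: kle_anti; rewrite ult -xt xu.
apply/span_of_subP => x xt; apply: (sumsmx_sup (cl x)) => //.
by apply: mem_span_of; rewrite kle_refl.
Qed.

Lemma strictly_below_sub t : (strictly_below t <= below t)%MS.
Proof. by rewrite strictly_belowE; apply: span_ofS => x /andP[]. Qed.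

Hypothesis mod_below : forall t, mxmodule rG (below t).
Hypothesis mod_sbelow : forall t, mxmodule rG (strictly_below t).
Hypothesis irr : forall t (W : 'M[E]_n), mxmodule rG W -> (W <= below t)%MS ->
  ~~ (W <= strictly_below t)%MS -> (below t <= W + strictly_below t)%MS.

Lemma strictly_below_max t : max_submod rG (strictly_below t) (below t).
Proof.
split=> [|W [modW lt1 lt2]].
  rewrite /ltmx strictly_below_sub /=; apply/negP; have [x xt] := cl_onto t.
  have Fx : (F x <= below t)%MS by apply: mem_span_of; rewrite xt kle_refl.
  move/(submx_trans Fx); rewrite strictly_belowE mem_span_ofE /klt xt eqxx.
  by [].
case/andP: lt1 => [s1 n1]; case/andP: lt2 => [s2 /negP[]].
apply: submx_trans (irr modW s2 n1) _.
by rewrite addsmx_sub submx_refl s1.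
Qed.

Local Notation L t := (section_repr (mod_sbelow t) (mod_below t)).

Local Notation spn S := (span_of (fun x => cl x \in (S : {set K}))).

(** Induction on S: remove a maximal type t from S. By freeness below t meets the
    span of the rest in strictly_below t, so the second isomorphism theorem
    identifies the top factor with that of t. *)
Lemma span_of_JH (S : {set K}) :
  (forall t u, kle u t -> t \in S -> u \in S) ->
  JH_constituents rG (spn S) S (fun t => L t).
Proof.
move: {2}#|S| (erefl #|S|) => m; elim: m S => [|m IH] S Sm Sdown.
  have S0 : S = set0 by apply/eqP; rewrite -cards_eq0 Sm.
  have comp0 : mx_composition_series rG (Nil 'M[E]_n) by split=> // i.
  exists [::], comp0; split.
    by rewrite /span_of big_pred0 // => x; rewrite S0 inE.
  have h : 'I_(size (Nil 'M[E]_n)) -> K by case.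
  exists h; split; try by case.
  by rewrite S0; apply/setP => t; rewrite inE; apply/negP => /imsetP[[]].
have [t0 t0S] : exists t, t \in S by apply/set0Pn; rewrite -cards_eq0 Sm.
(* A member of S with the largest number of types below it is maximal in S. *)
case: (arg_maxnP (P := fun t => t \in S) (fun t => #|[set u | kle u t]|) t0S) => t tS tmax.
have tmx u : u \in S -> kle t u -> u = t.
  move=> uS tu; apply: kle_anti; rewrite tu andbT.
  have sub : [set w | kle w t] \subset [set w | kle w u].
    by apply/subsetP => w; rewrite !inE => /kle_trans; apply.
  have /eqP/setP/(_ u) : [set w | kle w t] == [set w | kle w u].
    by rewrite eqEcard sub; apply: tmax.
  by rewrite !inE kle_refl.
pose S' := S :\ t.
have S'm : #|S'| = m by apply/eqP; rewrite -eqSS -Sm (cardsD1 t S) tS add1n.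
have S'down w u : kle u w -> w \in S' -> u \in S'.
  rewrite !inE => uw /andP[wt wS]; rewrite (Sdown _ _ uw wS) andbT.
  by apply: contra_neq wt => ut; apply: tmx; rewrite // -ut.
have [U [compU [lastU [h [h_inj h_im h_sim]]]]] := IH S' S'm S'down.
have modS' : mxmodule rG (spn S').
  have [modU _] := compU; rewrite -(eqmx_module _ lastU) (last_nth 0).
  exact: mx_subseries_module'.
have addE : (below t + spn S' :=: spn S)%MS.
  apply/eqmxP/andP; split.
    rewrite addsmx_sub !span_ofS // => x /=; last by rewrite !inE => /andP[].
    by move=> xt; apply: Sdown xt tS.
  apply/span_of_subP => x xS; have [xt|xt] := eqVneq (cl x) t.
    by apply: submx_trans (addsmxSl _ _); apply: mem_span_of; rewrite xt kle_refl.
  by apply: submx_trans (addsmxSr _ _); apply: mem_span_of; rewrite !inE xt.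
have capE : (below t :&: spn S' :=: strictly_below t)%MS.
  apply/eqmxP/andP; rewrite !strictly_belowE; split.
    apply: submx_trans (span_of_cap _ _) _; apply: span_ofS => x /=.
    by rewrite !inE /klt => /and3P[-> -> _].
  rewrite sub_capmx !span_ofS // => x /andP[xt xlt] //=.
  by rewrite !inE xt (Sdown _ _ xlt).
have modS : mxmodule rG (spn S).
  by rewrite -(eqmx_module _ addE) addsmx_module.
have sim1 := mx_second_rsim (mod_below t) modS'.
have modlast : mxmodule rG (last 0 U) by rewrite (eqmx_module _ lastU).
have sim2 : mx_rsim (L t) (section_repr modlast modS).
  apply: mx_rsim_trans (mx_rsim_trans sim1 _); apply: section_eqmx => //.
  - exact: eqmx_sym.
  - exact: eqmx_sym.
have maxS : max_submod rG (last 0 U) (spn S).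
  apply/(max_submodP modlast modS).
    by rewrite lastU span_ofS // => x; rewrite !inE => /andP[].
  apply: mx_rsim_irr sim2 _; apply/max_submodP; last exact: strictly_below_max.
  exact: strictly_below_sub.
have compUS : mx_composition_series rG (rcons U (spn S)).
  by apply/mx_series_rcons.
exists (rcons U (spn S)), compUS.
split; first by rewrite last_rcons.
(* The new top factor, whose index is the size of U, is sent to t. *)
pose h1 (i : 'I_(size (rcons U (spn S)))) : K :=
  if insub (val i) is Some j then h j else t.
have h1l (i : 'I_(size U)) i' : val i' = val i -> h1 i' = h i.
  by move=> e; rewrite /h1 e valK.
have szE : size (rcons U (spn S)) = (size U).+1 by rewrite size_rcons.
have h1t i : (size U <= val i)%N -> h1 i = t by move=> si; rewrite /h1 insubF // ltnNge si.
have hS' j : h j \in S' by rewrite -h_im imset_f.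
have nt j : h j != t by have := hS' j; rewrite !inE => /andP[].
have itop (i : 'I_(size (rcons U (spn S)))) :
    (size U <= val i)%N -> val i = size U.
  by move=> si; apply/eqP; rewrite eqn_leq si andbT -ltnS -szE ltn_ord.
exists h1; split.
- move=> i j; case: (ltnP (val i) (size U)) => si; case: (ltnP (val j) (size U)) => sj.
  + by rewrite (h1l (Ordinal si) i) // (h1l (Ordinal sj) j) // => /h_inj[] ?; apply: val_inj.
  + by rewrite (h1l (Ordinal si) i) // (h1t j) // => e; have := nt (Ordinal si); rewrite e eqxx.
  + by rewrite (h1l (Ordinal sj) j) // (h1t i) // => e; have := nt (Ordinal sj); rewrite -e eqxx.
  + by move=> _; apply: val_inj; rewrite (itop i) // (itop j).
- apply/setP => u; apply/imsetP/idP => [[i _ ->]|uS].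
    case: (ltnP (val i) (size U)) => si; last by rewrite h1t.
    by rewrite (h1l (Ordinal si)) //; have := hS' (Ordinal si); rewrite !inE => /andP[].
  have [->|ut] := eqVneq u t.
    have lt : (size U < size (rcons U (spn S)))%N by rewrite szE.
    by exists (Ordinal lt) => //; rewrite h1t.
  have : u \in S' by rewrite !inE ut.
  rewrite -h_im => /imsetP[i _ ->].
  have lt : (i < size (rcons U (spn S)))%N by rewrite szE ltnW ?ltnS.
  by exists (Ordinal lt) => //; rewrite (h1l i).
move=> i; case: (ltnP (val i) (size U)) => si.
  rewrite (h1l (Ordinal si)) //; apply: mx_rsim_trans (h_sim (Ordinal si)).
  by apply: section_eqmx; rewrite -?rcons_cons nth_rcons ?leqW ?si.
rewrite h1t //; apply: mx_rsim_trans (mx_rsim_sym sim2).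
apply: section_eqmx; rewrite itop //; last by rewrite nth_rcons ltnn eqxx.
by rewrite -rcons_cons nth_rcons leqnn -last_nth.
Qed.

End SpannedSubmodules.

(** * The ring O/m^2 as a ring of dual numbers *)

(** The section tau makes A the ring k[w] with w^2 = 0. *)
Record dual_numbers (A : comUnitRingType) (k : fieldType) (red : A -> k)
    (tau : k -> A) (w : A) : Prop := {
  dual_D : {morph tau : x y / x + y};
  dual_M : {morph tau : x y / x * y};
  dual_K : cancel tau red;
  dual_ww : w * w = 0;
  dual_onto : forall a, exists c, a = tau (red a) + tau c * w;
  dual_inj : forall c, tau c * w = 0 -> c = 0
}.

Section Quotient.
Variables (p : nat) (p_pr : prime p).
Variables (Qp : fieldType) (abs : Qp -> rat) (QpP : is_padic_field p abs).
Variables (F : fieldExtType Qp) (v : F -> int) (e : nat).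
Hypothesis vP : is_valuation p abs v e.
Hypothesis e_ge2 : (2 <= e)%N.
Variables (A : finComUnitRingType) (piA : F -> A).
Hypothesis piAP : is_quotient v 2 piA.
Variables (k : finFieldType) (red : {rmorphism A -> k}).
Hypothesis redP : is_quotient v 1 (fun x => red (piA x)).
Variables (f : nat) (card_k : #|k| = (p ^ f)%N).
Variables (varpi : F) (varpi_neq0 : varpi != 0) (v_varpi : v varpi = 1).
Variables (teich : k -> F).
Hypothesis teichP : is_teichmuller v (fun x => red (piA x)) teich.

Let tau (x : k) := piA (teich x).
Local Notation w := (piA varpi).
Local Notation O := (in_valring v).

Let v1 : v 1 = 0.
Proof.
have := val_mul vP (oner_neq0 F) (oner_neq0 F); rewrite mulr1 => h.
by apply: (@addrI _ (v 1)); rewrite addr0 -h.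
Qed.

Let vV x : x != 0 -> v x^-1 = - v x.
Proof.
move=> x0; have := val_mul vP x0 (invr_neq0 x0); rewrite divff // v1 => h.
by apply/eqP; rewrite -addr_eq0 addrC -h.
Qed.

Let O0 : O 0. Proof. by rewrite /in_valring /in_pow_ideal eqxx. Qed.
Let O1 : O 1. Proof. by rewrite /in_valring /in_pow_ideal v1 lexx orbT. Qed.

Let OD x y : O x -> O y -> O (x + y).
Proof.
rewrite /in_valring /in_pow_ideal.
have [->|x0] := eqVneq x 0; first by rewrite add0r.
have [->|y0] := eqVneq y 0; first by rewrite addr0 (negbTE x0).
have [//|xy0] := eqVneq (x + y) 0 => /= vx vy.
by apply: le_trans (val_add vP x0 y0 xy0); rewrite le_min vx vy.
Qed.

Let On n : O n%:R.
Proof. by elim: n => [|n IH] //; rewrite -natr1; apply: OD. Qed.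

Let piA0 : piA 0 = 0.
Proof.
have := quot_add piAP O0 O0; rewrite addr0 => h.
by apply: (@addrI _ (piA 0)); rewrite addr0 -h.
Qed.

Let piAn n : piA n%:R = n%:R.
Proof.
elim: n => [|n IH]; first exact: piA0.
by rewrite -natr1 (quot_add piAP) // (quot_one piAP) IH natr1.
Qed.

(** Ramification enters here: the valuation of p is e >= 2. *)
Let pA0 : p%:R = 0 :> A.
Proof.
apply/eqP; rewrite -piAn (quot_ker piAP) // /in_pow_ideal.
have absp : abs p%:R = p%:R ^ (-1).
  by rewrite (padic_nat QpP) ?prime_gt0 // logn_prime // eqxx expr1.
have := val_ramified vP absp; rewrite scaler_nat => ->.
by rewrite mulrN1 opprK lez_nat e_ge2 orbT.
Qed.

Let p_A : p \in [pchar A].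
Proof. by rewrite inE p_pr pA0 eqxx. Qed.

Let q_gt1 : (1 < p ^ f)%N.
Proof. by rewrite -card_k finNzRing_gt1. Qed.

Let Oteich x : O (teich x). Proof. exact: (teich_int teichP). Qed.

Let Ow : O varpi. Proof. by rewrite /in_valring /in_pow_ideal v_varpi orbT. Qed.

Let tauM : {morph tau : x y / x * y}.
Proof. by move=> x y; rewrite /tau (teichM teichP) (quot_mul piAP). Qed.

Let tauK : cancel tau red. Proof. exact: (teichK teichP). Qed.

Let ww : w * w = 0.
Proof.
rewrite -(quot_mul piAP) //; apply/eqP; rewrite (quot_ker piAP).
  by rewrite /in_pow_ideal (val_mul vP) // v_varpi orbT.
by rewrite /in_valring /in_pow_ideal (val_mul vP) // v_varpi orbT.
Qed.

Let red_ker a : red a = 0 -> exists b, a = b * w.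
Proof.
have [x Ox <-] := quot_onto piAP a => /eqP; rewrite (quot_ker redP) // /in_pow_ideal.
case/orP=> [/eqP->|vx]; first by exists 0; rewrite mul0r.
have [->|x0] := eqVneq x 0; first by exists 0; rewrite mul0r.
have Oy : O (x / varpi).
  rewrite /in_valring /in_pow_ideal (val_mul vP) ?invr_neq0 // vV // v_varpi.
  by rewrite subr_ge0 vx orbT.
by exists (piA (x / varpi)); rewrite -(quot_mul piAP) // divfK.
Qed.

Let red_unit a : red a != 0 -> a \is a GRing.unit.
Proof.
have [x Ox <-] := quot_onto piAP a; rewrite (quot_ker redP) // /in_pow_ideal negb_or -ltNge => /andP[x0 vx].
have vx0 : v x = 0.
  by move: Ox; rewrite /in_valring /in_pow_ideal (negbTE x0) /=; lia.
have Ox' : O x^-1 by rewrite /in_valring /in_pow_ideal vV // vx0 oppr0 lexx orbT.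
apply/unitrP; exists (piA x^-1).
by rewrite -!(quot_mul piAP) // mulVf // divff // (quot_one piAP).
Qed.

(** The two sides differ by a multiple of w. The q-th power map is additive in
    characteristic p, kills multiples of w and fixes the values of tau. *)
Let tauD : {morph tau : x y / x + y}.
Proof.
move=> x y; have tauq z : tau z = tau z ^+ (p ^ f).
  have tauX n : (0 < n)%N -> tau (z ^+ n) = tau z ^+ n.
    by case: n => // n _; elim: n => [|n IH]; rewrite ?expr1 // exprS tauM IH -exprS.
  by rewrite -tauX ?(ltnW q_gt1) // -card_k expf_card.
have [b eb] : exists b, tau (x + y) - (tau x + tau y) = b * w.
  by apply: red_ker; rewrite rmorphB rmorphD !tauK subrr.
have pq : [pchar A].-nat (p ^ f)%N by rewrite pnatX pnatE ?p_A.
have {}eb : tau (x + y) = (tau x + tau y) + b * w by rewrite -eb [RHS]addrC subrK.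
rewrite tauq eb (exprDn_pchar _ _ pq) (exprDn_pchar _ _ pq) -!tauq.
by rewrite -(subnK q_gt1) addn2 !exprS mulrCA mulrA mulrACA ww mulr0 mul0r addr0.
Qed.

Lemma quotient_dual_numbers : dual_numbers red (fun x => piA (teich x)) w.
Proof.
have tau0 : tau 0 = 0 by apply: (@addrI _ (tau 0)); rewrite -tauD !addr0.
split=> //.
- move=> a; have [b eb] : exists b, a - tau (red a) = b * w.
    by apply: red_ker; rewrite rmorphB tauK subrr.
  have [c ec] : exists c, b - tau (red b) = c * w.
    by apply: red_ker; rewrite rmorphB tauK subrr.
  exists (red b); apply/eqP; rewrite addrC -subr_eq eb -subr_eq0 -mulrBl.
  by rewrite -/(tau _) ec -mulrA ww mulr0.
- move=> c; have [->//|c0] := eqVneq c 0 => h.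
  have : w = 0.
    have u : tau c \is a GRing.unit by apply: red_unit; rewrite tauK.
    by apply: (mulrI u); rewrite mulr0.
  by move/eqP; rewrite (quot_ker piAP) // /in_pow_ideal (negbTE varpi_neq0) v_varpi.
Qed.

Lemma quotient_pchar : p \in [pchar A].
Proof. exact: p_A. Qed.

End Quotient.

(** * Generators of GL_2 *)

Section GL2.
Variable A : finComUnitRingType.
Local Notation gT := {'GL_2[A]}.

Lemma big_I2 (R : nmodType) (F : 'I_2 -> R) : \sum_i F i = F 0 + F 1.
Proof. by rewrite big_ord_recl big_ord1; congr (_ + F _); apply: val_inj. Qed.

Lemma matrix2P (M N : 'M[A]_2) : M 0 0 = N 0 0 -> M 0 1 = N 0 1 ->
  M 1 0 = N 1 0 -> M 1 1 = N 1 1 -> M = N.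
Proof.
move=> e1 e2 e3 e4; apply/matrixP => i j.
have I2 (i0 : 'I_2) : i0 = 0 \/ i0 = 1.
  by case: i0 => [[|[|//]] ?]; [left | right]; apply: val_inj.
by case: (I2 i) => ->; case: (I2 j) => ->.
Qed.

Lemma det2E (M : 'M[A]_2) : \det M = M 0 0 * M 1 1 - M 0 1 * M 1 0.
Proof.
rewrite (expand_det_row _ 0) big_I2 /cofactor !det_mx11 !mxE /= expr0 mul1r expr1 mulN1r mulrN.
by congr (_ * M _ _ - _ * M _ _); apply: val_inj.
Qed.

Lemma GLmulE (g h : gT) i j :
  GLval (g * h)%g i j = GLval g i 0 * GLval h 0 j + GLval g i 1 * GLval h 1 j.
Proof. by rewrite FinRing.val_unitM /= mxE big_I2. Qed.

Lemma GL2_inj (g h : gT) : GLval g 0 0 = GLval h 0 0 -> GLval g 0 1 = GLval h 0 1 ->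
  GLval g 1 0 = GLval h 1 0 -> GLval g 1 1 = GLval h 1 1 -> g = h.
Proof. by move=> *; apply: val_inj; apply: matrix2P. Qed.

Lemma det_GL_unit (g : gT) : \det (GLval g) \is a GRing.unit.
Proof. exact: (valP g). Qed.

Lemma detGM (g h : gT) : \det (GLval (g * h)%g) = \det (GLval g) * \det (GLval h).
Proof. by rewrite FinRing.val_unitM; apply: det_mulmx. Qed.

Definition mx2 (a b c d : A) : 'M[A]_2 :=
  \matrix_(i, j) (if i == 0 then if j == 0 then a else b else if j == 0 then c else d).

Definition GL2 a b c d : gT := insubd (1%g : gT) (mx2 a b c d).

Lemma GL2E a b c d : a * d - b * c \is a GRing.unit ->
  [/\ GLval (GL2 a b c d) 0 0 = a, GLval (GL2 a b c d) 0 1 = b,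
      GLval (GL2 a b c d) 1 0 = c & GLval (GL2 a b c d) 1 1 = d].
Proof.
move=> u; have -> : GLval (GL2 a b c d) = mx2 a b c d.
  by apply: insubdK; rewrite -topredE /= unitmxE det2E !mxE.
by rewrite !mxE.
Qed.

Definition weyl : gT := lam_GL 0.
Definition unip (l : A) : gT := GL2 1 l 0 1.
Definition diagl (d : A) : gT := GL2 d 0 0 1.

Lemma weylE : [/\ GLval weyl 0 0 = 0, GLval weyl 0 1 = 1, GLval weyl 1 0 = 1 & GLval weyl 1 1 = 0].
Proof. by rewrite /weyl /lam_GL /= !mxE. Qed.

Lemma unipE l : [/\ GLval (unip l) 0 0 = 1, GLval (unip l) 0 1 = l,
  GLval (unip l) 1 0 = 0 & GLval (unip l) 1 1 = 1].
Proof. by apply: GL2E; rewrite mulr1 mulr0 subr0 unitr1. Qed.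

Lemma diaglE d : d \is a GRing.unit -> [/\ GLval (diagl d) 0 0 = d, GLval (diagl d) 0 1 = 0,
  GLval (diagl d) 1 0 = 0 & GLval (diagl d) 1 1 = 1].
Proof. by move=> u; apply: GL2E; rewrite mulr1 mulr0 subr0. Qed.

(** If the upper left entry is a unit, Gauss elimination writes g as a product
    of a lower unipotent, a diagonal and an upper unipotent matrix. Otherwise, A
    being local, the two other entries of the determinant are units, and the first
    case applies to the product of the Weyl element with g. *)
Lemma GL2_generated (P : gT -> Prop) :
  (forall x y : A, x + y \is a GRing.unit -> x \is a GRing.unit \/ y \is a GRing.unit) ->
  (forall g h, P g -> P h -> P (g * h)%g) -> P weyl -> (forall l, P (unip l)) ->
  (forall d, d \is a GRing.unit -> P (diagl d)) -> forall g, P g.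
Proof.
move=> loc PM Pw PU PH.
have [w00 w01 w10 w11] := weylE.
have case1 (g : gT) : GLval g 0 0 \is a GRing.unit -> P g.
  move=> u; set a := GLval g 0 0 in u; pose b : A := GLval g 0 1; pose c : A := GLval g 1 0.
  pose ca := c / a; pose ba := b / a; pose d' := GLval g 1 1 - ca * b.
  have d'u : d' \is a GRing.unit.
    have := det_GL_unit g; rewrite det2E -/a -/b -/c => h.
    have e : GLval g 0 0 * GLval g 1 1 - b * c = a * d'.
      by rewrite /d' /ca mulrBr -/a mulrA mulrCA divrr // mulr1 (mulrC c).
    by move: h; rewrite e unitrM => /andP[].
  (* Conjugation by the Weyl element makes lower triangular matrices, and the
     second diagonal entry, from the given generators. *)
  pose L := (weyl * unip ca * weyl)%g; pose H := (diagl a * (weyl * diagl d' * weyl))%g.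
  have simp := (mulr0, mul0r, mulr1, mul1r, addr0, add0r).
  have [l00 l01 l10 l11] : [/\ GLval L 0 0 = 1, GLval L 0 1 = 0, GLval L 1 0 = ca & GLval L 1 1 = 1].
    have [u00 u01 u10 u11] := unipE ca.
    by split; rewrite /L !GLmulE ?w00 ?w01 ?w10 ?w11 ?u00 ?u01 ?u10 ?u11 !simp.
  have [h00 h01 h10 h11] : [/\ GLval H 0 0 = a, GLval H 0 1 = 0, GLval H 1 0 = 0 & GLval H 1 1 = d'].
    have [h00 h01 h10 h11] := diaglE u; have [k00 k01 k10 k11] := diaglE d'u.
    by split; rewrite /H GLmulE ?h00 ?h01 ?h10 ?h11 !simp // !GLmulE ?w00 ?w01 ?w10 ?w11 ?k00 ?k01 ?k10 ?k11 !simp.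
  have -> : g = (L * H * unip ba)%g.
    have [v00 v01 v10 v11] := unipE ba.
    have gE i j : GLval (L * H * unip ba)%g i j = GLval (L * H)%g i 0 * GLval (unip ba) 0 j + GLval (L * H)%g i 1 * GLval (unip ba) 1 j.
      exact: GLmulE.
    have LH0 j : GLval (L * H)%g 0 j = GLval H 0 j by rewrite GLmulE l00 l01 !simp.
    have LH1 j : GLval (L * H)%g 1 j = ca * GLval H 0 j + GLval H 1 j by rewrite GLmulE l10 l11 !simp.
    apply: GL2_inj; rewrite gE ?LH0 ?LH1 h00 h01 ?h10 ?h11 ?v00 ?v01 ?v10 ?v11 !simp //.
    - by rewrite mulrC divrK.
    - by rewrite divrK.
    - by rewrite -mulrA (mulrC a) divrK // /d' addrC subrK.
  have PL : P L by apply: (PM) => //; apply: (PM).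
  have PH' : P H by apply: (PM); [apply: PH | apply: (PM) => //; apply: (PM) => //; apply: PH].
  by apply: (PM) => //; apply: (PM).
move=> g; case u : (GLval g 0 0 \is a GRing.unit); first exact: case1.
have [u'|u'] : GLval g 0 0 * GLval g 1 1 \is a GRing.unit \/ - (GLval g 0 1 * GLval g 1 0) \is a GRing.unit.
  by apply: loc; rewrite -det2E det_GL_unit.
  by move: u'; rewrite unitrM u.
have -> : g = (weyl * (weyl * g))%g.
  by apply: GL2_inj; rewrite !GLmulE ?w00 ?w01 ?w10 ?w11 !(mulr0, mul0r, mulr1, mul1r, addr0, add0r).
apply: (PM) => //; apply: case1; rewrite GLmulE w00 w01 mul0r mul1r add0r.
by move: u'; rewrite unitrN unitrM => /andP[].
Qed.
End GL2.

(** * Coordinates of the bottom row *)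

Section DualNumbers.
Variables (A : finComUnitRingType) (k : finFieldType) (red : {rmorphism A -> k}).
Variables (tau : k -> A) (w : A).
Hypothesis dn : dual_numbers red tau w.

Let tauD := dual_D dn.
Let tauM := dual_M dn.
Let tauK := dual_K dn.
Let ww := dual_ww dn.

Lemma tau0 : tau 0 = 0.
Proof. by apply: (@addrI _ (tau 0)); rewrite -tauD !addr0. Qed.

Lemma tauN x : tau (- x) = - tau x.
Proof. by apply/eqP; rewrite -addr_eq0 -tauD addNr tau0. Qed.

Lemma red_w : red w = 0.
Proof. by apply/eqP; rewrite -sqrf_eq0 expr2 -rmorphM ww rmorph0. Qed.

Lemma tau1 : tau 1 = 1.
Proof.
have [c e] := dual_onto dn 1; rewrite rmorph1 in e.
have e2 : tau 1 * 1 = tau 1 * (tau 1 + tau c * w) by rewrite -e.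
have : tau c * w = 0.
  apply: (@addrI _ (tau 1)); rewrite addr0 -[RHS]mulr1 e2 mulrDr mulrA -!tauM.
  by rewrite !mul1r.
by move=> h; rewrite e h addr0.
Qed.

Lemma coord_uniq a b a' b' : tau a + tau b * w = tau a' + tau b' * w -> a = a' /\ b = b'.
Proof.
move=> h; have := congr1 red h; rewrite !rmorphD !rmorphM red_w !mulr0 !addr0 !tauK => aa.
split=> //; subst a'; have /addrI h' := h.
apply/eqP; rewrite -subr_eq0; apply/eqP; apply: (dual_inj dn).
by rewrite tauD tauN mulrBl h' subrr.
Qed.

(** The coefficient of w; it is a derivation over red. *)
Definition eps (a : A) : k := (teich_coord tau w a).2.

Lemma teich_coordE a b : teich_coord tau w (tau a + tau b * w) = (a, b).
Proof.
rewrite /teich_coord; case: pickP => [[c d] /= /eqP/coord_uniq[-> ->]//|].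
by move/(_ (a, b)); rewrite eqxx.
Qed.

Lemma dual_coordE a : a = tau (red a) + tau (eps a) * w.
Proof. by have [c e] := dual_onto dn a; rewrite {3}e /eps teich_coordE. Qed.

Lemma teich_coord_red a : teich_coord tau w a = (red a, eps a).
Proof. by rewrite {1}(dual_coordE a) teich_coordE. Qed.

Lemma epsE a b : eps (tau a + tau b * w) = b.
Proof. by rewrite /eps teich_coordE. Qed.

Lemma eps_tau a : eps (tau a) = 0.
Proof. by have := epsE a 0; rewrite tau0 mul0r addr0. Qed.

Lemma eps_tauw a : eps (tau a * w) = a.
Proof. by have := epsE 0 a; rewrite tau0 add0r. Qed.

Lemma epsD : {morph eps : a b / a + b}.
Proof.
move=> a b; rewrite {1}(dual_coordE a) {1}(dual_coordE b) addrACA -tauD -mulrDl -tauD.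
by rewrite epsE.
Qed.

Lemma epsM a b : eps (a * b) = red a * eps b + eps a * red b.
Proof.
rewrite {1}(dual_coordE a) {1}(dual_coordE b).
have -> : (tau (red a) + tau (eps a) * w) * (tau (red b) + tau (eps b) * w) =
  tau (red a * red b) + tau (red a * eps b + eps a * red b) * w + tau (eps a) * tau (eps b) * (w * w).
  by rewrite tauD !tauM; ring.
by rewrite ww mulr0 addr0 epsE.
Qed.

Lemma eps1 : eps 1 = 0. Proof. by rewrite -tau1 eps_tau. Qed.
Lemma eps0 : eps 0 = 0. Proof. by rewrite -tau0 eps_tau. Qed.
Lemma epsN a : eps (- a) = - eps a.
Proof. by apply/eqP; rewrite -addr_eq0 -epsD addNr eps0. Qed.

Lemma dual_unitE (a : A) : (a \is a GRing.unit) = (red a != 0).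
Proof.
apply/idP/idP => [u|a0]; first by rewrite -unitfE rmorph_unit.
apply/unitrP; exists (tau (red a)^-1 - tau (eps a / (red a * red a)) * w).
suff e : a * (tau (red a)^-1 - tau (eps a / (red a * red a)) * w) = 1 by rewrite [X in X = _]mulrC.
rewrite [LHS]dual_coordE epsM rmorphM !rmorphB !rmorphM red_w mulr0 subr0 tauK.
rewrite epsD epsN eps_tau eps_tauw divff // add0r tau1.
have -> : red a * - (eps a / (red a * red a)) + eps a / red a = 0 by field.
by rewrite tau0 mul0r addr0.
Qed.

Lemma dual_local (x y : A) : x + y \is a GRing.unit -> x \is a GRing.unit \/ y \is a GRing.unit.
Proof.
rewrite !dual_unitE rmorphD; have [->|] := eqVneq (red x) 0; last by left.
by rewrite add0r; right.
Qed.

Local Notation gT := {'GL_2[A]}.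

Definition Xcoord (h : gT) : k := red (GLval h 1 0).
Definition Ycoord (h : gT) : k := red (GLval h 1 1).
(** For a bottom row (X + X' w, Y + Y' w) this is X Y' - X' Y. Being a
    determinant, it is multiplied by the square of d when the row is multiplied by
    d, and under the congruence kernel it changes by a quadratic form in X and Y. *)
Definition Dcoord (h : gT) : k :=
  red (GLval h 1 0) * eps (GLval h 1 1) - eps (GLval h 1 0) * red (GLval h 1 1).

Lemma coords_weyl h : [/\ Xcoord (h * weyl A)%g = Ycoord h, Ycoord (h * weyl A)%g = Xcoord h & Dcoord (h * weyl A)%g = - Dcoord h].
Proof.
have [w00 w01 w10 w11] := weylE A.
rewrite /Xcoord /Ycoord /Dcoord !GLmulE w00 w01 w10 w11 !(mulr0, mulr1, addr0, add0r); split=> //.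
by ring.
Qed.

Lemma coords_unip h (l : A) : [/\ Xcoord (h * unip l)%g = Xcoord h, Ycoord (h * unip l)%g = Ycoord h + Xcoord h * red l
  & Dcoord (h * unip l)%g = Dcoord h + Xcoord h ^+ 2 * eps l].
Proof.
have [w00 w01 w10 w11] := unipE l.
rewrite /Xcoord /Ycoord /Dcoord !GLmulE w00 w01 w10 w11 !(mulr0, mulr1, addr0, add0r); split=> //.
  by rewrite rmorphD rmorphM addrC.
by rewrite !rmorphD !rmorphM epsD epsM; ring.
Qed.

Lemma coords_diagl h (d : A) : d \is a GRing.unit ->
  [/\ Xcoord (h * diagl d)%g = Xcoord h * red d, Ycoord (h * diagl d)%g = Ycoord h
  & Dcoord (h * diagl d)%g = red d * Dcoord h - eps d * (Xcoord h * Ycoord h)].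
Proof.
move=> u; have [w00 w01 w10 w11] := diaglE u.
rewrite /Xcoord /Ycoord /Dcoord !GLmulE w00 w01 w10 w11 !(mulr0, mulr1, addr0, add0r); split=> //.
  by rewrite rmorphM.
by rewrite !rmorphM epsM; ring.
Qed.

Lemma det_weyl : \det (GLval (weyl A)) = -1.
Proof. by have [w00 w01 w10 w11] := weylE A; rewrite det2E w00 w01 w10 w11 mul0r mulr1 sub0r. Qed.

Lemma det_unip (l : A) : \det (GLval (unip l)) = 1.
Proof. by have [w00 w01 w10 w11] := unipE l; rewrite det2E w00 w01 w10 w11 mulr1 mulr0 subr0. Qed.

Lemma det_diagl (d : A) : d \is a GRing.unit -> \det (GLval (diagl d)) = d.
Proof. by move/diaglE => [w00 w01 w10 w11]; rewrite det2E w00 w01 w10 w11 mulr1 mulr0 subr0. Qed.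

Lemma coords_neq0 h : Xcoord h != 0 \/ Ycoord h != 0.
Proof.
have := det_GL_unit h; rewrite det2E dual_unitE rmorphB !rmorphM.
rewrite -/(Xcoord h) -/(Ycoord h); have [->|] := eqVneq (Xcoord h) 0; last by left.
by rewrite mulr0 subr0 mulf_eq0 negb_or => /andP[_ ->]; right.
Qed.

End DualNumbers.

(** * Power sums over a finite field *)

Section PowerSums.
Variables (k : finFieldType) (E : fieldType) (iota : {rmorphism k -> E}).

(** For n > 0, some nonzero z has z^n different from 1, because X^n - 1 has at most
    n roots; multiplication by z permutes k and multiplies the sum by z^n. For n = 0,
    translation by 1 in the sum of all c gives the claim. *)
Lemma power_sum_lt n : (n < #|k|.-1)%N -> \sum_(c : k) c ^+ n = 0.
Proof.
case: n => [|n] lt.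
  have e : \sum_(c : k) c + \sum_(c : k) 1 = \sum_(c : k) c + 0.
    by rewrite addr0 -big_split /= [RHS](reindex_inj (addIr 1)).
  by apply: etrans (addrI _ e); apply: eq_bigr => c _; rewrite expr0.
have [z z0 zn] : exists2 z : k, z != 0 & z ^+ n.+1 != 1.
  apply/exists_inP; apply: contraTT lt; rewrite negb_exists_in => /forall_inP h.
  rewrite -leqNgt.
  have := @max_unity_roots k n.+1 (enum [pred z : k | z != 0]) isT.
  rewrite enum_uniq -cardE => /(_ _ isT) H; rewrite -(cardC1 (0 : k)); apply: H.
  apply/allP => z; rewrite mem_enum inE => /h; rewrite negbK unity_rootE.
  by [].
have : \sum_(c : k) c ^+ n.+1 = z ^+ n.+1 * \sum_(c : k) c ^+ n.+1.
  rewrite mulr_sumr (reindex_inj (mulfI z0)) /=.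
  by apply: eq_bigr => c _; rewrite exprMn.
move/eqP; rewrite -subr_eq0 -{1}[\sum_c _]mul1r -mulrBl mulf_eq0 subr_eq0 eq_sym (negbTE zn) /=.
by move/eqP.
Qed.

Lemma expf_card_pred (c : k) : c != 0 -> c ^+ #|k|.-1 = 1.
Proof.
move=> c0; apply: (mulfI c0); rewrite -exprS prednK ?mulr1 ?expf_card //.
by rewrite ltnW // finNzRing_gt1.
Qed.

Lemma power_sum_eq : \sum_(c : k) c ^+ #|k|.-1 = -1.
Proof.
have q1 : (1 < #|k|)%N := finNzRing_gt1 k.
have Q0 : (0 < #|k|.-1)%N by rewrite -ltnS prednK ?(ltnW q1).
have : \sum_(c : k) (c ^+ #|k|.-1 - 1) = -1.
  rewrite (bigD1 0) //= expr0n gtn_eqF // sub0r.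
  by rewrite big1 ?addr0 // => c c0; rewrite expf_card_pred ?subrr.
rewrite big_split /= => <-; rewrite -[LHS]addr0; congr (_ + _).
have e1 : \sum_(c : k) (1 : k) = 0.
  by apply: etrans (power_sum_lt Q0); apply: eq_bigr => c _; rewrite expr0.
by rewrite sumrN e1 oppr0.
Qed.

Lemma power_sum n : (n < (#|k|.-1).*2)%N ->
  \sum_(c : k) iota c ^+ n = - (n == #|k|.-1)%:R.
Proof.
have q1 : (1 < #|k|)%N := finNzRing_gt1 k.
move=> nlt; rewrite -(eq_bigr _ (fun c _ => rmorphXn iota n c)) -rmorph_sum.
case: ltngtP => h; last by rewrite h power_sum_eq rmorphN1.
  by rewrite power_sum_lt // rmorph0 oppr0.
have [m [m0 mlt ->]] : exists m, [/\ (0 < m)%N, (m < #|k|.-1)%N & n = (m + #|k|.-1)%N].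
  by exists (n - #|k|.-1)%N; split; [rewrite subn_gt0 | lia | rewrite subnK // ltnW].
rewrite oppr0.
under eq_bigr => c _.
  have -> : c ^+ (m + #|k|.-1) = c ^+ m.
    have [->|c0] := eqVneq c 0; last by rewrite exprD expf_card_pred ?mulr1.
    by rewrite !expr0n addn_eq0 !gtn_eqF // -ltnS prednK // ltnW.
  over.
by rewrite power_sum_lt // rmorph0.
Qed.
End PowerSums.

(** * Right translation of monomials *)

Section Monomials.
Variables (p f : nat) (A : finComUnitRingType) (k : finFieldType) (red : {rmorphism A -> k}).
Variables (tau : k -> A) (w : A).
Hypothesis dn : dual_numbers red tau w.
Variables (E : fieldType) (iota : {rmorphism k -> E}) (s : expo p f).

Local Notation gT := {'GL_2[A]}.
Local Notation G := 'GL_2[A]%G.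
Local Notation rG := (regular_repr E G).
Local Notation X h := (iota (Xcoord red h)).
Local Notation Y h := (iota (Ycoord red h)).
Local Notation D h := (iota (Dcoord red tau w h)).

Lemma GL_in (g : gT) : g \in G. Proof. by rewrite inE. Qed.

Definition mono_row (a b j : nat) : 'rV[E]_#|G| :=
  fun_row G (fun h => det_s iota red s h * (X h ^+ a * Y h ^+ b * D h ^+ j)).

Lemma fun_row_act (phi : gT -> E) g : fun_row G phi *m rG g^-1%g = fun_row G (fun h => phi (h * g)%g).
Proof. by rewrite fun_row_regular ?GL_in // invgK. Qed.

Lemma det_sM g h : det_s iota red s (g * h)%g = det_s iota red s g * det_s iota red s h.
Proof. by rewrite /det_s detGM !rmorphM exprMn. Qed.

Lemma act_weyl a b j : mono_row a b j *m rG (weyl A)^-1%g = ((-1) ^+ s * (-1) ^+ j) *: mono_row b a j.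
Proof.
rewrite fun_row_act; apply/rowP => l; rewrite !mxE det_sM.
have [-> -> ->] := coords_weyl red tau w (enum_val l).
by rewrite {2}/det_s det_weyl !rmorphN1 rmorphN (exprNn (iota _)); ring.
Qed.

Lemma act_unip a b j c : mono_row a b j *m rG (unip (tau c))^-1%g =
  \sum_(i < b.+1) iota c ^+ i *: ('C(b, i)%:R *: mono_row (a + i) (b - i) j).
Proof.
rewrite fun_row_act; apply/rowP => l; rewrite summxE !mxE det_sM.
have [-> -> ->] := coords_unip dn (enum_val l) (tau c).
rewrite {2}/det_s det_unip !rmorph1 expr1n mulr1 (eps_tau dn) mulr0 addr0 (dual_K dn).
rewrite rmorphD rmorphM exprDn mulr_sumr mulr_suml mulr_sumr; apply: eq_bigr => i _.
by rewrite !mxE exprD exprMn -mulr_natl; ring.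
Qed.

Lemma act_xx a b j c : mono_row a b j *m rG (unip (tau c * w)%R)^-1%g =
  \sum_(i < j.+1) iota c ^+ i *: ('C(j, i)%:R *: mono_row (a + 2 * i) b (j - i)).
Proof.
rewrite fun_row_act; apply/rowP => l; rewrite summxE !mxE det_sM.
have [-> -> ->] := coords_unip dn (enum_val l) (tau c * w).
rewrite {2}/det_s det_unip !rmorph1 expr1n mulr1 (eps_tauw dn) rmorphM (red_w dn) mulr0 mulr0 addr0.
rewrite rmorphD rmorphM rmorphXn exprDn 2!mulr_sumr; apply: eq_bigr => i _.
by rewrite !mxE exprD exprMn -mulr_natl exprM; ring.
Qed.

Lemma unit_xy c : 1 - tau c * w \is a GRing.unit.
Proof. by rewrite (dual_unitE dn) rmorphB rmorph1 rmorphM (red_w dn) mulr0 subr0 oner_neq0. Qed.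

(** With 1 - c w, rather than 1 + c w, D goes to D + c X Y. *)
Lemma act_xy a b j c : mono_row a b j *m rG (diagl (1 - tau c * w)%R)^-1%g =
  \sum_(i < j.+1) iota c ^+ i *: ('C(j, i)%:R *: mono_row (a + i) (b + i) (j - i)).
Proof.
rewrite fun_row_act; apply/rowP => l; rewrite summxE !mxE det_sM.
have [-> -> ->] := coords_diagl dn (enum_val l) (unit_xy c).
have rE : red (1 - tau c * w) = 1 by rewrite rmorphB rmorph1 rmorphM (red_w dn) mulr0 subr0.
rewrite {2}/det_s (det_diagl (unit_xy c)) rE rmorph1 expr1n mulr1 mulr1 mul1r.
rewrite (epsD dn) (epsN dn) (eps_tauw dn) (eps1 dn) sub0r mulNr opprK.
rewrite rmorphD !rmorphM exprDn 2!mulr_sumr; apply: eq_bigr => i _.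
by rewrite !mxE !exprD !exprMn -mulr_natl; ring.
Qed.

Lemma unit_tau d : d != 0 -> tau d \is a GRing.unit.
Proof. by move=> d0; rewrite (dual_unitE dn) (dual_K dn). Qed.

Lemma act_torus a b j d : d != 0 ->
  mono_row a b j *m rG (diagl (tau d))^-1%g = iota d ^+ (s + a + j) *: mono_row a b j.
Proof.
move=> d0; have u := unit_tau d0; rewrite fun_row_act; apply/rowP => l; rewrite !mxE det_sM.
have [-> -> ->] := coords_diagl dn (enum_val l) u.
rewrite {2}/det_s (det_diagl u) (eps_tau dn) mul0r subr0 !rmorphM (dual_K dn) !exprMn !exprD.
by ring.
Qed.

(** The general unipotent and diagonal matrices factor along the decomposition
    l = tau a + tau c w and, for a unit d, along d = tau (red d) (1 - tau c w). *)
Lemma stable_module (W : 'M[E]_#|G|) :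
  (forall c, (W *m rG (unip (tau c))^-1%g <= W)%MS) ->
  (forall c, (W *m rG (unip (tau c * w)%R)^-1%g <= W)%MS) ->
  (forall c, (W *m rG (diagl (1 - tau c * w)%R)^-1%g <= W)%MS) ->
  (forall d, d != 0 -> (W *m rG (diagl (tau d))^-1%g <= W)%MS) ->
  (W *m rG (weyl A)^-1%g <= W)%MS -> mxmodule rG W.
Proof.
move=> WU WT WZ WH Ww; pose P (g : gT) := g \in rstabs rG W.
have inv g : (W *m rG g^-1%g <= W)%MS -> P g.
  by move=> h; rewrite /P -groupV inE GL_in.
have PM g h : P g -> P h -> P (g * h)%g by apply: groupM.
suff h (g : gT) : P g by apply/subsetP => g _; apply: h.
have PU c : P (unip (tau c)) by apply: inv.
have PT c : P (unip (tau c * w)) by apply: inv.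
have PZ c : P (diagl (1 - tau c * w)%R) by apply: inv.
have PH d : d != 0 -> P (diagl (tau d)) by move=> d0; apply: inv; apply: WH.
apply: (GL2_generated _ PM (inv _ Ww)) => [x y|l|d u]; first exact: (dual_local dn).
  have -> : unip l = (unip (tau (red l)) * unip (tau (eps tau w l) * w)%R)%g.
    have [a1 a2 a3 a4] := unipE l; have [b1 b2 b3 b4] := unipE (tau (red l)).
    have [c1 c2 c3 c4] := unipE (tau (eps tau w l) * w).
    apply: GL2_inj; rewrite GLmulE ?a1 ?a2 ?a3 ?a4 ?b1 ?b2 ?b3 ?b4 ?c1 ?c2 ?c3 ?c4 !(mulr0, mul0r, mulr1, mul1r, addr0, add0r) //.
    by rewrite addrC -(dual_coordE dn).
  exact: PM.
have rd0 : red d != 0 by rewrite -(dual_unitE dn).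
pose c := - (eps tau w d / red d).
have -> : diagl d = (diagl (tau (red d)) * diagl (1 - tau c * w)%R)%g.
  have [a1 a2 a3 a4] := diaglE u; have [b1 b2 b3 b4] := diaglE (unit_tau rd0).
  have [c1 c2 c3 c4] := diaglE (unit_xy c).
  apply: GL2_inj; rewrite GLmulE ?a1 ?a2 ?a3 ?a4 ?b1 ?b2 ?b3 ?b4 ?c1 ?c2 ?c3 ?c4 !(mulr0, mul0r, mulr1, mul1r, addr0, add0r) //.
  rewrite {1}(dual_coordE dn d) mulrBr mulr1 /c (tauN dn) mulNr mulrN opprK.
  by congr (_ + _); rewrite mulrA -(dual_M dn) (mulrC (red d)) divfK.
by apply: (PM); [apply: PH | apply: PZ].
Qed.

End Monomials.

(** * Coefficients of polynomial orbit maps *)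

Section OrbitCoefficients.
Variables (k : finFieldType) (E : fieldType) (iota : {rmorphism k -> E}).
Variables (gT : finGroupType) (G : {group gT}) (n : nat) (rG : mx_representation E G n).
Local Notation q := #|k|.

(** Suppose that g c moves u by a polynomial in c of degree below q. Weighting
    by c^(q-1-b) and summing over c then isolates, up to sign, the coefficient of
    c^b, because the sums of the other powers of c vanish. Hence this coefficient
    lies in every submodule that contains u. *)
Definition coef_op (g : k -> gT) (b : nat) : 'M[E]_n :=
  \sum_(c : k) iota c ^+ (q.-1 - b) *: rG (g c)^-1%g.

Lemma coef_op_module g b m (W : 'M[E]_n) (u : 'M_(m, n)) : (forall c, g c \in G) ->
  mxmodule rG W -> (u <= W)%MS -> (u *m coef_op g b <= W)%MS.
Proof.
move=> gG modW uW; rewrite /coef_op mulmx_sumr summx_sub // => c _.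
by rewrite -scalemxAr scalemx_sub // mxmodule_trans // groupV.
Qed.

Lemma coef_opE g b m (u : 'rV[E]_n) (y : nat -> 'rV[E]_n) :
  (forall c, u *m rG (g c)^-1%g = \sum_(i < m.+1) iota c ^+ i *: y i) ->
  (m < q)%N -> (0 < b < q)%N -> u *m coef_op g b = - (if (b <= m)%N then y b else 0).
Proof.
move=> uE mq /andP[b0 bq].
have sumE (i : nat) : (i < q)%N -> \sum_(c : k) iota c ^+ (q.-1 - b + i) = - (i == b)%:R.
  move=> iq; rewrite power_sum; last by lia.
  by congr (- (_ : bool)%:R); lia.
rewrite /coef_op mulmx_sumr.
under eq_bigr => c _ do rewrite -scalemxAr uE scaler_sumr.
rewrite exchange_big /=.
have termE (i : 'I_m.+1) : \sum_(c : k) iota c ^+ (q.-1 - b) *: (iota c ^+ i *: y i) = - ((i == b :> nat)%:R *: y i).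
  rewrite -scaleNr -sumE ?scaler_suml; last exact: leq_ltn_trans (ltnSE (ltn_ord i)) mq.
  by apply: eq_bigr => c _; rewrite scalerA exprD.
rewrite (eq_bigr _ (fun i _ => termE i)) sumrN; congr (- _).
case: leqP => bm.
  rewrite (bigD1 (Ordinal (bm : b < m.+1)%N)) //= eqxx scale1r big1 ?addr0 // => i.
  by rewrite -val_eqE /= => /negbTE->; rewrite scale0r.
by rewrite big1 // => i _; rewrite ltn_eqF ?scale0r // (leq_ltn_trans (ltnSE (ltn_ord i))).
Qed.

(** The weights c^(q-1-b) add up to 0 for b > 0, so the operator lies in the
    augmentation ideal of the group ring. *)
Lemma coef_op_augmentation g b (u : 'rV[E]_n) : (0 < b < q)%N ->
  u *m coef_op g b = \sum_(c : k) iota c ^+ (q.-1 - b) *: (u *m rG (g c)^-1%g - u).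
Proof.
move=> /andP[b0 bq]; rewrite /coef_op mulmx_sumr.
under [RHS]eq_bigr => c _ do rewrite scalerBr.
rewrite sumrB -scaler_suml power_sum; last by lia.
have -> : (q.-1 - b == q.-1)%N = false by lia.
rewrite oppr0 scale0r subr0; apply: eq_bigr => c _.
by rewrite scalemxAr.
Qed.
End OrbitCoefficients.

(** * Submodules and the preorder *)

Section BasisAction.
Variables (p f : nat) (p_pr : prime p) (f_gt0 : (0 < f)%N).
Variables (A : finComUnitRingType) (k : finFieldType) (red : {rmorphism A -> k}).
Variables (tau : k -> A) (w : A).
Hypothesis dn : dual_numbers red tau w.
Hypothesis card_k : #|k| = (p ^ f)%N.
Variables (E : fieldType) (iota : {rmorphism k -> E}) (s : expo p f).
Hypothesis p_E : p \in [pchar E].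
Variable r : expo p f.
Hypothesis r_neq0 : r != ord0.

Local Notation G := 'GL_2[A]%G.
Local Notation rG := (regular_repr E G).
Local Notation theta := (theta p f).
Local Notation to_expo := (to_expo p f).
Local Notation mono_theta := (@mono_theta p f).
Local Notation mono_row := (mono_row red tau w iota s).
Local Notation le := (theta_le r).
Local Notation xexp := (xexp r).
Local Notation yexp := (yexp r).
Local Notation homog := (@homog p f r).
Let ylt := yexp_lt p_pr f_gt0 r.
Let dlt := @dexp_lt p f p_pr f_gt0.
Let exp_gt0 := exp_gt0 p_pr f_gt0 r_neq0.
Let homog_mono := homog_mono p_pr f_gt0 r_neq0.

Definition basis_row (x : theta) : 'rV[E]_#|G| := mono_row (xexp x) (yexp x) (dexp x).

(** Reduction of exponents is invisible on values: c^q = c in k. *)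
Lemma expr_to_expo c m : iota c ^+ to_expo m = iota c ^+ m.
Proof.
rewrite to_expo_val ?q_gt1 //; case: m => //= m.
have mE : m.+1 = ((p ^ f).-1 * (m %/ (p ^ f).-1) + (m %% (p ^ f).-1).+1)%N.
  by rewrite addnS mulnC -divn_eq.
have [->|c0] := eqVneq c 0; first by rewrite rmorph0 !expr0n.
rewrite [in RHS]mE exprD exprM -[iota c ^+ (p ^ f).-1]rmorphXn -card_k expf_card_pred //.
by rewrite rmorph1 expr1n mul1r.
Qed.

Lemma mono_rowE a b j : homog a b j -> mono_row a b j = basis_row (mono_theta a b j).
Proof.
move=> h; have [hx hy hd] := mono_thetaK p_pr f_gt0 r_neq0 h.
by apply/rowP => i; rewrite !mxE hx hy hd !expr_to_expo.
Qed.

Local Notation Lucas := (Lucas p_pr p_E).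

(** If the binomial coefficient is not 0 in E then, by Lucas, i is digitwise
    below the exponent of Y, and the shifted monomial is below x in the preorder. *)
Lemma term_unip_sub m (W : 'M[E]_(m, #|G|)) x i : (i <= yexp x)%N ->
  (forall z, le z x -> (basis_row z <= W)%MS) ->
  ('C(yexp x, i)%:R *: mono_row (xexp x + i) (yexp x - i) (dexp x) <= W)%MS.
Proof.
move=> iy zW; have iq := leq_ltn_trans iy (ylt x).
case C0: ('C(yexp x, i)%:R == 0 :> E); first by rewrite (eqP C0) scale0r sub0mx.
rewrite scalemx_sub // mono_rowE; last by apply: (homog_mono (y := x)); have := exp_gt0 x; lia.
apply: zW; apply: (le_shift_y p_pr f_gt0 r_neq0 iq).
by rewrite (Lucas iq (ylt x)) in C0; apply: negbFE.
Qed.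

Lemma term_xx_sub m (W : 'M[E]_(m, #|G|)) x i : (i <= dexp x)%N ->
  (forall z, le z x -> (basis_row z <= W)%MS) ->
  ('C(dexp x, i)%:R *: mono_row (xexp x + 2 * i) (yexp x) (dexp x - i) <= W)%MS.
Proof.
move=> iy zW; have iq := leq_ltn_trans iy (dlt x).
case C0: ('C(dexp x, i)%:R == 0 :> E); first by rewrite (eqP C0) scale0r sub0mx.
rewrite scalemx_sub // mono_rowE; last by apply: (homog_mono (y := x)); have := exp_gt0 x; lia.
apply: zW; apply: (le_shift_xx p_pr f_gt0 r_neq0 iq).
by rewrite (Lucas iq (dlt x)) in C0; apply: negbFE.
Qed.

Lemma term_xy_sub m (W : 'M[E]_(m, #|G|)) x i : (i <= dexp x)%N ->
  (forall z, le z x -> (basis_row z <= W)%MS) ->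
  ('C(dexp x, i)%:R *: mono_row (xexp x + i) (yexp x + i) (dexp x - i) <= W)%MS.
Proof.
move=> iy zW; have iq := leq_ltn_trans iy (dlt x).
case C0: ('C(dexp x, i)%:R == 0 :> E); first by rewrite (eqP C0) scale0r sub0mx.
rewrite scalemx_sub // mono_rowE; last by apply: (homog_mono (y := x)); have := exp_gt0 x; lia.
apply: zW; apply: (le_shift_xy p_pr f_gt0 r_neq0 iq).
by rewrite (Lucas iq (dlt x)) in C0; apply: negbFE.
Qed.

(** Every generator of the group expands a monomial into monomials below it. *)
Lemma ideal_module (P : pred theta) : (forall x y, le x y -> P y -> P x) ->
  mxmodule rG (span_of basis_row P).
Proof.
move=> Pdown; set W := span_of basis_row P.
have PW z x : P x -> le z x -> (basis_row z <= W)%MS.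
  by move=> Px zx; apply: mem_span_of; apply: Pdown zx Px.
have stab g : (forall x, P x -> (basis_row x *m rG g <= W)%MS) -> (W *m rG g <= W)%MS.
  move=> h; rewrite sumsmxMr; apply/sumsmx_subP => x Px.
  by rewrite (eqmxMr _ (genmxE _)) h.
apply: (stable_module dn) => [c|c|c|d d0|]; apply: stab => x Px.
- rewrite act_unip // summx_sub // => i _; rewrite scalemx_sub //.
  by apply: term_unip_sub; [rewrite -ltnS | move=> z; apply: PW].
- rewrite act_xx // summx_sub // => i _; rewrite scalemx_sub //.
  by apply: term_xx_sub; [rewrite -ltnS | move=> z; apply: PW].
- rewrite act_xy // summx_sub // => i _; rewrite scalemx_sub //.
  by apply: term_xy_sub; [rewrite -ltnS | move=> z; apply: PW].
- by rewrite act_torus // scalemx_sub // (PW x x) // theta_le_refl.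
rewrite act_weyl scalemx_sub // mono_rowE; last first.
  by apply: (homog_mono (y := x)); have := exp_gt0 x; lia.
by apply: (PW _ x) => //; apply: swap_le.
Qed.

Local Notation op_unip := (coef_op iota rG (fun c => unip (tau c))).
Local Notation op_xx := (coef_op iota rG (fun c => unip (tau c * w))).
Local Notation op_xy := (coef_op iota rG (fun c => diagl (1 - tau c * w))).

Lemma coef_unip x b : (0 < b < p ^ f)%N ->
  basis_row x *m op_unip b =
  - (if (b <= yexp x)%N then 'C(yexp x, b)%:R *: mono_row (xexp x + b) (yexp x - b) (dexp x) else 0).
Proof.
move=> bq; apply: (coef_opE (m := yexp x)
   (y := fun i => 'C(yexp x, i)%:R *: mono_row (xexp x + i) (yexp x - i) (dexp x))); rewrite ?card_k //.
by move=> c; apply: act_unip.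
Qed.

Lemma coef_xx x b : (0 < b < p ^ f)%N ->
  basis_row x *m op_xx b =
  - (if (b <= dexp x)%N then 'C(dexp x, b)%:R *: mono_row (xexp x + 2 * b) (yexp x) (dexp x - b) else 0).
Proof.
move=> bq; apply: (coef_opE (m := dexp x)
   (y := fun i => 'C(dexp x, i)%:R *: mono_row (xexp x + 2 * i) (yexp x) (dexp x - i))); rewrite ?card_k //.
by move=> c; apply: act_xx.
Qed.

Lemma coef_xy x b : (0 < b < p ^ f)%N ->
  basis_row x *m op_xy b =
  - (if (b <= dexp x)%N then 'C(dexp x, b)%:R *: mono_row (xexp x + b) (yexp x + b) (dexp x - b) else 0).
Proof.
move=> bq; apply: (coef_opE (m := dexp x)
   (y := fun i => 'C(dexp x, i)%:R *: mono_row (xexp x + i) (yexp x + i) (dexp x - i))); rewrite ?card_k //.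
by move=> c; apply: act_xy.
Qed.

Lemma scale_sub_inv m (W : 'M[E]_(m, #|G|)) (a : E) (u : 'rV_#|G|) :
  a != 0 -> (- (a *: u) <= W)%MS -> (u <= W)%MS.
Proof. by move=> a0; rewrite eqmx_opp (eqmx_scale _ a0). Qed.

Lemma dle_bin_neq0 i n : (i < p ^ f)%N -> (n < p ^ f)%N -> dle p f i n ->
  'C(n, i)%:R != 0 :> E.
Proof. by move=> iq nq d; rewrite (Lucas iq nq) d. Qed.

Lemma pX_bnd (m : 'I_f) : (0 < p ^ m < p ^ f)%N.
Proof. by rewrite expn_gt0 prime_gt0 //= (expX_lt p_pr). Qed.

(** The coefficient operator of order p^m yields the shifted monomial times a
    binomial coefficient, which is nonzero by Lucas. *)
Lemma module_step_y (W : 'M[E]_#|G|) x (m : 'I_f) :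
   (0 < dig p (yexp x) m)%N ->
  (basis_row x *m op_unip (p ^ m)%N <= W)%MS ->
  (basis_row (mono_theta (xexp x + p ^ m) (yexp x - p ^ m) (dexp x))%N <= W)%MS.
Proof.
move=> xm; have /andP[pm0 pmq] := pX_bnd m.
have d : dle p f (p ^ m) (yexp x) by rewrite dleX.
have l := dle_leq p_pr pmq (ylt x) d.
rewrite coef_unip ?pX_bnd // l => /(scale_sub_inv (dle_bin_neq0 pmq (ylt x) d)).
by rewrite mono_rowE //; apply: (homog_mono (y := x)); have := exp_gt0 x; lia.
Qed.

Lemma module_step_xx (W : 'M[E]_#|G|) x (m : 'I_f) :
   (0 < dig p (dexp x) m)%N ->
  (basis_row x *m op_xx (p ^ m)%N <= W)%MS ->
  (basis_row (mono_theta (xexp x + 2 * p ^ m) (yexp x) (dexp x - p ^ m))%N <= W)%MS.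
Proof.
move=> xm; have /andP[pm0 pmq] := pX_bnd m.
have d : dle p f (p ^ m) (dexp x) by rewrite dleX.
have l := dle_leq p_pr pmq (dlt x) d.
rewrite coef_xx ?pX_bnd // l => /(scale_sub_inv (dle_bin_neq0 pmq (dlt x) d)).
by rewrite mono_rowE //; apply: (homog_mono (y := x)); have := exp_gt0 x; lia.
Qed.

Lemma module_step_xy (W : 'M[E]_#|G|) x (m : 'I_f) :
   (0 < dig p (dexp x) m)%N ->
  (basis_row x *m op_xy (p ^ m)%N <= W)%MS ->
  (basis_row (mono_theta (xexp x + p ^ m) (yexp x + p ^ m) (dexp x - p ^ m))%N <= W)%MS.
Proof.
move=> xm; have /andP[pm0 pmq] := pX_bnd m.
have d : dle p f (p ^ m) (dexp x) by rewrite dleX.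
have l := dle_leq p_pr pmq (dlt x) d.
rewrite coef_xy ?pX_bnd // l => /(scale_sub_inv (dle_bin_neq0 pmq (dlt x) d)).
by rewrite mono_rowE //; apply: (homog_mono (y := x)); have := exp_gt0 x; lia.
Qed.

Lemma module_swap (W : 'M[E]_#|G|) x : mxmodule rG W -> (basis_row x <= W)%MS ->
  (basis_row (mono_theta (yexp x) (xexp x) (dexp x)) <= W)%MS.
Proof.
move=> modW xW; have := mxmodule_trans modW (GL_in (weyl A)^-1%g) xW.
rewrite act_weyl eqmx_scale; last by rewrite mulf_neq0 ?expf_neq0 ?oppr_eq0 ?oner_neq0.
by rewrite mono_rowE //; apply: (homog_mono (y := x)); have := exp_gt0 x; lia.
Qed.

(** Each step of the preorder is carried out by an element of the group ring.
    Together with ideal_module this makes the preorder the relation of generation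
    between basis vectors. *)
Lemma module_le (W : 'M[E]_#|G|) x y : mxmodule rG W -> le x y -> (basis_row y <= W)%MS ->
  (basis_row x <= W)%MS.
Proof.
move=> modW /connectP[t]; elim: t x => [|z t IH] x /=; first by move=> _ ->.
case/andP=> xz zt e yW; have {IH e zt} zW := IH _ zt e yW.
have op g b : (basis_row z *m coef_op iota rG g b <= W)%MS.
  by apply: coef_op_module => // c; rewrite GL_in.
case/(theta_stepP p_pr f_gt0 r_neq0): xz => [[m zm ->]|->|[m zm [->|->]]].
- exact: module_step_y zm (op _ _).
- exact: module_swap.
- exact: module_step_xx zm (op _ _).
- exact: module_step_xy zm (op _ _).
Qed.

End BasisAction.

(** * Functions on k as polynomials *)

Section Interpolation.
Variables (k : finFieldType) (E : fieldType) (iota : {rmorphism k -> E}).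
Local Notation q := #|k|.

Lemma poly_vanish m (b : nat -> E) : (m <= q)%N ->
  (forall t, \sum_(i < m) b i * iota t ^+ i = 0) -> forall i, (i < m)%N -> b i = 0.
Proof.
move=> mq h i im; pose P := \poly_(i < m) b i.
have rootP (t : k) : root P (iota t) by rewrite /root horner_poly h.
have : P = 0.
  apply/eqP/negPn/negP => P0.
  have := @max_poly_roots _ P [seq iota t | t <- enum k] P0.
  rewrite (map_inj_uniq (fmorph_inj iota)) enum_uniq size_map -cardE ltnNge.
  rewrite (leq_trans (size_poly _ _) mq) => /(_ _ isT) H.
  have /H : all (root P) [seq iota t | t <- enum k] by apply/allP => _ /mapP[t _ ->]; apply: rootP.
  by [].
by move/polyP/(_ i); rewrite coef_poly im coef0.
Qed.

Lemma poly_interpolate (psi : k -> E) : exists b : nat -> E,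
  forall t, psi t = \sum_(i < q) b i * iota t ^+ i.
Proof.
have q1 : (1 < q)%N := finNzRing_gt1 k.
have Q0 : (0 < q.-1)%N by rewrite -ltnS prednK ?(ltnW q1).
(* On k, the polynomial 1 - (X - c)^(q-1) is the indicator function of c. *)
pose P := \sum_(c : k) psi c *: (1 - ('X - (iota c)%:P) ^+ q.-1) : {poly E}.
have szP : (size P <= q)%N.
  apply: leq_trans (size_sum _ _ _) _; apply/bigmax_leqP => c _.
  apply: leq_trans (size_scale_leq _ _) _; apply: leq_trans (size_polyD _ _) _.
  by rewrite size_polyN size_exp_XsubC size_poly1 geq_max prednK ?leqnn ?(ltnW q1).
exists (fun i => P`_i) => t; rewrite -(horner_coef_wide _ szP) /P horner_sum.
rewrite (bigD1 t) //= !hornerE subrr expr0n gtn_eqF // subr0 mulr1 big1 ?addr0 // => c ct.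
rewrite !hornerE -rmorphB -rmorphXn expf_card_pred ?rmorph1 ?subrr ?mulr0 //.
by rewrite subr_eq0 eq_sym.
Qed.

Lemma poly_interpolate2 (psi : k -> k -> E) : exists b : nat -> nat -> E,
  forall s t, psi s t = \sum_(i < q) \sum_(j < q) b i j * (iota s ^+ i * iota t ^+ j).
Proof.
(* Finite functions as coefficients make the existence statements decidable,
   so that xchoose provides families of coefficients. *)
have h t : exists b : {ffun 'I_q -> E}, [forall s, psi s t == \sum_(i < q) b i * iota s ^+ i].
  have [b bE] := poly_interpolate (psi^~ t); exists [ffun i : 'I_q => b i].
  by apply/forallP => s; rewrite bE; apply/eqP/eq_bigr => i _; rewrite ffunE.
pose b t := xchoose (h t).
have bE t s : psi s t = \sum_(i < q) b t i * iota s ^+ i.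
  by have /forallP/(_ s)/eqP := xchooseP (h t).
have h2 i : exists d : {ffun 'I_q -> E}, [forall t, b t i == \sum_(j < q) d j * iota t ^+ j].
  have [d dE] := poly_interpolate (b^~ i); exists [ffun j : 'I_q => d j].
  by apply/forallP => t; rewrite dE; apply/eqP/eq_bigr => j _; rewrite ffunE.
pose d i := xchoose (h2 i).
have dE i t : b t i = \sum_(j < q) d i j * iota t ^+ j.
  by have /forallP/(_ t)/eqP := xchooseP (h2 i).
exists (fun i j => if (insub i, insub j) is (Some i', Some j') then d i' j' else 0) => s t.
rewrite bE; apply: eq_bigr => i _; rewrite dE mulr_suml; apply: eq_bigr => j _.
by rewrite !valK mulrAC mulrA.
Qed.
End Interpolation.

(** * Linear independence of the monomials *)

Section Independence.
Variables (p f : nat) (p_pr : prime p) (f_gt0 : (0 < f)%N).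
Variables (A : finComUnitRingType) (k : finFieldType) (red : {rmorphism A -> k}).
Variables (tau : k -> A) (w : A).
Hypothesis dn : dual_numbers red tau w.
Hypothesis card_k : #|k| = (p ^ f)%N.
Variables (E : fieldType) (iota : {rmorphism k -> E}) (s : expo p f).
Hypothesis p_E : p \in [pchar E].
Variable r : expo p f.
Hypothesis r_neq0 : r != ord0.

Local Notation gT := {'GL_2[A]}.
Local Notation G := 'GL_2[A]%G.
Local Notation theta := (theta p f).
Local Notation xexp := (xexp r).
Local Notation yexp := (yexp r).
Local Notation homog := (@homog p f r).

Local Notation basis_row := (basis_row red tau w iota s r).
Local Notation X h := (iota (Xcoord red h)).
Local Notation Y h := (iota (Ycoord red h)).
Local Notation D h := (iota (Dcoord red tau w h)).
Local Notation expr_to_expo := (expr_to_expo p_pr f_gt0 card_k iota).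

(** The matrices rep_fin l, with bottom row (1, l), and rep_inf l for l in the
    maximal ideal, with bottom row (-l, 1), represent the cosets of the Borel
    subgroup; X vanishes on the latter and not on the former. *)
Definition rep_fin (l : A) : gT := GL2 0 (-1) 1 l.
Definition rep_inf (l : A) : gT := GL2 1 0 (- l) 1.
Definition rep_fin_inv (l : A) : gT := GL2 l 1 (-1) 0.
Definition rep_inf_inv (l : A) : gT := GL2 1 0 l 1.

Lemma rep_finE l : [/\ GLval (rep_fin l) 0 0 = 0, GLval (rep_fin l) 0 1 = -1, GLval (rep_fin l) 1 0 = 1 & GLval (rep_fin l) 1 1 = l].
Proof. by apply: GL2E; rewrite mul0r mulN1r opprK add0r unitr1. Qed.
Lemma rep_infE l : [/\ GLval (rep_inf l) 0 0 = 1, GLval (rep_inf l) 0 1 = 0, GLval (rep_inf l) 1 0 = - l & GLval (rep_inf l) 1 1 = 1].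
Proof. by apply: GL2E; rewrite mul0r mulr1 subr0 unitr1. Qed.
Lemma rep_fin_invE l : [/\ GLval (rep_fin_inv l) 0 0 = l, GLval (rep_fin_inv l) 0 1 = 1, GLval (rep_fin_inv l) 1 0 = -1 & GLval (rep_fin_inv l) 1 1 = 0].
Proof. by apply: GL2E; rewrite mulr0 mulrN1 opprK add0r unitr1. Qed.
Lemma rep_inf_invE l : [/\ GLval (rep_inf_inv l) 0 0 = 1, GLval (rep_inf_inv l) 0 1 = 0, GLval (rep_inf_inv l) 1 0 = l & GLval (rep_inf_inv l) 1 1 = 1].
Proof. by apply: GL2E; rewrite mul0r mulr1 subr0 unitr1. Qed.

Local Notation simp := (mulr0, mul0r, mulr1, mul1r, addr0, add0r, mulrN1, mulN1r, opprK).

Lemma rep_finK l : (rep_fin_inv l * rep_fin l)%g = 1%g.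
Proof.
have [a1 a2 a3 a4] := rep_fin_invE l; have [b1 b2 b3 b4] := rep_finE l.
have o i j : GLval (1%g : gT) i j = (i == j)%:R by rewrite FinRing.val_unit1 mxE.
by apply: GL2_inj; rewrite GLmulE o ?a1 ?a2 ?a3 ?a4 ?b1 ?b2 ?b3 ?b4 !simp ?subrr ?addNr.
Qed.

Lemma rep_infK l : (rep_inf_inv l * rep_inf l)%g = 1%g.
Proof.
have [a1 a2 a3 a4] := rep_inf_invE l; have [b1 b2 b3 b4] := rep_infE l.
have o i j : GLval (1%g : gT) i j = (i == j)%:R by rewrite FinRing.val_unit1 mxE.
by apply: GL2_inj; rewrite GLmulE o ?a1 ?a2 ?a3 ?a4 ?b1 ?b2 ?b3 ?b4 !simp ?subrr ?addNr.
Qed.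

Lemma det_s_neq0 g : det_s iota red s g != 0.
Proof.
rewrite /det_s expf_neq0 // fmorph_eq0 -(dual_unitE dn); exact: det_GL_unit.
Qed.

Lemma fun_rowE (phi : gT -> E) g : fun_row G phi 0 (gring_index G g) = phi g.
Proof. by rewrite mxE gring_indexK ?GL_in. Qed.

Lemma row_fun_row (u : 'rV[E]_#|G|) : u = fun_row G (fun g => u 0 (gring_index G g)).
Proof. by apply/rowP => i; rewrite mxE gring_valK. Qed.

Lemma expr_congr c m n : (0 < m)%N -> (0 < n)%N -> m = n %[mod (p ^ f).-1] ->
  iota c ^+ m = iota c ^+ n.
Proof.
move=> m0 n0 mn; rewrite -expr_to_expo -[RHS]expr_to_expo.
by rewrite (to_expo_congr p_pr f_gt0 _ mn) // m0 n0.
Qed.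

Lemma expr_homog c a b j : homog a b j -> iota c ^+ (a + b + 2 * j) = iota c ^+ r.
Proof.
case/andP=> ab0 /eqP e; apply: expr_congr e; last by rewrite lt0n.
by rewrite addn_gt0 ab0.
Qed.

(** Homogeneity allows division by powers of X, so that where X does not vanish a
    monomial is X^r times a monomial in Y / X and D / X^2. *)
Lemma mono_X (x y d : k) a b j : homog a b j -> x != 0 ->
  iota x ^+ a * iota y ^+ b * iota d ^+ j =
  iota x ^+ r * (iota (y / x) ^+ b * iota (d / x ^+ 2) ^+ j).
Proof.
move=> h x0; rewrite -(expr_homog _ h) !rmorphM !fmorphV rmorphXn !exprMn !exprVn -exprM !exprD.
have nz m : iota x ^+ m != 0 by rewrite expf_neq0 // fmorph_eq0.
by field; rewrite !nz.
Qed.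

Lemma mono_Y (y d : k) b j : homog 0 b j -> y != 0 ->
  iota y ^+ b * iota d ^+ j = iota y ^+ r * iota (d / y ^+ 2) ^+ j.
Proof.
move=> h y0; rewrite -(expr_homog _ h) add0n rmorphM fmorphV rmorphXn exprMn exprVn -exprM exprD.
have nz m : iota y ^+ m != 0 by rewrite expf_neq0 // fmorph_eq0.
by field; rewrite !nz.
Qed.

Let homogT := homog_theta p_pr f_gt0 r_neq0.

Lemma basis_row_val x g : basis_row x 0 (gring_index G g) =
  det_s iota red s g * (X g ^+ xexp x * Y g ^+ yexp x * D g ^+ dexp x).
Proof. exact: fun_rowE. Qed.

Lemma coords_rep_fin a b : [/\ Xcoord red (rep_fin (tau a + tau b * w)) = 1, Ycoord red (rep_fin (tau a + tau b * w)) = a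
  & Dcoord red tau w (rep_fin (tau a + tau b * w)) = b].
Proof.
have [b1 b2 b3 b4] := rep_finE (tau a + tau b * w); rewrite /Xcoord /Ycoord /Dcoord b3 b4 (epsE dn) (eps1 dn).
by rewrite rmorph1 rmorphD rmorphM (red_w dn) mulr0 addr0 (dual_K dn) mul1r mul0r subr0.
Qed.

Lemma coords_rep_inf a : [/\ Xcoord red (rep_inf (tau a * w)) = 0, Ycoord red (rep_inf (tau a * w)) = 1
  & Dcoord red tau w (rep_inf (tau a * w)) = a].
Proof.
have [b1 b2 b3 b4] := rep_infE (tau a * w); rewrite /Xcoord /Ycoord /Dcoord b3 b4 (epsN dn) (eps_tauw dn).
by rewrite rmorph1 rmorphN rmorphM (red_w dn) mulr0 oppr0 (eps1 dn) mulr0 mulr1 sub0r opprK.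
Qed.

Lemma sum_expo (F : expo p f -> E) (t : E) :
  \sum_(j : expo p f) F j * t ^+ j = \sum_(i < (p ^ f).-1.+1) F (inord i) * t ^+ i.
Proof. by apply: eq_bigr => j _; rewrite inord_val. Qed.

Let qE : (p ^ f).-1.+1 = #|k|.
Proof. by rewrite card_k prednK // expn_gt0 prime_gt0. Qed.

Lemma sum_theta (F : theta -> E) :
  \sum_x F x = \sum_(j : expo p f) F (None, j) + \sum_(i : expo p f) \sum_(j : expo p f) F (Some i, j).
Proof.
rewrite (eq_bigr (fun x => F (x.1, x.2))) => [|[a b] _ //].
rewrite -(pair_bigA _ (fun a b => F (a, b))) /= (bigD1 None) //=; congr (_ + _).
rewrite (reindex_onto Some (odflt ord0)) /=; last by case.
by apply: eq_bigl => i; rewrite eqxx.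
Qed.

(** Where X = 0 only the indices (oo, j) contribute, and they give the powers of
    D. Where X = 1 the others give the monomials in Y and D, with exponents below q.
    In both cases the coefficients of a polynomial function vanish with it. *)
Lemma basis_row_free (c : theta -> E) : \sum_x c x *: basis_row x = 0 -> forall x, c x = 0.
Proof.
move=> h.
have hg g : \sum_x c x * (X g ^+ xexp x * Y g ^+ yexp x * D g ^+ dexp x) = 0.
  have := congr1 (fun u : 'rV_#|G| => u 0 (gring_index G g)) h; rewrite summxE mxE => hh.
  apply: (mulfI (det_s_neq0 g)); rewrite mulr0; apply: etrans hh; rewrite mulr_sumr; apply: eq_bigr => x _.
  by rewrite mxE basis_row_val; ring.
have cN j : c (None, j) = 0.
  have := @poly_vanish k E iota (p ^ f).-1.+1 (fun i => c (None, inord i)).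
  move=> /(_ (eq_leq qE)) H; rewrite -[j]inord_val; apply: H; last exact: ltn_ord.
  move=> t; have [hX hY hD] := coords_rep_inf t; have := hg (rep_inf (tau t * w)).
  rewrite hX hY hD rmorph0 rmorph1 sum_theta [Z in _ + Z]big1 ?addr0 => [e|i _].
    rewrite -(sum_expo (fun l => c (None, l))); apply: etrans e; apply: eq_bigr => l _.
    by rewrite /xexp /= expr0 expr1n !mul1r.
  rewrite big1 // => l _; have /andP[h0 _] := homogT (Some i, l).
  have x0 : (0 < xexp (Some i, l))%N.
    by have [] := expo_subP p_pr f_gt0 i (expo_r2_neq0 p_pr f_gt0 r_neq0 l).
  by rewrite expr0n gtn_eqF // !mul0r mulr0.
case=> [[i|] j] //; move: j.
have cS t i0 : \sum_(j : expo p f) c (Some i0, j) * iota t ^+ j = 0.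
  have := @poly_vanish k E iota (p ^ f).-1.+1 (fun i => \sum_(j : expo p f) c (Some (inord i), j) * iota t ^+ j).
  move=> /(_ (eq_leq qE)) H; rewrite -[i0]inord_val; apply: H; last exact: ltn_ord.
  move=> a; have [hX hY hD] := coords_rep_fin a t; have := hg (rep_fin (tau a + tau t * w)).
  rewrite hX hY hD rmorph1 sum_theta [Z in Z + _]big1 ?add0r => [e|l _]; last by rewrite cN mul0r.
  rewrite -(sum_expo (fun i => \sum_(j : expo p f) c (Some i, j) * iota t ^+ j)).
  apply: etrans e; apply: eq_bigr => l _; rewrite mulr_suml; apply: eq_bigr => j _.
  by rewrite expr1n mul1r /yexp /dexp /=; ring.
move=> j.
have := @poly_vanish k E iota (p ^ f).-1.+1 (fun j => c (Some i, inord j)).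
move=> /(_ (eq_leq qE)) H; rewrite -[j]inord_val; apply: H; last exact: ltn_ord.
by move=> t; rewrite -(sum_expo (fun j => c (Some i, j))).
Qed.

End Independence.

(** * The induced space and its given basis *)

Section InducedSpace.
Variables (p f : nat) (p_pr : prime p) (f_gt0 : (0 < f)%N).
Variables (A : finComUnitRingType) (k : finFieldType) (red : {rmorphism A -> k}).
Variables (tau : k -> A) (w : A).
Hypothesis dn : dual_numbers red tau w.
Hypothesis card_k : #|k| = (p ^ f)%N.
Variables (E : fieldType) (iota : {rmorphism k -> E}) (s : expo p f).
Hypothesis p_E : p \in [pchar E].
Variable r : expo p f.
Hypothesis r_neq0 : r != ord0.

Local Notation gT := {'GL_2[A]}.
Local Notation G := 'GL_2[A]%G.
Local Notation xexp := (xexp r).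
Local Notation yexp := (yexp r).

Local Notation basis_row := (basis_row red tau w iota s r).
Local Notation X h := (iota (Xcoord red h)).
Local Notation Y h := (iota (Ycoord red h)).
Local Notation D h := (iota (Dcoord red tau w h)).

Local Notation expr_homog := (expr_homog p_pr f_gt0 card_k iota r_neq0).
Local Notation mono_X := (mono_X p_pr f_gt0 card_k iota r_neq0).
Local Notation mono_Y := (mono_Y p_pr f_gt0 card_k iota r_neq0).
Let homogT := homog_theta p_pr f_gt0 r_neq0.
Local Notation basis_row_val := (basis_row_val red tau w iota s r).
Local Notation chi := (chi iota red s r).
Let qE : (p ^ f).-1.+1 = #|k|.
Proof. by rewrite card_k prednK // expn_gt0 prime_gt0. Qed.
Local Notation simp := (mulr0, mul0r, mulr1, mul1r, addr0, add0r, mulrN1, mulN1r, opprK).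

Lemma borelE (b : gT) : (b \in borel A) = (GLval b 1 0 == 0).
Proof. by rewrite inE. Qed.

Lemma borel_sub : borel A \subset G.
Proof. by apply/subsetP => b _; rewrite GL_in. Qed.

Lemma basis_row_I2 x : (basis_row x <= I2 iota red s r)%MS.
Proof.
apply/inducedP; first exact: borel_sub.
move=> b g; rewrite borelE => /eqP b10 _; rewrite det_sM /Defs.chi /chi_r.
have [hX hY hD] : [/\ Xcoord red (b * g)%g = red (GLval b 1 1) * Xcoord red g,
   Ycoord red (b * g)%g = red (GLval b 1 1) * Ycoord red g
   & Dcoord red tau w (b * g)%g = red (GLval b 1 1) ^+ 2 * Dcoord red tau w g].
  rewrite /Xcoord /Ycoord /Dcoord !GLmulE b10 !simp !rmorphM !(epsM dn); split=> //; by ring.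
rewrite hX hY hD !rmorphM !exprMn -(expr_homog _ (homogT x)).
rewrite (exprD _ (xexp x + yexp x)) (exprD _ (xexp x)) (exprM _ 2) expr2 exprMn.
by ring.
Qed.

Lemma I2_transform (u : 'rV[E]_#|G|) (b g : gT) : (u <= I2 iota red s r)%MS ->
  GLval b 1 0 = 0 -> u 0 (gring_index G (b * g)%g) = chi b * u 0 (gring_index G g).
Proof.
rewrite {1}(row_fun_row u) => /(inducedP _ _ borel_sub) h b10.
by apply: h; rewrite ?GL_in // borelE b10.
Qed.

Lemma mul_rep_fin_inv (g : gT) : Xcoord red g != 0 ->
  let l := tau (Ycoord red g / Xcoord red g) + tau (Dcoord red tau w g / Xcoord red g ^+ 2) * w in
  GLval (g * rep_fin_inv l)%g 1 0 = 0 /\ GLval (g * rep_fin_inv l)%g 1 1 = GLval g 1 0.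
Proof.
move=> X0 l; have [a1 a2 a3 a4] := rep_fin_invE l; rewrite !GLmulE a1 a2 a3 a4 !simp; split=> //.
apply/eqP; rewrite subr_eq0; apply/eqP.
rewrite [LHS](dual_coordE dn) [RHS](dual_coordE dn); congr (tau _ + tau _ * w).
  rewrite rmorphM rmorphD rmorphM (red_w dn) mulr0 addr0 (dual_K dn) -/(Xcoord red g) -/(Ycoord red g).
  by rewrite mulrC divfK.
rewrite (epsM dn) (epsE dn) rmorphD rmorphM (red_w dn) mulr0 addr0 (dual_K dn).
move: X0; rewrite /Xcoord /Ycoord /Dcoord; move: (red _) => x x0; field.
exact: x0.
Qed.

Lemma mul_rep_inf_inv (g : gT) : Xcoord red g = 0 ->
  let l := tau (Dcoord red tau w g / Ycoord red g ^+ 2) * w in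
  GLval (g * rep_inf_inv l)%g 1 0 = 0 /\ GLval (g * rep_inf_inv l)%g 1 1 = GLval g 1 1.
Proof.
move=> X0 l; have [a1 a2 a3 a4] := rep_inf_invE l; rewrite !GLmulE a1 a2 a3 a4 !simp; split=> //.
have Y0 : Ycoord red g != 0 by case: (coords_neq0 dn g) => //; rewrite X0 eqxx.
have l0 : red l = 0 by rewrite rmorphM (red_w dn) mulr0.
rewrite [LHS](dual_coordE dn) -[RHS](addr0 0) -{2}(mul0r w) -{1 2}(tau0 dn); congr (tau _ + tau _ * w).
  by rewrite rmorphD rmorphM l0 mulr0 addr0 -/(Xcoord red g) X0.
rewrite (epsD dn) (epsM dn) l0 mulr0 addr0 (eps_tauw dn).
move: X0 Y0; rewrite /Xcoord /Ycoord /Dcoord => ->; move: (red _) => y y0; field.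
exact: y0.
Qed.

Lemma det_rep_fin_inv (l : A) : det_s iota red s (rep_fin_inv l) = 1.
Proof.
have [a1 a2 a3 a4] := rep_fin_invE l; rewrite /det_s det2E a1 a2 a3 a4.
by rewrite !simp ?sub0r ?opprK !rmorph1 expr1n.
Qed.

Lemma det_rep_inf_inv (l : A) : det_s iota red s (rep_inf_inv l) = 1.
Proof.
have [a1 a2 a3 a4] := rep_inf_invE l; rewrite /det_s det2E a1 a2 a3 a4.
by rewrite !simp subr0 !rmorph1 expr1n.
Qed.

(** The values of u where X = 0 are matched by the monomials without X. *)
Lemma I2_span_zero (u : 'rV[E]_#|G|) : (u <= I2 iota red s r)%MS ->
  exists c : expo p f -> E, forall g, Xcoord red g = 0 ->
    (u - \sum_j c j *: basis_row (None, j)) 0 (gring_index G g) = 0.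
Proof.
move=> uI; pose psi t := u 0 (gring_index G (rep_inf (tau t * w))).
have [b bE] := poly_interpolate iota psi; exists (fun j => b j) => g X0.
have Y0 : Ycoord red g != 0 by case: (coords_neq0 dn g) => //; rewrite X0 eqxx.
have [b10 b11] := mul_rep_inf_inv X0; set l := tau _ * w in b10 b11.
have gE : g = ((g * rep_inf_inv l) * rep_inf l)%g by rewrite -mulgA rep_infK mulg1.
have ug : u 0 (gring_index G g) = det_s iota red s g * (Y g ^+ r * psi (Dcoord red tau w g / Ycoord red g ^+ 2)).
  rewrite {1}gE I2_transform // /Defs.chi /chi_r b11 det_sM det_rep_inf_inv mulr1.
  by rewrite -mulrA.
rewrite !mxE ug bE summxE -qE !mulr_sumr -sumrB big1 // => j _.
rewrite mxE basis_row_val X0 rmorph0 {1}/xexp /= expr0 mul1r.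
have h := homogT (None, j); have := mono_Y (Dcoord red tau w g) h Y0; rewrite /dexp /= => ->.
by ring.
Qed.

(** A function that vanishes where X = 0 is determined by its values on the
    representatives (1, l), and polynomials in the two coordinates of l take
    arbitrary values there. *)
Lemma I2_span_nonzero (u : 'rV[E]_#|G|) : (u <= I2 iota red s r)%MS ->
  (forall g, Xcoord red g = 0 -> u 0 (gring_index G g) = 0) ->
  exists c : expo p f -> expo p f -> E, u = \sum_i \sum_j c i j *: basis_row (Some i, j).
Proof.
move=> uI u0; pose psi a t := u 0 (gring_index G (rep_fin (tau a + tau t * w))).
have [b bE] := poly_interpolate2 iota psi; exists (fun i j => b i j).
apply/rowP => ig; rewrite -(gring_valK ig); set g := enum_val ig.
have x0 i j : (0 < xexp (Some i, j))%N.
  by have [] := expo_subP p_pr f_gt0 i (expo_r2_neq0 p_pr f_gt0 r_neq0 j).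
rewrite summxE.
have [X0|X0] := eqVneq (Xcoord red g) 0.
  rewrite u0 // big1 // => i _; rewrite summxE big1 // => j _.
  by rewrite mxE basis_row_val X0 rmorph0 expr0n gtn_eqF // !mul0r !mulr0.
have [b10 b11] := mul_rep_fin_inv X0; set l := tau _ + tau _ * w in b10 b11.
have gE : g = ((g * rep_fin_inv l) * rep_fin l)%g by rewrite -mulgA rep_finK mulg1.
have -> : u 0 (gring_index G g) = det_s iota red s g * (X g ^+ r * psi (Ycoord red g / Xcoord red g) (Dcoord red tau w g / Xcoord red g ^+ 2)).
  rewrite {1}gE I2_transform // /Defs.chi /chi_r b11 det_sM det_rep_fin_inv mulr1.
  by rewrite -mulrA.
rewrite bE -qE !mulr_sumr; apply: eq_bigr => i _; rewrite summxE !mulr_sumr; apply: eq_bigr => j _.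
rewrite mxE basis_row_val; have h := homogT (Some i, j).
by rewrite (mono_X _ _ h X0); rewrite /yexp /dexp /=; ring.
Qed.

Lemma I2_span : (I2 iota red s r :=: span_of basis_row predT)%MS.
Proof.
apply/eqmxP/andP; split; last by apply/span_of_subP => x _; apply: basis_row_I2.
apply/rV_subP => u uI; have [c cE] := I2_span_zero uI.
have sN : ((\sum_j c j *: basis_row (None, j))%R <= span_of basis_row predT)%MS.
  by apply: summx_sub => j _; rewrite scalemx_sub ?mem_span_of.
have u'I : ((u - \sum_j c j *: basis_row (None, j))%R <= I2 iota red s r)%MS.
  by rewrite addmx_sub // eqmx_opp summx_sub // => j _; rewrite scalemx_sub ?basis_row_I2.
have [d dE] := I2_span_nonzero u'I cE.
rewrite -[u](subrK (\sum_j c j *: basis_row (None, j))) addmx_sub // dE.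
by apply: summx_sub => i _; apply: summx_sub => j _; rewrite scalemx_sub ?mem_span_of.
Qed.

Local Notation f_fin := (f_fin iota red tau w r).

(** If X(h) is not 0, the only nonzero term of the sum is the one for
    l = - h_11 / h_10, and if X(h) = 0 there is none. *)
Lemma f_finE (j0 j1 : expo p f) h : f_fin j0 j1 h =
  (-1) ^+ (j0 + j1) * (X h ^+ xexp (Some j0, j1) * Y h ^+ j0 * D h ^+ j1).
Proof.
have x0 : (0 < xexp (Some j0, j1))%N.
  by have [] := expo_subP p_pr f_gt0 j0 (expo_r2_neq0 p_pr f_gt0 r_neq0 j1).
have bE l : ((h * lam_GL l)%g \in borel A) = (GLval h 1 0 * l + GLval h 1 1 == 0).
  by rewrite borelE GLmulE /lam_GL /= !mxE /= mulr1.
have b11 l : GLval (h * lam_GL l)%g 1 1 = GLval h 1 0.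
  by rewrite GLmulE /lam_GL /= !mxE /= !simp.
rewrite /Defs.f_fin /otimes.
have [X0|X0] := eqVneq (Xcoord red h) 0.
  have Y0 : Ycoord red h != 0 by case: (coords_neq0 dn h) => //; rewrite X0 eqxx.
  rewrite X0 rmorph0 expr0n gtn_eqF // !mul0r mulr0 big1 // => l _; rewrite bE ifF //.
  apply: contraNF Y0 => /eqP/(congr1 red); rewrite rmorphD rmorphM rmorph0 -/(Xcoord red h) X0 mul0r add0r.
  by rewrite /Ycoord => ->.
have u : GLval h 1 0 \is a GRing.unit by rewrite (dual_unitE dn).
(* The value of l for which the bottom left entry of h * lam_GL l vanishes. *)
pose l0 := - (GLval h 1 1 / GLval h 1 0).
have l0E : GLval h 1 0 * l0 + GLval h 1 1 = 0 by rewrite /l0 mulrN mulrC divrK // addNr.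
rewrite (bigD1 l0) //= bE l0E eqxx big1 ?addr0; last first.
  move=> l ll0; rewrite bE ifF //; apply: contraNF ll0 => /eqP e.
  by apply/eqP/(mulrI u)/(addIr (GLval h 1 1)); rewrite e l0E.
have r0 : red l0 = - (Ycoord red h / Xcoord red h).
  have := congr1 red l0E; rewrite rmorphD rmorphM rmorph0 -/(Xcoord red h) -/(Ycoord red h) => /eqP.
  by rewrite addr_eq0 => /eqP e; apply: (mulfI X0); rewrite e mulrN mulrC divfK.
have e0 : eps tau w l0 = - (Dcoord red tau w h / Xcoord red h ^+ 2).
  have := congr1 (eps tau w) l0E; rewrite (epsD dn) (epsM dn) (eps0 dn) r0.
  rewrite /Dcoord -/(Xcoord red h) -/(Ycoord red h).
  move: (eps tau w l0) (eps tau w (GLval h 1 0)) (eps tau w (GLval h 1 1)) => a x1 y1 e.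
  apply: (mulfI X0); move/eqP: e; rewrite -addrA addr_eq0 => /eqP ->; field.
  exact: X0.
rewrite (teich_coord_red dn) /= r0 e0 /chi_r b11 -/(Xcoord red h).
have hm := homogT (Some j0, j1); have := mono_X (Ycoord red h) (Dcoord red tau w h) hm X0.
rewrite /yexp /dexp /= => ->; rewrite !rmorphN !(exprNn (iota _)) exprD; ring.
Qed.

(** The given basis is the monomial basis up to signs. For (oo, j) the Weyl
    element exchanges X and Y and changes the sign of D. *)
Lemma f_chiE x : f_chi iota red tau w s r x =
  (-1) ^+ (if x.1 is Some j0 then j0 + x.2 else 0)%N *: basis_row x.
Proof.
apply/rowP => i; rewrite !mxE; set h := enum_val i; rewrite /f_theta.
case: x => [[j0|] j1] /=; first by rewrite f_finE /yexp /dexp /=; ring.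
rewrite f_finE -/(weyl A); have [-> -> ->] := coords_weyl red tau w h.
have -> : xexp (Some ord0, j1) = yexp (None, j1).
  have r20 := expo_r2_neq0 p_pr f_gt0 r_neq0 j1.
  rewrite /xexp /yexp /=; congr (nat_of_ord _).
  by apply: (expo_sub_eq p_pr f_gt0 r20); first by rewrite lt0n.
have sq : (-1) ^+ j1 * (-1) ^+ j1 = 1 :> E by rewrite -exprD addnn -signr_odd odd_double.
rewrite /xexp /dexp /= rmorphN (exprNn (iota _)) !expr0 add0n !mul1r mulr1.
have -> (a b c : E) : a * ((-1) ^+ j1 * (b * ((-1) ^+ j1 * c))) = ((-1) ^+ j1 * (-1) ^+ j1) * (a * (b * c)) by ring.
by rewrite sq mul1r.
Qed.

End InducedSpace.

(** * Normal p-subgroups and maximal submodules *)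

Section MaximalSubmodules.
Variables (E : fieldType) (gT : finGroupType) (G : {group gT}) (n : nat).
Variable (rG : mx_representation E G n).

(** The quotient V / M is simple, and a normal p-subgroup acts trivially on a
    simple module in characteristic p. *)
Lemma pcore_max_submod p (V M : 'M[E]_n) g (u : 'rV[E]_n) : p \in [pchar E] ->
  mxmodule rG V -> mxmodule rG M -> max_submod rG M V -> (g \in 'O_p(G))%g ->
  (u <= V)%MS -> (u *m rG g - u <= M)%MS.
Proof.
move=> pE modV modM maxM gO uV; have sMV := ltmxW (proj1 maxM).
have gG : g \in G by apply: subsetP gO; apply: pcore_sub.
have /(max_submodP modM modV sMV) irrMV := maxM.
have /subsetP/(_ g gO)/rkerP[_ g1] := pcore_sub_rker_mx_irr_pchar pE irrMV.
have uS : (in_factmod M u <= <<in_factmod M V>>)%MS by rewrite genmxE submxMr.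
have := in_submodJ (section_module modM modV) g uS.
rewrite -[submod_mx _ _]/(section_repr modM modV g) g1 mulmx1 => e.
rewrite -in_factmod_eq0 linearB /= subr_eq0 (in_factmodJ modM _ gG); apply/eqP.
rewrite -[RHS](in_submodK uS) -e in_submodK //.
exact: mxmodule_trans (section_module modM modV) gG uS.
Qed.
End MaximalSubmodules.

(** * The congruence kernel *)

Section CongruenceKernel.
Variables (p : nat) (A : finComUnitRingType) (k : finFieldType) (red : {rmorphism A -> k}).
Variables (tau : k -> A) (w : A).
Hypothesis dn : dual_numbers red tau w.
Hypothesis p_A : p \in [pchar A].
Local Notation gT := {'GL_2[A]}.
Local Notation G := 'GL_2[A]%G.

Definition cong_ker : {set gT} := [set g : gT | map_mx red (GLval g) == 1%:M].

Lemma cong_kerP g : reflect (map_mx red (GLval g) = 1%:M) (g \in cong_ker).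
Proof. by rewrite inE; apply: eqP. Qed.

Lemma redGM (g h : gT) : map_mx red (GLval (g * h)%g) = map_mx red (GLval g) *m map_mx red (GLval h).
Proof. by rewrite -map_mxM; congr map_mx; rewrite FinRing.val_unitM. Qed.

Lemma redG1 : map_mx red (GLval (1%g : gT)) = 1%:M.
Proof. by rewrite FinRing.val_unit1 map_mx1. Qed.

Lemma cong_ker_group : group_set cong_ker.
Proof.
apply/group_setP; split=> [|g h /cong_kerP gK /cong_kerP hK]; apply/cong_kerP; first exact: redG1.
by rewrite redGM gK hK mulmx1.
Qed.

Canonical cong_ker_groupType := Group cong_ker_group.

Lemma cong_ker_normal : (cong_ker <| G)%g.
Proof.
apply/normalP; split=> [|x _]; first by apply/subsetP => g _; apply: GL_in.
apply/setP => g; rewrite mem_conjg; apply/cong_kerP/cong_kerP => h.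
  have [g' {}h ->] : exists2 g' : gT, map_mx red (GLval g') = 1%:M & g = (g' ^ x)%g.
    by exists (g ^ x^-1)%g; rewrite ?conjgKV.
  by rewrite conjgE !redGM h mul1mx -redGM mulVg redG1.
by rewrite conjgE invgK !redGM h mul1mx -redGM mulgV redG1.
Qed.

(** Write g = 1 + N, where N has entries in (w); then N^2 = 0 and
    g^p = 1 + p N = 1. *)
Lemma cong_ker_expp (g : gT) : g \in cong_ker -> (g ^+ p = 1)%g.
Proof.
move=> /cong_kerP gK; pose N := GLval g - 1.
have Nw i j : exists c, N i j = tau c * w.
  have := dual_coordE dn (N i j).
  have -> : red (N i j) = 0.
    by have /matrixP/(_ i j) := gK; rewrite /N !mxE rmorphB rmorph_nat => ->; rewrite subrr.
  by rewrite (tau0 dn) add0r; exists (eps tau w (N i j)).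
have NN : N * N = 0.
  apply/matrixP => i j; rewrite !mxE big1 // => l _.
  have [a ->] := Nw i l; have [b ->] := Nw l j.
  by rewrite mulrACA (dual_ww dn) mulr0.
have gn m : GLval g ^+ m = 1 + N *+ m.
  elim: m => [|m IH]; first by rewrite expr0 mulr0n addr0.
  rewrite exprS IH -{1}(subrK 1 (GLval g)) -/N mulrDl mulrDr mulr1 mul1r.
  by rewrite mulrnAr NN mul0rn addr0 mulrS addrCA.
apply: val_inj; rewrite FinRing.val_unitX FinRing.val_unit1 /= gn.
suff -> : N *+ p = 0 by rewrite addr0.
by apply/matrixP => i j; rewrite mulmxnE [RHS]mxE (mulrn_pchar p_A).
Qed.

Lemma cong_ker_pcore : (cong_ker \subset 'O_p(G))%g.
Proof.
have p_pr : prime p by case/andP: p_A.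
apply: pcore_max; last exact: cong_ker_normal.
apply/pgroupP => l l_pr /(Cauchy l_pr)[g gK og].
have : (#[g]%g %| p)%N by rewrite order_dvdn cong_ker_expp.
by rewrite og dvdn_prime2 // inE.
Qed.

Lemma unip_cong_ker c : unip (tau c * w) \in cong_ker.
Proof.
apply/cong_kerP; have [a1 a2 a3 a4] := unipE (tau c * w).
apply/matrixP => i j; rewrite !mxE.
have I2 (i0 : 'I_2) : i0 = 0 \/ i0 = 1.
  by case: i0 => [[|[|//]] ?]; [left | right]; apply: val_inj.
by case: (I2 i) => ->; case: (I2 j) => ->; rewrite ?a1 ?a2 ?a3 ?a4 ?rmorph1 ?rmorph0 // rmorphM (red_w dn) mulr0.
Qed.

Lemma diagl_cong_ker c : diagl (1 - tau c * w) \in cong_ker.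
Proof.
apply/cong_kerP; have [a1 a2 a3 a4] := diaglE (unit_xy dn c).
apply/matrixP => i j; rewrite !mxE.
have I2 (i0 : 'I_2) : i0 = 0 \/ i0 = 1.
  by case: i0 => [[|[|//]] ?]; [left | right]; apply: val_inj.
by case: (I2 i) => ->; case: (I2 j) => ->; rewrite ?a1 ?a2 ?a3 ?a4 ?rmorph1 ?rmorph0 // rmorphB rmorphM (red_w dn) mulr0 rmorph1 subr0.
Qed.

End CongruenceKernel.

(** * Irreducibility of the subquotients *)

Section Irreducibility.
Variables (p f : nat) (p_pr : prime p) (f_gt0 : (0 < f)%N).
Variables (A : finComUnitRingType) (k : finFieldType) (red : {rmorphism A -> k}).
Variables (tau : k -> A) (w : A).
Hypothesis dn : dual_numbers red tau w.
Hypothesis card_k : #|k| = (p ^ f)%N.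
Variables (E : fieldType) (iota : {rmorphism k -> E}) (s : expo p f).
Hypothesis p_E : p \in [pchar E].
Variable r : expo p f.
Hypothesis r_neq0 : r != ord0.

Local Notation G := 'GL_2[A]%G.
Local Notation rG := (regular_repr E G).
Local Notation theta := (theta p f).
Local Notation le := (theta_le r).
Local Notation xexp := (xexp r).
Local Notation yexp := (yexp r).
Local Notation homog := (@homog p f r).
Local Notation ylt := (yexp_lt p_pr f_gt0 r).
Local Notation exp_gt0 := (exp_gt0 p_pr f_gt0 r_neq0).
Local Notation homog_mono := (homog_mono p_pr f_gt0 r_neq0).

Local Notation basis_row := (basis_row red tau w iota s r).

Local Notation op_unip := (coef_op iota rG (fun c => unip (tau c))).
Local Notation cl := (theta_ktype r).
Local Notation V := (below basis_row cl (@ktype_le p f r)).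
Local Notation Vs := (strictly_below basis_row cl (@ktype_le p f r)).
Local Notation klt := (klt (@ktype_le p f r)).

Lemma cl_eqE x y : (cl x == cl y) = (theta_class r x == theta_class r y).
Proof. by []. Qed.

Lemma cl_eq x y : (cl x == cl y) = le x y && le y x.
Proof. by rewrite cl_eqE (theta_class_eq p_pr f_gt0 r_neq0). Qed.

Lemma cl_onto t : exists x, cl x = t.
Proof.
by case: t => [pr prP]; have /imsetP[x _ e] := prP; exists x; apply: val_inj.
Qed.

Lemma ktype_leE x y : ktype_le (cl x) (cl y) = le x y.
Proof.
apply/existsP/idP => [[x' /existsP[y' /and3P[xx yy xy']]]|xy].
  move: xx yy; rewrite !cl_eq => /andP[_ xx'] /andP[y'y _].
  by apply: theta_le_trans xx' _; apply: theta_le_trans xy' _.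
by exists x; apply/existsP; exists y; rewrite !eqxx.
Qed.

Local Notation le_refl := (@theta_le_refl p f r).
Local Notation le_tr := (@theta_le_trans p f r).
Local Notation VsE := (strictly_belowE basis_row cl_onto ktype_leE le_refl le_tr cl_eq).

Lemma V_module t : mxmodule rG (V t).
Proof.
have [z <-] := cl_onto t.
apply: (ideal_module p_pr f_gt0 dn card_k iota s p_E r_neq0 (P := fun x => ktype_le (cl x) (cl z))) => x y xy.
by rewrite !ktype_leE; apply: le_tr.
Qed.

Lemma Vs_module t : mxmodule rG (Vs t).
Proof. by apply: sumsmx_module => u _; apply: V_module. Qed.

Lemma klt_E x y : klt (cl x) (cl y) = le x y && ~~ le y x.
Proof. by rewrite /klt cl_eq ktype_leE; case: (le x y); rewrite //= andbT. Qed.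

Lemma mem_V x y : le x y -> (basis_row x <= V (cl y))%MS.
Proof. by move=> xy; apply: mem_span_of; rewrite ktype_leE. Qed.

Lemma mem_Vs x y : le x y -> ~~ le y x -> (basis_row x <= Vs (cl y))%MS.
Proof. by move=> xy yx; rewrite VsE; apply: mem_span_of; rewrite klt_E xy. Qed.

Lemma V_generated x (W : 'M[E]_#|G|) : mxmodule rG W -> (basis_row x <= W)%MS -> (V (cl x) <= W)%MS.
Proof.
move=> modW xW; apply/span_of_subP => y; rewrite ktype_leE => yx.
exact: (module_le p_pr f_gt0 dn card_k p_E r_neq0 modW yx xW).
Qed.

Lemma class_inj_y x y : theta_class r x = theta_class r y -> yexp x = yexp y -> x = y.
Proof.
move=> xy e; have [ej _] := class_twdeg p_pr f_gt0 r_neq0 xy.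
apply: (theta_exp_inj p_pr f_gt0 r_neq0); [ | exact: e | exact: ej].
by have := class_sum p_pr f_gt0 r_neq0 xy; rewrite e => /addIn.
Qed.

(** Take u in W outside Vs, and consider the members of the type that occur in
    u. Applied to the one with the largest exponent of Y, a suitable coefficient
    operator yields the lowest member H of the type. It sends the other members
    into Vs, since inside the type nothing lies lower than H. As H generates V, the
    claim follows. *)
Lemma V_irr t (W : 'M[E]_#|G|) : mxmodule rG W -> (W <= V t)%MS -> ~~ (W <= Vs t)%MS ->
  (V t <= W + Vs t)%MS.
Proof.
have [x <-] := cl_onto t; move=> modW WV /row_subPn[i nW].
set u := row i W in nW; have uW : (u <= W)%MS by apply: row_sub.
have /span_ofP[c uE] := submx_trans uW WV.
have [H Hx Hmin] := class_lowest p_pr f_gt0 r_neq0 x.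
have clH : cl H = cl x by apply/eqP; rewrite cl_eqE Hx.
have [y0 /andP[y0x cy0]] : exists y, (cl y == cl x) && (c y != 0).
  apply/existsP; apply: contraR nW; rewrite negb_exists => /forallP h.
  rewrite uE; apply: summx_sub => y yx; have [yltx|] := boolP (le x y).
    have := h y; rewrite cl_eq yltx andbT -ktype_leE yx /= negbK => /eqP->.
    by rewrite scale0r sub0mx.
  move=> nxy; apply: scalemx_sub; apply: mem_Vs nxy.
  by rewrite -ktype_leE.
(* y0 is the member of the type with the largest exponent of Y in u. *)
have {y0 y0x cy0} [y0 /andP[y0x cy0] ymax] : exists2 y, (cl y == cl x) && (c y != 0) &
    forall z, (cl z == cl x) && (c z != 0) -> (yexp z <= yexp y)%N.
  case: (arg_maxnP (P := fun y => (cl y == cl x) && (c y != 0)) (fun y => yexp y) (i0 := y0)) => [|y h1 h2].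
    by rewrite y0x.
  by exists y.
have modS : mxmodule rG (W + Vs (cl x))%MS by apply: addsmx_module modW (Vs_module _).
suff HW : (basis_row H <= W + Vs (cl x))%MS.
  by rewrite -{1}clH; apply: (V_generated modS HW).
have y0H : theta_class r y0 = theta_class r H by apply/eqP; rewrite Hx -cl_eqE.
have Hy0 := Hmin y0 (etrans y0H Hx).
have leHy := dle_leq p_pr (ylt H) (ylt y0) Hy0.
have y0x' : le y0 x by move: y0x; rewrite cl_eq => /andP[].
have Py0 : ktype_le (cl y0) (cl x) by rewrite ktype_leE.
pose yW := (W + Vs (cl x))%MS.

(* z y is the image of basis_row y under the operator that is applied to u. *)
have key (z : theta -> 'rV[E]_#|G|) (a : E) : a != 0 -> z y0 = a *: basis_row H ->
    ((\sum_(y | ktype_le (cl y) (cl x)) c y *: z y)%R <= W)%MS ->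
    (forall y, ktype_le (cl y) (cl x) -> y != y0 -> c y != 0 -> (z y <= Vs (cl x))%MS) ->
    (basis_row H <= yW)%MS.
  move=> a0 zy0 zW zS; rewrite -(eqmx_scale _ (mulf_neq0 cy0 a0)) -scalerA -zy0.
  have -> : c y0 *: z y0 = (\sum_(y | ktype_le (cl y) (cl x)) c y *: z y) -
      (\sum_(y | ktype_le (cl y) (cl x) && (y != y0)) c y *: z y).
    by rewrite (bigD1 y0 Py0) /= addrK.
  apply: addmx_sub; first exact: submx_trans zW (addsmxSl _ _).
  rewrite eqmx_opp; apply: submx_trans (addsmxSr _ _); apply: summx_sub => y /andP[yx yy0].
  have [->|cy] := eqVneq (c y) 0; first by rewrite scale0r sub0mx.
  by apply: scalemx_sub; apply: zS.

have small y : ktype_le (cl y) (cl x) -> cl y != cl x -> (basis_row y <= Vs (cl x))%MS.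
  move=> yx ycl; apply: mem_Vs; first by rewrite -ktype_leE.
  by apply: contra ycl => xy; rewrite cl_eq -ktype_leE yx.
have same y : cl y == cl x -> theta_class r y = theta_class r x by rewrite cl_eqE => /eqP.
have [e0|lt0] : yexp y0 = yexp H \/ (yexp H < yexp y0)%N.
  by move: leHy; rewrite leq_eqVlt => /orP[/eqP->|]; [left | right].
  (* If y0 already has the exponent of H, it is the only member occurring in u. *)
  have eH := class_inj_y y0H e0.
  apply: (key basis_row 1); [exact: oner_neq0 | by rewrite scale1r eH | by rewrite -uE | move=> y yx yy0 cy].
  apply: (small y yx); apply: contra yy0 => yc; apply/eqP/class_inj_y.
    by rewrite (same _ yc) y0H.
  apply/eqP; rewrite eqn_leq; apply/andP; split; first by apply: ymax; rewrite yc.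
  by rewrite e0; apply: (dle_leq p_pr (ylt H) (ylt y)); apply: Hmin; apply: same.
(* The order that carries y0 to H exactly. *)
set b := (yexp y0 - yexp H)%N.
have bq : (0 < b < p ^ f)%N by rewrite subn_gt0 lt0 (leq_ltn_trans (leq_subr _ _) (ylt y0)).
have bd : dle p f b (yexp y0) by apply: (dleB p_pr (ylt H) (ylt y0) Hy0).
have by0 : (b <= yexp y0)%N by apply: leq_subr.
have /andP[_ bq'] := bq.
apply: (key (fun y => basis_row y *m op_unip b) (- 'C(yexp y0, b)%:R)).
- by rewrite oppr_eq0; apply: (dle_bin_neq0 p_pr p_E bq' (ylt y0) bd).
- rewrite (coef_unip p_pr f_gt0 dn card_k iota s r y0 bq) by0 -scaleNr; congr (_ *: _).
  have [ej _] := class_twdeg p_pr f_gt0 r_neq0 y0H.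
  have es := class_sum p_pr f_gt0 r_neq0 y0H.
  have e1 : (xexp y0 + b)%N = xexp H by rewrite /b (addnBA _ leHy) es addnK.
  have e2 : (yexp y0 - b)%N = yexp H by apply: subKn leHy.
  by rewrite e1 e2 ej.
- have -> : \sum_(y | ktype_le (cl y) (cl x)) c y *: (basis_row y *m op_unip b) = u *m op_unip b.
    by rewrite uE mulmx_suml; apply: eq_bigr => y _; rewrite scalemxAl.
  by apply: coef_op_module; [move=> l; apply: GL_in | exact: modW | exact: uW].
move=> y yx yy0 cy; have modS' := Vs_module (cl x).
have [yc|ync] := boolP (cl y == cl x); last first.
  by apply: coef_op_module; [move=> l; apply: GL_in | exact: modS' | exact: small].
rewrite (coef_unip p_pr f_gt0 dn card_k iota s r y bq) eqmx_opp.
case: leqP => byy; last by rewrite sub0mx.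
have lty : (yexp y < yexp y0)%N.
  have ley : (yexp y <= yexp y0)%N by apply: ymax; rewrite yc cy.
  rewrite ltn_neqAle ley andbT; apply: contra yy0 => /eqP e.
  by apply/eqP; apply: class_inj_y e; rewrite (same _ yc) y0H.
case C0: ('C(yexp y, b)%:R == 0 :> E); first by rewrite (eqP C0) scale0r sub0mx.
have yb : dle p f b (yexp y).
  by move: C0; rewrite (Lucas p_pr p_E bq' (ylt y)) => /negbFE.
have exy : (xexp y + b + (yexp y - b) = xexp y + yexp y)%N by rewrite -addnA (subnKC byy).
have h : homog (xexp y + b) (yexp y - b) (dexp y).
  by apply: (homog_mono (y := y)); rewrite exy ?exp_gt0.
apply: scalemx_sub; rewrite (mono_rowE p_pr f_gt0 red tau w card_k iota s r_neq0 h).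
have zy := le_shift_y p_pr f_gt0 r_neq0 bq' yb.
have yx' : le y x by rewrite -ktype_leE.
apply: small; first by rewrite ktype_leE; apply: le_tr zy yx'.
apply/negP => zc; have := Hmin _ (same _ zc).
move/(dle_leq p_pr (ylt H) (ylt _)).
have [_ -> _] := mono_thetaK p_pr f_gt0 r_neq0 h.
move/leq_trans/(_ (to_expo_le p_pr f_gt0 _)); rewrite /b leqNgt => /negP; apply.
by rewrite (ltn_subLR _ byy) (subnK leHy).
Qed.

End Irreducibility.

(** * Uniqueness of the maximal submodule *)

Section Cosocle.
Variables (p f : nat) (p_pr : prime p) (f_gt0 : (0 < f)%N).
Variables (A : finComUnitRingType) (k : finFieldType) (red : {rmorphism A -> k}).
Variables (tau : k -> A) (w : A).
Hypothesis dn : dual_numbers red tau w.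
Hypothesis card_k : #|k| = (p ^ f)%N.
Variables (E : fieldType) (iota : {rmorphism k -> E}) (s : expo p f).
Hypothesis p_E : p \in [pchar E].
Variable r : expo p f.
Hypothesis r_neq0 : r != ord0.

Local Notation G := 'GL_2[A]%G.
Local Notation rG := (regular_repr E G).
Local Notation theta := (theta p f).
Local Notation to_expo := (to_expo p f).
Local Notation mono_row := (mono_row red tau w iota s).
Local Notation le := (theta_le r).
Local Notation xexp := (xexp r).
Local Notation yexp := (yexp r).
Local Notation xlt := (xexp_lt p_pr f_gt0 r).
Local Notation ylt := (yexp_lt p_pr f_gt0 r).

Local Notation basis_row := (basis_row red tau w iota s r).

Local Notation cl := (theta_ktype r).
Local Notation V := (below basis_row cl (@ktype_le p f r)).
Local Notation Vs := (strictly_below basis_row cl (@ktype_le p f r)).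
Local Notation klt := (klt (@ktype_le p f r)).

Local Notation cl_onto := (@cl_onto p f r).
Local Notation cl_eq := (cl_eq p_pr f_gt0 r_neq0).
Local Notation ktype_leE := (ktype_leE p_pr f_gt0 r_neq0).
Local Notation free := (basis_row_free p_pr f_gt0 dn card_k (iota := iota) (s := s) r_neq0).
Local Notation le_refl := (@theta_le_refl p f r).
Local Notation le_tr := (@theta_le_trans p f r).
Local Notation VsE := (strictly_belowE basis_row cl_onto ktype_leE le_refl le_tr cl_eq).
Local Notation V_module := (V_module p_pr f_gt0 dn card_k iota s p_E r_neq0).
Local Notation Vs_module := (Vs_module p_pr f_gt0 dn card_k iota s p_E r_neq0).
Local Notation module_le := (module_le p_pr f_gt0 dn card_k p_E r_neq0).
Hypothesis p_A : p \in [pchar A].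

Lemma V_max t : max_submod rG (Vs t) (V t).
Proof.
apply: (strictly_below_max free cl_onto ktype_leE le_refl le_tr cl_eq) => u W.
exact: (V_irr p_pr f_gt0 dn card_k p_E r_neq0).
Qed.

Section Max.
Variables (x0 : theta) (M : 'M[E]_#|G|).
Hypotheses (modM : mxmodule rG M) (maxM : max_submod rG M (V (cl x0))).

(** The congruence kernel is a normal p-subgroup, hence acts trivially on V / M. *)
Lemma cong_ker_sub (u : 'rV[E]_#|G|) g : (u <= V (cl x0))%MS -> g \in cong_ker red ->
  (u *m rG g^-1%g - u <= M)%MS.
Proof.
move=> uV gK; apply: (pcore_max_submod p_E (V_module (cl x0)) modM maxM); last exact: uV.
by rewrite groupV; apply: subsetP gK; apply: (cong_ker_pcore dn p_A).
Qed.

Lemma aug_sub z g b : le z x0 -> (forall c, g c \in cong_ker red) -> (0 < b < p ^ f)%N ->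
  (basis_row z *m coef_op iota rG g b <= M)%MS.
Proof.
move=> zx gK bq; rewrite coef_op_augmentation ?card_k //.
apply: summx_sub => c _; apply: scalemx_sub; apply: cong_ker_sub; last exact: gK.
exact: (mem_V p_pr f_gt0).
Qed.

(** The trades of powers of D are made by coefficient operators in the
    augmentation ideal of the congruence kernel, which maps V into M. The other
    steps keep the exponent of D. *)
Lemma dexp_drop z : le z x0 -> dexp z = dexp x0 \/ (basis_row z <= M)%MS.
Proof.
case/connectP => t; elim: t z => [|z' t IH] z /=; first by move=> _ ->; left.
case/andP=> zz' zt e; have z'x : le z' x0 by apply/connectP; exists t.
case: (IH _ zt e) => [dz'|z'M]; last by right; apply: (module_le modM (connect1 zz') z'M).
case/(theta_stepP p_pr f_gt0 r_neq0): zz' => [[m zm ->]|->|[m zm [->|->]]].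
- by left; rewrite /dexp /= to_expoK ?(q_gt1 p_pr f_gt0).
- by left; rewrite /dexp /= to_expoK ?(q_gt1 p_pr f_gt0).
- right; apply: (module_step_xx p_pr f_gt0 dn card_k p_E r_neq0 zm).
  by apply: (aug_sub z'x); [move=> c; apply: (unip_cong_ker dn) | apply: pX_bnd].
- right; apply: (module_step_xy p_pr f_gt0 dn card_k p_E r_neq0 zm).
  by apply: (aug_sub z'x); [move=> c; apply: (diagl_cong_ker dn) | apply: pX_bnd].
Qed.

(** On the monomials whose D-exponent is m - s, the torus acts by characters that
    separate the exponents of X; this operator is, up to sign, the projection onto
    the exponent a. *)
Definition torus_op (a m : nat) : 'M[E]_#|G| :=
  \sum_(d : k | d != 0) (iota d ^+ ((p ^ f).-1 - a) / iota d ^+ m) *: rG (diagl (tau d))^-1%g.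

Lemma torus_op_module a m (u : 'rV[E]_#|G|) : (u <= M)%MS -> (u *m torus_op a m <= M)%MS.
Proof.
move=> uM; rewrite /torus_op mulmx_sumr; apply: summx_sub => d _.
rewrite -scalemxAr; apply: scalemx_sub; apply: (mxmodule_trans modM _ uM).
exact: GL_in.
Qed.

Lemma torus_opE a x : (0 < a < (p ^ f).-1)%N ->
  basis_row x *m torus_op a (s + dexp x) = - ((xexp x == a)%:R *: basis_row x).
Proof.
move=> /andP[a0 aq]; have xq := xlt x.
have q0 : (0 < p ^ f)%N by rewrite expn_gt0 prime_gt0.
rewrite /torus_op mulmx_sumr.
have termE d : d != 0 -> basis_row x *m ((iota d ^+ ((p ^ f).-1 - a) / iota d ^+ (s + dexp x)) *: rG (diagl (tau d))^-1%g) =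
    iota d ^+ ((p ^ f).-1 - a + xexp x) *: basis_row x.
  move=> d0; rewrite -scalemxAr /basis_row (act_torus dn) // scalerA; congr (_ *: _).
  have dn0 m : iota d ^+ m != 0 by rewrite expf_neq0 // fmorph_eq0.
  by rewrite !exprD; field; rewrite !dn0.
rewrite (eq_bigr _ termE) -scaler_suml -scaleNr; congr (_ *: _).
have := power_sum iota (n := (p ^ f).-1 - a + xexp x); rewrite card_k.
rewrite (bigD1 0) //= rmorph0 expr0n.
have -> : ((p ^ f).-1 - a + xexp x == 0)%N = false by lia.
rewrite add0r => ->; last by lia.
by congr (- (_ : bool)%:R); lia.
Qed.

Lemma homog_mod_y x y : xexp x = xexp y -> dexp x = dexp y ->
  yexp x = yexp y %[mod (p ^ f).-1].
Proof.
move=> ex ed; have /andP[_ /eqP hx] := homog_theta p_pr f_gt0 r_neq0 x.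
have /andP[_ /eqP hy] := homog_theta p_pr f_gt0 r_neq0 y.
apply/eqP; rewrite -(eqn_modDl (xexp x)) -(eqn_modDr (2 * dexp x)) hx.
by rewrite ex ed hy.
Qed.

(** Suppose that Vs is not in M. By dexp_drop some basis vector of Vs with the
    same exponent of D as x0 is outside M, so the carry set is not empty and the
    type has a member x with exponents 0 < a < q - 1 and b > 0. By maximality
    M + Vs = V, so M contains x minus a combination of smaller monomials. Modulo M
    these have the D-exponent of x, again by dexp_drop, and the torus projection
    to the exponent a leaves those with the X-exponent of x. A coefficient operator
    shows that the latter are in M. Hence x is in M, although x generates V. *)
Lemma Vs_sub_max :
  ~ ((theta_class r x0).1 = setT /\ expo_r2 r (theta_class r x0).2 = to_expo (p ^ f - 1)) ->
  (Vs (cl x0) <= M)%MS.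
Proof.
move=> notT; have sMV := ltmxW (proj1 maxM).
apply/negPn/negP => nVs.
have [y0 y0x ny0] : exists2 y, klt (cl y) (cl x0) & ~~ (basis_row y <= M)%MS.
  have : ~~ [forall y, klt (cl y) (cl x0) ==> (basis_row y <= M)%MS].
    apply: contra nVs => /forallP h; rewrite VsE; apply/span_of_subP => y yx.
    by have := h y; rewrite yx.
  by rewrite negb_forall => /existsP[y]; rewrite negb_imply => /andP[]; exists y.
(* For an empty carry set all of Vs has a smaller exponent of D than x0. *)
have I0 : (theta_class r x0).1 <> set0.
  move=> I0; move: y0x; rewrite (klt_E p_pr f_gt0 r_neq0) => /andP[yx nxy].
  case: (dexp_drop yx) => [ed|yM]; last by rewrite yM in ny0.
  have e := class_set0_min p_pr f_gt0 r_neq0 I0 yx ed.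
  by move: nxy; rewrite (class_le p_pr f_gt0 r_neq0) ?e.
have [x xE [/andP[ax0 axq] bx0]] := class_generic p_pr f_gt0 r_neq0 I0 notT.
have clx : cl x = cl x0 by apply/eqP; rewrite cl_eqE xE.
have xV : (basis_row x <= V (cl x0))%MS by have lexx := le_refl x; rewrite -clx; exact: (mem_V p_pr f_gt0).
suff xM : (basis_row x <= M)%MS.
  have := V_generated p_pr f_gt0 dn card_k p_E r_neq0 modM xM; rewrite clx => VM.
  by have [/andP[_ /negP nVM] _] := maxM; apply: (nVM VM).
have nMs : ~~ (M <= Vs (cl x0))%MS.
  apply/negP => MVs; have [ltV _] := V_max (cl x0); have [_ /(_ (Vs (cl x0)))] := maxM; apply.
  by split; [exact: Vs_module | rewrite /ltmx MVs nVs | exact: ltV].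
have := submx_trans xV (V_irr p_pr f_gt0 dn card_k p_E r_neq0 modM sMV nMs).
case/sub_addsmxP => [[u1 u2]] /= xe.
have : (u2 *m Vs (cl x0) <= Vs (cl x0))%MS by apply: submxMl.
rewrite VsE => /span_ofP[c cE].
have mM : (u1 *m M <= M)%MS by apply: submxMl.
have {xe cE} mE : u1 *m M = basis_row x - \sum_(y | klt (cl y) (cl x0)) c y *: basis_row y.
  by rewrite -cE xe addrK.
have ed : dexp x = dexp x0 by have [] := class_twdeg p_pr f_gt0 r_neq0 xE.
have lowd y : klt (cl y) (cl x0) -> dexp y != dexp x -> (basis_row y <= M)%MS.
  rewrite (klt_E p_pr f_gt0 r_neq0) ed => /andP[yx _] /eqP nd.
  by case: (dexp_drop yx) => [/nd|h]; [case | exact: h].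
(* The monomials that the torus projection does not separate from x. *)
pose S y := [&& klt (cl y) (cl x0), dexp y == dexp x & xexp y == xexp x].
have abx : (0 < xexp x < (p ^ f).-1)%N by rewrite ax0 axq.
have vM : (basis_row x - (\sum_(y | S y) c y *: basis_row y)%R <= M)%MS.
  have := torus_op_module (xexp x) (s + dexp x) mM; rewrite mE mulmxBl.
  rewrite (torus_opE x abx) eqxx scale1r mulmx_suml.
  rewrite -eqmx_opp opprD opprK opprK => h.
  have -> : basis_row x - \sum_(y | S y) c y *: basis_row y =
     (basis_row x + \sum_(y | klt (cl y) (cl x0)) (c y *: basis_row y) *m torus_op (xexp x) (s + dexp x)) -
     (\sum_(y | klt (cl y) (cl x0)) (c y *: basis_row y) *m torus_op (xexp x) (s + dexp x) + \sum_(y | S y) c y *: basis_row y).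
    by rewrite opprD addrA addrK.
  apply: addmx_sub; first exact: h.
  rewrite eqmx_opp [X in (_ + X)%R](eq_bigl (fun y => klt (cl y) (cl x0) && ((dexp y == dexp x) && (xexp y == xexp x)))); last by move=> y.
  rewrite [X in (_ + X)%R]big_mkcondr -big_split /=; apply: summx_sub => y yx.
  have [ey|ny] := eqVneq (dexp y) (dexp x); last first.
    rewrite addr0; apply: torus_op_module; apply: scalemx_sub; exact: lowd.
  rewrite -scalemxAl -ey (torus_opE y abx).
  case: (xexp y == xexp x); first by rewrite scale1r scalerN addNr sub0mx.
  by rewrite scale0r oppr0 scaler0 addr0 sub0mx.
(* The exponents of Y are congruent modulo q - 1 and differ, hence are 0 and
   q - 1. *)
have Sprop y : S y -> yexp y = 0%N /\ yexp x = (p ^ f).-1.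
  case/and3P => yx /eqP eyd /eqP eyx; have ym := homog_mod_y eyx eyd.
  have q0 : (0 < p ^ f)%N by rewrite expn_gt0 prime_gt0.
  have yq : (yexp y <= (p ^ f).-1)%N by have := ylt y; rewrite -[in (p ^ f)%N](prednK q0).
  have xq : (yexp x <= (p ^ f).-1)%N by have := ylt x; rewrite -[in (p ^ f)%N](prednK q0).
  have [y0'|y0'] := posnP (yexp y).
    split; [exact: y0' | apply: (eq_mod_pos bx0 _ xq (leqnn _))]; first exact: leq_trans xq.
    by rewrite -ym y0' modnn mod0n.
  have exy : yexp y = yexp x by apply: (eq_mod_pos y0' bx0 yq xq ym).
  have exy' : y = x by exact: (theta_exp_inj p_pr f_gt0 r_neq0 eyx exy eyd).
  by move: yx; rewrite exy' clx /klt eqxx.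
have SM y : S y -> (basis_row y <= M)%MS.
  move=> Sy; have [y0' xq] := Sprop y Sy; have /and3P[_ /eqP eyd /eqP eyx] := Sy.
  have Q0 : (0 < (p ^ f).-1)%N by rewrite -xq.
  have q0 : (0 < p ^ f)%N by rewrite expn_gt0 prime_gt0.
  have bq : (0 < (p ^ f).-1 < p ^ f)%N by rewrite Q0 /= prednK.
  (* The operator of order q - 1 kills the members of S, where Y does not
     occur, and sends x to the monomial of exponent a + q - 1 in X and 0 in Y,
     which as a function is the monomial of y. *)
  have h := coef_op_module iota (p ^ f).-1 (fun c => GL_in (unip (tau c))) modM vM.
  move: h; rewrite mulmxBl (coef_unip p_pr f_gt0 dn card_k iota s r x bq) xq leqnn binn scale1r subnn.
  rewrite mulmx_suml big1 ?subr0 => [|z Sz]; last first.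
    have [z0 _] := Sprop z Sz.
    by rewrite -scalemxAl (coef_unip p_pr f_gt0 dn card_k iota s r z bq) z0 leqNgt Q0 oppr0 scaler0.
  rewrite eqmx_opp /basis_row y0' eyd -eyx => h; suff <- : mono_row (xexp y + (p ^ f).-1) 0 (dexp x) = mono_row (xexp y) 0 (dexp x) by [].
  apply/rowP => i; rewrite !mxE; congr (_ * (_ * _ * _)).
  apply: (expr_congr p_pr f_gt0 card_k); rewrite ?modnDr.
  - by rewrite addn_gt0 Q0 orbT.
  - by rewrite eyx.
  - by [].
have sM : ((\sum_(y | S y) c y *: basis_row y)%R <= M)%MS.
  by apply: summx_sub => y Sy; apply: scalemx_sub; apply: SM.
by rewrite -[basis_row x](subrK (\sum_(y | S y) c y *: basis_row y)); apply: addmx_sub.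
Qed.

End Max.
End Cosocle.

(** * The types and the constituents *)

Lemma JH_eqmx (E : fieldType) (gT : finGroupType) (G : {group gT}) n
  (rG : mx_representation E G n) (W W' : 'M[E]_n) (T : finType) (S : {set T}) (d : T -> nat)
  (L : forall t : T, mx_representation E G (d t)) : (W :=: W')%MS ->
  JH_constituents rG W S L -> JH_constituents rG W' S L.
Proof.
move=> WW' [U [compU [lastU h]]]; exists U, compU; split=> //.
exact: eqmx_trans lastU WW'.
Qed.

Lemma span_of_scale (E : fieldType) n (T : finType) (F F' : T -> 'rV[E]_n) (a : T -> E) (P : pred T) :
  (forall x, a x != 0) -> (forall x, F x = a x *: F' x) -> span_of F P = span_of F' P.
Proof.
move=> a0 FF'; apply: eq_bigr => x _; apply/eq_genmx; rewrite FF'; exact: eqmx_scale.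
Qed.

Lemma free_scale (E : fieldType) n (T : finType) (F F' : T -> 'rV[E]_n) (a : T -> E) :
  (forall x, a x != 0) -> (forall x, F x = a x *: F' x) ->
  (forall c : T -> E, \sum_x c x *: F' x = 0 -> forall x, c x = 0) ->
  forall c : T -> E, \sum_x c x *: F x = 0 -> forall x, c x = 0.
Proof.
move=> a0 FF' free c h x; have /free/(_ x)/eqP : \sum_x (c x * a x) *: F' x = 0.
  by rewrite -[RHS]h; apply: eq_bigr => y _; rewrite FF' scalerA.
by rewrite mulf_eq0 (negbTE (a0 x)) orbF => /eqP.
Qed.

Theorem theorem1p4
  (p : nat) (p_prime : prime p) (p_odd : odd p)
  (Qp : fieldType) (abs : Qp -> rat) (QpP : is_padic_field p abs)
  (F : fieldExtType Qp) (v : F -> int) (e : nat)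
  (vP : is_valuation p abs v e) (e_ge2 : (2 <= e)%N)
  (A : finComUnitRingType) (piA : F -> A) (piAP : is_quotient v 2 piA)
  (k : finFieldType) (red : {rmorphism A -> k})
  (redP : is_quotient v 1 (fun x => red (piA x)))
  (f : nat) (card_k : #|k| = (p ^ f)%N)
  (varpi : F) (varpi_neq0 : varpi != 0) (v_varpi : v varpi = 1)
  (teich : k -> F)
  (teichP : is_teichmuller v (fun x => red (piA x)) teich)
  (E : fieldType) (iota : {rmorphism k -> E})
  (s r : expo p f) (s_neq0 : s != ord0) (r_neq0 : r != ord0) :
  let rG := regular_repr E 'GL_2[A]%G in
  let I2chi := I2 iota red s r in
  let V := Vmod iota red (fun x => piA (teich x)) (piA varpi) s (r := r) in
  (forall x y : theta p f,
     (theta_class r x == theta_class r y) = theta_le r x y && theta_le r y x)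
  /\
  exists modV : forall t : ktype r, mxmodule rG (V t),
  let L := Lrep modV in
  [/\ JH_constituents rG I2chi [set: ktype r] L,
      forall t u : ktype r, (V u <= V t)%MS = ktype_le u t,
      forall t : ktype r,
        JH_constituents rG (V t) [set u | ktype_le u t] L
    & forall t : ktype r,
        ~ ((ktype_pair t).1 = [set: 'I_f]
           /\ expo_r2 r (ktype_pair t).2 = to_expo p f (p ^ f - 1)) ->
        irreducible_cosocle (modV t) (L t)].
Proof.
have f_gt0 : (0 < f)%N.
  by rewrite lt0n; apply/eqP => f0; have := finNzRing_gt1 k; rewrite card_k f0 expn0.
have dn : dual_numbers red (fun x => piA (teich x)) (piA varpi).
  exact: (quotient_dual_numbers p_prime QpP vP e_ge2 piAP redP card_k varpi_neq0 v_varpi teichP).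
have p_A : p \in [pchar A] by apply: (quotient_pchar p_prime QpP vP e_ge2 piAP).
have p_E : p \in [pchar E].
  rewrite inE p_prime /=; have := p_A; rewrite inE p_prime /= => /eqP pA0.
  by have := congr1 (iota \o red) pA0; rewrite /= !rmorph_nat !rmorph0 => ->.
move=> rG I2chi V; split; first exact: (theta_class_eq p_prime f_gt0 r_neq0).
set tau := (fun x => piA (teich x)) in dn V *; set w := piA varpi in dn V *.
pose bas := f_chi iota red tau w s r; pose B := basis_row red tau w iota s r.
have [a a0 FB] : exists2 a : theta p f -> E, (forall x, a x != 0) & forall x, bas x = a x *: B x.
  exists (fun x : theta p f => (-1) ^+ (if x.1 is Some j0 then j0 + x.2 else 0)%N).
    by move=> x; rewrite expf_neq0 // oppr_eq0 oner_neq0.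
  move=> x; exact: (f_chiE p_prime f_gt0 dn card_k).
have spanE P : span_of bas P = span_of B P := span_of_scale P a0 FB.
pose cl := theta_ktype r; pose kle := @ktype_le p f r.
have VE t : V t = below B cl kle t by apply: spanE.
have sVE t : strictly_below bas cl kle t = strictly_below B cl kle t.
  by apply: eq_bigr => u _; apply: spanE.
have modV t : mxmodule rG (V t).
  by rewrite VE; apply: (V_module p_prime f_gt0 dn card_k iota s p_E r_neq0).
have free := free_scale a0 FB (basis_row_free p_prime f_gt0 dn card_k (iota := iota) (s := s) r_neq0).
have onto := @cl_onto p f r.
have leE := ktype_leE p_prime f_gt0 r_neq0.
have cleq := cl_eq p_prime f_gt0 r_neq0.
have lerefl := @theta_le_refl p f r.
have letr := @theta_le_trans p f r.
have irr (t : ktype r) (W : 'M[E]_#|'GL_2[A]%G|) : mxmodule rG W -> (W <= V t)%MS ->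
    ~~ (W <= strictly_below bas cl kle t)%MS -> (V t <= W + strictly_below bas cl kle t)%MS.
  by rewrite VE sVE; apply: (V_irr p_prime f_gt0 dn card_k p_E r_neq0).
have JH := span_of_JH free onto leE lerefl letr cleq modV (Vlt_module modV) irr.
exists modV => L; split.
- apply: JH_eqmx (JH setT _) => [|t u _ _]; last by rewrite inE.
  rewrite spanE; apply: eqmx_trans (eqmx_sym (I2_span p_prime f_gt0 dn card_k iota s r_neq0)).
  have -> : span_of B (fun x => cl x \in [set: ktype r]) = span_of B predT.
    by apply: eq_bigl => x; rewrite inE.
  by [].
- move=> t u; exact: (below_leE free onto leE lerefl letr).
- move=> t.
  have <- : span_of bas (fun x => cl x \in [set u | kle u t]) = V t.
    by apply: eq_bigl => x; rewrite inE.
  apply: JH => t' u; rewrite !inE => ut'; exact: (kle_trans onto leE letr).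
move=> t; have [x0 <-] := onto t => notT.
have maxV := strictly_below_max free onto leE lerefl letr cleq irr.
have sVV := ltmxW (proj1 (maxV (cl x0))).
exists (Vlt iota red tau w s (cl x0)), (Vlt_module modV (cl x0)); split.
- move=> u; split.
    move=> uR; split=> [|M modM maxM]; first exact: submx_trans uR sVV.
    apply: submx_trans uR _; rewrite -[Vlt _ _ _ _ _ _]/(strictly_below bas cl kle (cl x0)) sVE.
    apply: (Vs_sub_max p_prime f_gt0 dn card_k p_E r_neq0 p_A modM); last exact: notT.
    exact: (eq_ind _ (fun Z => max_submod rG M Z) maxM _ (VE (cl x0))).
  by case=> _; apply; [exact: Vlt_module | exact: maxV].
- by apply/max_submodP; [exact: sVV | exact: maxV].
exact: mx_rsim_refl.
Qed.
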